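(* Let $\Gamma$ be a countable discrete group. (1) If $\mu\in\mathrm{Prob}(\Gamma)$ is a $C^*$-simple measure on $\Gamma$, then the Dirac measure $\delta_{\{e\}}$ at the trivial subgroup is the unique $\mu$-stationary Borel probability measure on $\mathrm{Sub}_a(\Gamma)$. (2) Conversely, if $\Gamma$ is not $C^*$-simple, then for no $\mu\in\mathrm{Prob}(\Gamma)$ is $\delta_{\{e\}}$ the unique $\mu$-stationary Borel probability measure on $\mathrm{Sub}_a(\Gamma)$.
   Context: $\mathrm{Sub}(\Gamma)$ is the set of all subgroups of $\Gamma$ with the compact topology inherited from $2^\Gamma$; $\Gamma$ acts on it by conjugation. $\mathrm{Sub}_a(\Gamma)$ is the closed $\Gamma$-invariant subset of amenable subgroups. A Borel probability measure $\nu$ on a compact $\Gamma$-space is $\mu$-stationary if $\sum_{g}\mu(g)\,g\nu=\nu$. $C^*_\lambda(\Gamma)\subset\mathcal{B}(\ell^2(\Gamma))$ is the reduced $C^*$-algebra (generated by the left regular representation $\lambda$); $\Gamma$ is $C^*$-simple if $C^*_\lambda(\Gamma)$ has no non-trivial proper closed two-sided ideal. $\Gamma$ acts on $C^*_\lambda(\Gamma)$ by $g\cdot a=\lambda_ga\lambda_{g^{-1}}$ and on states by $(g\tau)(a)=\tau(g^{-1}\cdot a)$; a state $\tau$ is $\mu$-stationary if $\sum_g\mu(g)\,g\tau=\tau$. A measure $\mu\in\mathrm{Prob}(\Gamma)$ is $C^*$-simple if the canonical trace $\tau_0$ (with $\tau_0(\lambda_g)=0$ for $g\neq e$, $\tau_0(\lambda_e)=1$)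 is the unique $\mu$-stationary state on $C^*_\lambda(\Gamma)$. *)

(* Defs.v *)
From HB Require Import structures.
From mathcomp Require Import all_boot all_order all_algebra finmap.
From mathcomp Require Import all_classical all_reals all_analysis.
From mathcomp Require Import summability complex.
From mathcomp Require Import ring.

Set Implicit Arguments.
Unset Strict Implicit.
Unset Printing Implicit Defensive.

Import Order.TTheory GRing.Theory Num.Theory.
Import numFieldNormedType.Exports.
Import ComplexField.Normc.

Local Open Scope classical_set_scope.
Local Open Scope complex_scope.
Local Open Scope ring_scope.

Section ell2.
Context {R : realType} {G : groupType}.
Implicit Types (f h : G -> R[i]) (F : set G).

Definition sqnorm f : \bar R := (\esum_(g in [set: G]) (normc (f g) ^+ 2)%:E)%E.

Definition square_summable : set (G -> R[i]) := [set f | (sqnorm f < +oo)%E].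

Lemma sqnorm_ge0 f : (0 <= sqnorm f)%E.
Proof. by apply: esum_ge0 => g _; rewrite lee_fin sqr_ge0. Qed.

Lemma normc_ge0 (z : R[i]) : 0 <= normc z.
Proof. by case: z => a b; exact: sqrtr_ge0. Qed.

Lemma esumZl (c : R) (a : G -> R) : 0 <= c -> (forall g, 0 <= a g) ->
  (\esum_(g in [set: G]) (c * a g)%:E = c%:E * \esum_(g in [set: G]) (a g)%:E)%E.
Proof.
move=> c0 a0.
have le (c' : R) (a' : G -> R) : 0 < c' -> (forall g, 0 <= a' g) ->
  (\esum_(g in [set: G]) (c' * a' g)%:E <=
   c'%:E * \esum_(g in [set: G]) (a' g)%:E)%E.
  move=> c'0 a'0; apply: ge_ereal_sup => _ [F [finF FG] <-].
  rewrite (eq_fsbigr (fun g => c'%:E * (a' g)%:E)%E); last first.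
    by move=> g _; rewrite EFinM.
  rewrite -ge0_mule_fsumr; last by move=> g; rewrite lee_fin.
  apply: lee_wpmul2l; first by rewrite lee_fin ltW.
  by apply: ereal_sup_ubound; exists F.
move: c0; rewrite le_eqVlt => /predU1P[<-|c0].
  by rewrite mul0e esum1// => g _; rewrite mul0r.
apply/eqP; rewrite eq_le le//=.
have -> : (\esum_(g in [set: G]) (a g)%:E =
           \esum_(g in [set: G]) (c^-1 * (c * a g))%:E)%E.
  by apply: eq_esum => g _; rewrite mulKf// gt_eqF.
have ca0 g : 0 <= c * a g by rewrite mulr_ge0// ltW.
have ci0 : 0 < c^-1 by rewrite invr_gt0.
have /(lee_wpmul2l (x := c%:E)) := le c^-1 (fun g => c * a g) ci0 ca0.
rewrite lee_fin (ltW c0) => /(_ isT) /le_trans; apply.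
by rewrite muleA -EFinM divff ?gt_eqF// mul1e.
Qed.

Lemma sqnormZ (c : R[i]) f :
  (sqnorm (c *: f) = (normc c ^+ 2)%:E * sqnorm f)%E.
Proof.
rewrite -esumZl; [|by rewrite sqr_ge0|by move=> g; rewrite sqr_ge0].
by apply: eq_esum => g _; rewrite /= normcM exprMn.
Qed.

Lemma sqnorm0 : sqnorm 0 = 0%E.
Proof. by apply: esum1 => g _; rewrite normc0 expr0n. Qed.

(* Convexity of the square, the parametrised form of Minkowski's inequality. *)
Lemma sqnormD f h (s t : R) : 0 < s -> 0 < t ->
  (sqnorm (f + h)%R <=
   (s + t)%:E * (s^-1%:E * sqnorm f + t^-1%:E * sqnorm h))%E.
Proof.
move=> s0 t0.
have sq0 (k : G -> R[i]) g : 0 <= normc (k g) ^+ 2 by rewrite sqr_ge0.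
have si0 : 0 <= s^-1 by rewrite invr_ge0 ltW.
have ti0 : 0 <= t^-1 by rewrite invr_ge0 ltW.
rewrite -!esumZl// -esumD; last 2 first.
- by move=> g _; rewrite lee_fin mulr_ge0.
- by move=> g _; rewrite lee_fin mulr_ge0.
rewrite -(esumZl (a := fun g => s^-1 * normc (f g) ^+ 2 + t^-1 * normc (h g) ^+ 2)).
- apply: le_esum => g _; rewrite lee_fin.
  set a := normc (f g); set b := normc (h g).
  apply: (@le_trans _ _ ((a + b) ^+ 2)).
    by rewrite lerXn2r ?nnegrE ?addr_ge0 ?normc_ge0// le_normcD.
  rewrite -subr_ge0.
  have -> : (s + t) * (s^-1 * a ^+ 2 + t^-1 * b ^+ 2) - (a + b) ^+ 2 =
            (s^-1 * t^-1) * (t * a - s * b) ^+ 2.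
    by field; rewrite !gt_eqF.
  by apply: mulr_ge0; rewrite ?sqr_ge0// mulr_ge0.
- by rewrite addr_ge0// ltW.
- by move=> g; rewrite addr_ge0// mulr_ge0.
Qed.

Lemma square_summable_submod : submod_closed (mem square_summable).
Proof.
split; first by rewrite inE /square_summable/= sqnorm0 ltry.
move=> c f h; rewrite !inE /square_summable/= => ff fh.
apply: le_lt_trans (sqnormD _ _ ltr01 ltr01) _.
rewrite invr1 !mul1e sqnormZ.
have fin k : (sqnorm k < +oo)%E -> sqnorm k = (fine (sqnorm k))%:E.
  by move=> kf; rewrite fineK// ge0_fin_numE ?sqnorm_ge0.
by rewrite (fin _ ff) (fin _ fh) -!(EFinM, EFinD) ltry.
Qed.

End ell2.

Definition ell2 (R : realType) (G : groupType) : Type :=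
  set_type (@square_summable R G).

Section ell2_normed.
Context (R : realType) (G : groupType).
Local Notation ell2 := (ell2 R G).

HB.instance Definition _ :=
  SubChoice.copy ell2 (set_type (@square_summable R G)).
HB.instance Definition _ := GRing.SubChoice_isSubLmodule.Build R[i] _ _ ell2
  square_summable_submod.

Definition ell2_fun (f : ell2) : G -> R[i] := val f.
Coercion ell2_fun : ell2 >-> Funclass.

Definition mk_ell2 (f : G -> R[i]) (sf : square_summable f) : ell2 :=
  exist _ f (mem_set sf).

Lemma ell2P (f h : ell2) : f =1 h -> f = h.
Proof. by move=> /funext; exact: val_inj. Qed.

Definition ell2_norm (f : ell2) : R := Num.sqrt (fine (sqnorm f)).

Lemma sqnorm_ell2 (f : ell2) : sqnorm f = (ell2_norm f ^+ 2)%:E.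
Proof.
have : ell2_fun f \in square_summable by exact: valP.
rewrite inE /square_summable/= => ff.
have fin : sqnorm f \is a fin_num by rewrite ge0_fin_numE ?sqnorm_ge0.
by rewrite /ell2_norm sqr_sqrtr ?fine_ge0 ?sqnorm_ge0// fineK.
Qed.

Lemma ell2_norm_ge0 f : 0 <= ell2_norm f.
Proof. exact: sqrtr_ge0. Qed.

Lemma normc_le_ell2_norm (f : ell2) g : normc (f g) <= ell2_norm f.
Proof.
rewrite -ler_sqr ?nnegrE ?normc_ge0 ?ell2_norm_ge0//.
rewrite -lee_fin -sqnorm_ell2; apply: esum_ge; exists [set g]; first by split.
by rewrite fsbig_set1.
Qed.

Lemma ell2_norm_eq0 (f : ell2) : ell2_norm f = 0 -> f = 0.
Proof.
move=> f0; apply/ell2P => g /=; apply: eq0_normc; apply/eqP.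
by rewrite eq_le normc_ge0 -[X in _ <= X]f0 normc_le_ell2_norm.
Qed.

Lemma ell2_normZ (c : R[i]) (f : ell2) :
  ell2_norm (c *: f) = normc c * ell2_norm f.
Proof.
apply/eqP; rewrite -(@eqrXn2 _ 2) ?mulr_ge0 ?ell2_norm_ge0 ?normc_ge0//.
rewrite exprMn; apply/eqP/EFin_inj.
by rewrite [RHS]EFinM -!sqnorm_ell2 -sqnormZ.
Qed.

Lemma ell2_normD (f h : ell2) : ell2_norm (f + h) <= ell2_norm f + ell2_norm h.
Proof.
have [/ell2_norm_eq0->|f0] := eqVneq (ell2_norm f) 0.
  by rewrite !add0r lerDr ell2_norm_ge0.
have [/ell2_norm_eq0->|h0] := eqVneq (ell2_norm h) 0.
  by rewrite !addr0 lerDl ell2_norm_ge0.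
have {}f0 : 0 < ell2_norm f by rewrite lt_neqAle eq_sym f0 ell2_norm_ge0.
have {}h0 : 0 < ell2_norm h by rewrite lt_neqAle eq_sym h0 ell2_norm_ge0.
rewrite -ler_sqr ?nnegrE ?addr_ge0 ?ell2_norm_ge0// -lee_fin -sqnorm_ell2.
apply: le_trans (sqnormD _ _ f0 h0) _.
by rewrite !sqnorm_ell2 -!(EFinM, EFinD) lee_fin !expr2 !mulKf ?gt_eqF.
Qed.

Definition ell2_cnorm (f : ell2) : R[i] := (ell2_norm f)%:C.

Fact ell2_cnorm_triangle f h : ell2_cnorm (f + h) <= ell2_cnorm f + ell2_cnorm h.
Proof. by rewrite -rmorphD lecR ell2_normD. Qed.

Fact ell2_cnorm_scale (c : R[i]) f : ell2_cnorm (c *: f) = `|c| * ell2_cnorm f.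
Proof. by rewrite /ell2_cnorm ell2_normZ rmorphM; case: c. Qed.

Fact ell2_cnorm_eq0 f : ell2_cnorm f = 0 -> f = 0.
Proof. by case=> /ell2_norm_eq0. Qed.

HB.instance Definition _ :=
  Lmodule_isNormed.Build R[i] ell2 ell2_cnorm_triangle ell2_cnorm_scale ell2_cnorm_eq0.

End ell2_normed.

Section bounded_operators.
Context (R : realType) (G : groupType).
Local Notation ell2 := (ell2 R G).

Definition bounded_operator : set (ell2 -> ell2) :=
  [set T | linear T /\
    exists M : R, forall f, ell2_norm (T f) <= M * ell2_norm f].

Lemma bounded_operator_submod : submod_closed (mem bounded_operator).
Proof.
split.
  rewrite inE; split; first by move=> c f h /=; rewrite scaler0 addr0.
  exists 0 => f; rewrite mul0r.
  by rewrite -[X in ell2_norm X](scale0r 0) ell2_normZ normc0 mul0r.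
move=> c S T; rewrite !inE => -[linS [M SM]] [linT [N TN]]; split.
  move=> d f h; rewrite -[LHS]/(c *: S (d *: f + h) + T (d *: f + h)).
  rewrite -[RHS]/(d *: (c *: S f + T f) + (c *: S h + T h)).
  rewrite linS linT !scalerDr !scalerA (mulrC c d).
  by rewrite -!addrA; congr (_ + _); rewrite addrCA.
exists (normc c * M + N) => f /=.
rewrite (le_trans (ell2_normD _ _))// ell2_normZ mulrDl -mulrA.
by rewrite lerD// ler_wpM2l// normc_ge0.
Qed.

End bounded_operators.

(* The algebra B(l^2(G)) of bounded operators, made below into an algebra for
   composition and a normed module for the operator norm. *)
Definition bop (R : realType) (G : groupType) : Type :=
  set_type (@bounded_operator R G).

Section bop_algebra.
Context (R : realType) (G : groupType).
Local Notation ell2 := (ell2 R G).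
Local Notation bop := (bop R G).
Implicit Types S T U : bop.

HB.instance Definition _ :=
  SubChoice.copy bop (set_type (@bounded_operator R G)).
HB.instance Definition _ := GRing.SubChoice_isSubLmodule.Build R[i] _ _ bop
  (@bounded_operator_submod R G).

Definition bop_fun T : ell2 -> ell2 := val T.
Coercion bop_fun : bop >-> Funclass.

Lemma bop_boundedP T : bounded_operator T.
Proof. by have := valP T; rewrite inE. Qed.

Definition mk_bop (T : ell2 -> ell2) (bT : bounded_operator T) : bop :=
  exist _ T (mem_set bT).

Lemma bop_linear T : linear T.
Proof. by have [] := bop_boundedP T. Qed.

HB.instance Definition _ T :=
  GRing.isLinear.Build R[i] ell2 ell2 _ (bop_fun T) (bop_linear T).

Lemma bopP S T : S =1 T -> S = T.
Proof. by move=> /funext; exact: val_inj. Qed.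

Lemma bounded_comp S T : bounded_operator (S \o T).
Proof.
split; first by move=> c f h; rewrite /= !linearP.
have [_ [M SM]] := bop_boundedP S; have [_ [N TN]] := bop_boundedP T.
exists (`|M| * N) => f /=; rewrite (le_trans (SM _))//.
rewrite (le_trans (ler_wpM2r (ell2_norm_ge0 _) (ler_norm M)))// -mulrA.
by rewrite ler_wpM2l.
Qed.

Lemma bounded_id : bounded_operator (@id ell2).
Proof. by split=> //; exists 1 => f; rewrite mul1r. Qed.

Definition bop_mul S T : bop := mk_bop (bounded_comp S T).
Definition bop_one : bop := mk_bop bounded_id.

Fact bop_mulA : associative bop_mul.
Proof. by move=> S T U; exact: val_inj. Qed.

Fact bop_mul1 : left_id bop_one bop_mul.
Proof. by move=> T; exact: val_inj. Qed.

Fact bop_mulr1 : right_id bop_one bop_mul.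
Proof. by move=> T; exact: val_inj. Qed.

Fact bop_mulDl : left_distributive bop_mul +%R.
Proof. by move=> S T U; exact: val_inj. Qed.

Fact bop_mulDr : right_distributive bop_mul +%R.
Proof.
move=> S T U; apply/bopP => f.
by rewrite -[LHS]/(S (T f + U f)) linearD.
Qed.

Lemma sqnorm_delta (g : G) :
  sqnorm (fun x => (x == g)%:R : R[i]) = 1%E.
Proof.
rewrite -[RHS](@esum_set1 R G g (fun=> 1%E)) ?lee01// [RHS]esum_mkcond.
apply: eq_esum => x _; have [->|xg] := eqVneq x g.
  by rewrite mem_set// normc1 expr1n.
by rewrite memNset ?normc0 ?expr0n// => xg'; rewrite xg' eqxx in xg.
Qed.

Lemma square_summable_delta (g : G) :
  square_summable (fun x => (x == g)%:R : R[i]).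
Proof. by rewrite /square_summable/= sqnorm_delta ltry. Qed.

Definition delta (g : G) : ell2 := mk_ell2 (square_summable_delta g).

Fact bop_one_neq0 : bop_one != 0.
Proof.
apply/eqP => /(congr1 (fun T : bop => T (delta 1%g) 1%g)).
rewrite -[LHS]/((1%g == 1%g :> G)%:R) -[RHS]/0 eqxx => /eqP.
by rewrite oner_eq0.
Qed.

HB.instance Definition _ := GRing.Zmodule_isNzRing.Build bop
  bop_mulA bop_mul1 bop_mulr1 bop_mulDl bop_mulDr bop_one_neq0.

Fact bop_scaleAl (c : R[i]) S T : c *: (S * T) = (c *: S) * T.
Proof. exact: val_inj. Qed.

HB.instance Definition _ := GRing.Lmodule_isLalgebra.Build R[i] bop bop_scaleAl.

Fact bop_scaleAr (c : R[i]) S T : c *: (S * T) = S * (c *: T).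
Proof. by apply/bopP => f; rewrite -[RHS]/(S (c *: T f)) linearZ. Qed.

HB.instance Definition _ := GRing.Lalgebra_isAlgebra.Build R[i] bop bop_scaleAr.

Definition opnorm T : R :=
  sup [set ell2_norm (T f) | f in [set f | ell2_norm f <= 1]].

Lemma ell2_norm0 : ell2_norm (0 : ell2) = 0.
Proof. by rewrite -[X in ell2_norm X](scale0r 0) ell2_normZ normc0 mul0r. Qed.

Lemma opnorm_has_sup T :
  has_sup [set ell2_norm (T f) | f in [set f | ell2_norm f <= 1]].
Proof.
split; first by exists (ell2_norm (T 0)), 0; rewrite //= ell2_norm0.
have [_ [M TM]] := bop_boundedP T; exists `|M| => _ [f /= f1 <-].
rewrite (le_trans (TM f))// (le_trans (ler_wpM2r (ell2_norm_ge0 _) (ler_norm M)))//.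
by rewrite ler_piMr.
Qed.

Lemma opnormP T f : ell2_norm (T f) <= opnorm T * ell2_norm f.
Proof.
have [/ell2_norm_eq0->|f0] := eqVneq (ell2_norm f) 0.
  by rewrite linear0 ell2_norm0 mulr0.
have {}f0 : 0 < ell2_norm f by rewrite lt_neqAle eq_sym f0 ell2_norm_ge0.
rewrite -ler_pdivrMr//.
have nf : normc ((ell2_norm f)^-1%:C) = (ell2_norm f)^-1.
  by rewrite /= expr0n addr0 sqrtr_sqr ger0_norm// invr_ge0 ltW.
rewrite mulrC -nf -ell2_normZ -linearZ/=.
apply: (ub_le_sup (opnorm_has_sup T).2); exists ((ell2_norm f)^-1%:C *: f) => //=.
by rewrite ell2_normZ nf mulVf// gt_eqF.
Qed.

Lemma opnorm_le T (M : R) :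
  (forall f, ell2_norm f <= 1 -> ell2_norm (T f) <= M) -> opnorm T <= M.
Proof.
move=> TM; apply: ge_sup; first exact: (opnorm_has_sup T).1.
by move=> _ [f /= f1 <-]; exact: TM.
Qed.

Lemma opnorm_ge0 T : 0 <= opnorm T.
Proof.
apply: le_trans (ell2_norm_ge0 (T 0)) _.
by apply: (ub_le_sup (opnorm_has_sup T).2); exists 0; rewrite //= ell2_norm0.
Qed.

Lemma opnormD S T : opnorm (S + T) <= opnorm S + opnorm T.
Proof.
apply: opnorm_le => f f1 /=; rewrite (le_trans (ell2_normD _ _))// lerD//.
  by rewrite (le_trans (opnormP _ _))// ler_piMr// opnorm_ge0.
by rewrite (le_trans (opnormP _ _))// ler_piMr// opnorm_ge0.
Qed.

Lemma opnorm_eq0 T : opnorm T = 0 -> T = 0.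
Proof.
move=> T0; apply/bopP => f; apply: ell2_norm_eq0; apply/eqP.
by rewrite eq_le ell2_norm_ge0 (le_trans (opnormP _ _))// T0 mul0r.
Qed.

Lemma opnormZ (c : R[i]) T : opnorm (c *: T) = normc c * opnorm T.
Proof.
have le (d : R[i]) S : opnorm (d *: S) <= normc d * opnorm S.
  apply: opnorm_le => f f1 /=; rewrite ell2_normZ ler_wpM2l ?normc_ge0//.
  by rewrite (le_trans (opnormP _ _))// ler_piMr// opnorm_ge0.
apply/eqP; rewrite eq_le le/=.
have [->|c0] := eqVneq c 0; first by rewrite normc0 mul0r opnorm_ge0.
have nc0 : 0 < normc c.
  rewrite lt_neqAle normc_ge0 andbT eq_sym; apply: contra_neq c0.
  exact: eq0_normc.
by rewrite mulrC -ler_pdivlMr// mulrC -normcV -[X in opnorm X <= _](scalerK c0) le.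
Qed.

Definition bop_cnorm T : R[i] := (opnorm T)%:C.

Fact bop_cnorm_triangle S T : bop_cnorm (S + T) <= bop_cnorm S + bop_cnorm T.
Proof. by rewrite -rmorphD lecR opnormD. Qed.

Fact bop_cnorm_scale (c : R[i]) T : bop_cnorm (c *: T) = `|c| * bop_cnorm T.
Proof. by rewrite /bop_cnorm opnormZ rmorphM; case: c. Qed.

Fact bop_cnorm_eq0 T : bop_cnorm T = 0 -> T = 0.
Proof. by case=> /opnorm_eq0. Qed.

HB.instance Definition _ :=
  Lmodule_isNormed.Build R[i] bop bop_cnorm_triangle bop_cnorm_scale bop_cnorm_eq0.

Lemma sqnorm_translate (g : G) (f : G -> R[i]) :
  sqnorm (fun x => f (g^-1 * x)%g) = sqnorm f.
Proof.
rewrite /sqnorm [RHS](@reindex_esum _ _ _ setT setT (fun x => (g^-1 * x)%g))//.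
split => //; first by move=> x y _ _ /mulgI.
by move=> x _; exists (g * x)%g => //; rewrite mulKg.
Qed.

Lemma square_summable_translate (g : G) (f : ell2) :
  square_summable (fun x => f (g^-1 * x)%g).
Proof.
by rewrite /square_summable/= sqnorm_translate; have := valP f; rewrite inE.
Qed.

Definition translate (g : G) (f : ell2) : ell2 :=
  mk_ell2 (square_summable_translate g f).

Lemma bounded_translate (g : G) : bounded_operator (translate g).
Proof.
split; first by move=> c f h; exact: val_inj.
by exists 1 => f; rewrite mul1r /ell2_norm/= sqnorm_translate.
Qed.

Definition lambda (g : G) : bop := mk_bop (bounded_translate g).

Lemma lambda1 : lambda 1%g = 1.
Proof.
apply/bopP => f; apply/ell2P => x.
by rewrite -[LHS]/(f (1^-1 * x)%g) invg1 mul1g.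
Qed.

Lemma lambdaM g h : lambda (g * h)%g = lambda g * lambda h.
Proof.
apply/bopP => f; apply/ell2P => x.
by rewrite -[LHS]/(f ((g * h)^-1 * x)%g) invgM -mulgA.
Qed.

(* The inner product, as an unordered sum over G; it is linear in the first
   variable. *)
Definition inner (f h : ell2) : R[i] :=
  summability.sum (fun g => f g * (h g)^* : (R[i])^o).

(* T is the adjoint of S; it exists and is unique by Riesz representation. *)
Definition is_adjoint S T := forall f h, inner (S f) h = inner f (T h).

Definition star_subalgebra (A : set bop) :=
  subalg_closed (mem A) /\ forall S T, A S -> is_adjoint S T -> A T.

Definition cstar_lambda : set bop :=
  smallest [set A | star_subalgebra A /\ closed A] (range lambda).

Lemma cstar_lambda_sub (A : set bop) :
  star_subalgebra A -> closed A -> range lambda `<=` A -> cstar_lambda `<=` A.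
Proof. by move=> sA cA lA T; apply; split. Qed.

Lemma cstar_lambda_gen (g : G) : cstar_lambda (lambda g).
Proof. by move=> A [_]; apply; exists g. Qed.

Lemma cstar_lambda_subalg : subalg_closed (mem cstar_lambda).
Proof.
split; first by rewrite inE -lambda1; exact: cstar_lambda_gen.
- move=> c S T; rewrite !inE => CS CT A sA; have [[[[_ lin _] _] _] _] := sA.
  by have := lin c S T; rewrite !inE; apply; [exact: CS|exact: CT].
- move=> S T; rewrite !inE => CS CT A sA; have [[[[_ _ mul] _] _] _] := sA.
  by have := mul S T; rewrite !inE; apply; [exact: CS|exact: CT].
Qed.

End bop_algebra.

(* The reduced C*-algebra, with the norm topology inherited from B(l^2(G)). *)
Definition Cstar (R : realType) (G : groupType) : Type :=
  set_type (@cstar_lambda R G).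

Section Cstar.
Context (R : realType) (G : groupType).
Local Notation bop := (bop R G).
Local Notation Cstar := (Cstar R G).

HB.instance Definition _ :=
  SubChoice.copy Cstar (set_type (@cstar_lambda R G)).
HB.instance Definition _ := GRing.SubChoice_isSubAlgebra.Build R[i] _ _ Cstar
  (@cstar_lambda_subalg R G).
HB.instance Definition _ :=
  Topological.copy Cstar (set_type (@cstar_lambda R G)).

Definition mk_Cstar (T : bop) (CT : cstar_lambda T) : Cstar :=
  exist _ T (mem_set CT).

Definition Cstar_lambda (g : G) : Cstar := mk_Cstar (cstar_lambda_gen g).

Definition closed_ideal (J : set Cstar) :=
  [/\ submod_closed (mem J),
      forall a b, J b -> J (a * b) /\ J (b * a) &
      closed J].

Definition Cstar_simple :=
  forall J : set Cstar, closed_ideal J -> J = [set 0] \/ J = [set: Cstar].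

(* b ranges over the adjoints of a, so that b * a is a^* a. *)
Definition state (tau : {scalar Cstar}) :=
  (forall a b : Cstar, is_adjoint (val a) (val b) -> 0 <= tau (b * a)) /\
  tau 1 = 1.

Definition Cstar_act (g : G) (a : Cstar) : Cstar :=
  Cstar_lambda g * a * Cstar_lambda g^-1%g.

(* The sum of mu g (g tau) converges pointwise to tau, as an unordered sum,
   where (g tau) a = tau (g^-1 . a). *)
Definition stationary_state (mu : G -> R) (tau : {scalar Cstar}) :=
  forall a, partial_sum (fun g => (mu g)%:C * tau (Cstar_act g^-1%g a)) @ totally
    --> (tau a : (R[i])^o).

Definition canonical_trace_fun (a : Cstar) : R[i] :=
  inner (bop_fun (val a) (delta R 1%g)) (delta R 1%g).

Lemma inner_delta (f : ell2 R G) g : inner f (delta R g) = f g.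
Proof.
rewrite /inner /summability.sum.
have FF := @totally_filter G.
apply: (@cvg_lim (R[i])^o); first exact: norm_hausdorff.
apply: cvg_near_cst; exists [fset g]%fset => // A /=; rewrite fsub1set => gA.
rewrite /partial_sum -(big_seq_fsetE _ A xpredT (fun i => f i * (delta R g i)^*)).
rewrite (bigD1_seq g)//=; last exact: fset_uniq.
have dE x : delta R g x = (x == g)%:R by [].
rewrite dE eqxx conjC1 mulr1 -[RHS]addr0; congr (_ + _).
by apply: big1 => x xg; rewrite dE (negbTE xg) conjC0 mulr0.
Qed.

Fact canonical_trace_linear : scalar canonical_trace_fun.
Proof. by move=> c a b; rewrite /canonical_trace_fun !inner_delta. Qed.

HB.instance Definition _ := GRing.isLinear.Build R[i] Cstar R[i] *%R
  canonical_trace_fun canonical_trace_linear.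

Definition canonical_trace : {scalar Cstar} := canonical_trace_fun.

Lemma canonical_trace_lambda g : canonical_trace (Cstar_lambda g) = (g == 1%g)%:R.
Proof.
rewrite -[LHS]/(canonical_trace_fun (Cstar_lambda g)) /canonical_trace_fun inner_delta.
by rewrite -[LHS]/((g^-1 * 1 == 1)%g%:R) mulg1 invg_eq1.
Qed.

Definition Cstar_simple_measure (mu : G -> R) :=
  [/\ state canonical_trace, stationary_state mu canonical_trace &
      forall tau, state tau -> stationary_state mu tau -> tau =1 canonical_trace].

End Cstar.

Section amenable_subgroups.
Context (R : realType) (G : groupType).

(* The subgroups of G, inside 2^G with the product topology. *)
Definition Sub : set {ptws G -> bool} :=
  [set H : {ptws G -> bool} | group_closed (H : pred G)].

(* von Neumann amenability of a subgroup H: a finitely additive probability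
   measure on the subsets of H, invariant under left translation by H. The
   values of m on other subsets of G are irrelevant. *)
Definition amenable (H : set G) := exists m : set G -> R,
  [/\ forall A, 0 <= m A,
      m H = 1,
      forall A B, A `<=` H -> B `<=` H -> A `&` B = set0 ->
        m (A `|` B) = m A + m B &
      forall h A, H h -> A `<=` H -> m [set (h * x)%g | x in A] = m A].

Definition amenable_subgroup : set {ptws G -> bool} :=
  [set H | Sub H /\ amenable [set x | H x]].

(* g H g^-1, since x ^ g = g^-1 * x * g; see conj_subgroupE. *)
Definition conj_subgroup (g : G) (H : {ptws G -> bool}) : {ptws G -> bool} :=
  fun x => H (x ^ g)%g.

Lemma conj_subgroupE g H :
  [set x | conj_subgroup g H x] = [set (g * x * g^-1)%g | x in [set x | H x]].
Proof.
apply/seteqP; split => x /=; rewrite /conj_subgroup.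
  by move=> Hx; exists (x ^ g)%g; rewrite // conjgE -!mulgA mulgV mulg1 mulVKg.
by move=> [y Hy <-]; rewrite conjgE !mulgA mulVg mul1g mulgVK.
Qed.

Lemma conj_amenable_subgroup g H :
  amenable_subgroup H -> amenable_subgroup (conj_subgroup g H).
Proof.
move=> [[H1 HF] [m [m0 mH mD mM]]]; split.
  split; first by rewrite unfold_in /conj_subgroup conj1g.
  move=> x y; rewrite !unfold_in /conj_subgroup conjMg conjVg.
  exact: HF.
have inj : injective (conjg^~ g) by exact: conjg_inj.
have sub A : A `<=` [set x | conj_subgroup g H x] ->
    [set (x ^ g)%g | x in A] `<=` [set x | H x].
  by move=> sA _ [x /sA Ax <-].
exists (fun A => m [set (x ^ g)%g | x in A]); split => //.
- rewrite -[RHS]mH; congr m; apply/seteqP; split; first exact: sub.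
  move=> x /= Hx; exists (x ^ g^-1)%g; last exact: conjgKV.
  by change (H ((x ^ g^-1) ^ g)%g); rewrite conjgKV.
- move=> A B sA sB AB; rewrite image_setU mD//; [exact: sub|exact: sub|].
  apply/seteqP; split => // _ [[x Ax <-] [y By /inj xy]].
  by move: (conj Ax By); rewrite xy -[_ /\ _]/((A `&` B) x) AB.
- move=> h A Hh sA; rewrite -[RHS](mM (h ^ g)%g)//; last exact: sub.
  congr m; rewrite !image_comp; apply: eq_imagel => x _ /=.
  by rewrite conjMg.
Qed.

Lemma trivial_amenable_subgroup :
  amenable_subgroup (fun x => x == 1%g : bool).
Proof.
split.
  split; first by rewrite unfold_in.
  by move=> x y; rewrite !unfold_in => /eqP-> /eqP->; rewrite divgg.
exists (fun A => (1%g \in A)%:R); split => //.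
- by rewrite mem_set//=.
- move=> A B _ _ AB; rewrite in_setU -natrD.
  have := in_setI 1%g A B.
  by rewrite AB in_set0; case: (_ \in A) (_ \in B) => -[].
- move=> h A /= /eqP-> _; congr (nat_of_bool _)%:R; congr (_ \in _).
  by under eq_imagel do rewrite mul1g; rewrite image_id.
Qed.

End amenable_subgroups.

(* The space of amenable subgroups, with the topology induced from 2^G and the
   Borel sigma-algebra of that topology. *)
Definition Suba (R : realType) (G : groupType) : Type :=
  set_type (@amenable_subgroup R G).

Section Suba.
Context (R : realType) (G : groupType).
Local Notation Suba := (Suba R G).

Definition mk_Suba (H : {ptws G -> bool}) (aH : amenable_subgroup R H) : Suba :=
  exist _ H (mem_set aH).

Definition trivial_subgroup : Suba := mk_Suba (trivial_amenable_subgroup R G).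

HB.instance Definition _ :=
  Topological.copy Suba (set_type (@amenable_subgroup R G)).
HB.instance Definition _ := isPointed.Build Suba trivial_subgroup.

Definition Suba_act (g : G) (H : Suba) : Suba :=
  mk_Suba (conj_amenable_subgroup g (set_mem (valP H))).

HB.instance Definition _ :=
  Measurable.copy Suba (g_sigma_algebraType (@open Suba)).

Definition prob (mu : G -> R) :=
  (forall g, 0 <= mu g) /\ (\esum_(g in [set: G]) (mu g)%:E = 1)%E.

Definition stationary_measure (mu : G -> R) (nu : probability Suba R) :=
  forall A : set Suba, measurable A ->
    (\esum_(g in [set: G]) ((mu g)%:E * pushforward nu (Suba_act g) A)
     = nu A)%E.

Definition dirac_trivial : probability Suba R := dirac trivial_subgroup.

Definition unique_stationary_dirac (mu : G -> R) :=
  stationary_measure mu dirac_trivial /\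
  forall nu : probability Suba R, stationary_measure mu nu ->
    forall A : set Suba, measurable A -> nu A = dirac_trivial A.

End Suba.

(* Main.v *)
(* Part (1). A stationary measure nu on Sub_a(G) gives the functional
   lambda_g |-> nu {K | g \in K}. For an amenable K, the indicator function of K is a
   functional of norm one on C*_lambda(G) (Kesten, Hulanicki), so by averaging this
   functional is a stationary state; hence it is the canonical trace, and nu-almost no K
   contains a given g <> 1.

   Part (2). A non-trivial ideal yields states on B(l^2(G)) that stay away from the trace
   along the whole conjugation orbit. Composing such a state with a mean on G and
   maximising a convex functional of the result produces, in an ultralimit, a finitely
   additive probability on G whose stabiliser H is amenable, together with a finite set F
   of non-trivial elements that meets every conjugate of H. For a
   mu-stationary finitely additive probability M on G (an ultralimit of Cesaro averages of
   convolution powers), the clopen content C |-> M {g | g.H \in C} extends to a stationary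
   Borel measure on the compact space Sub_a(G), and it gives full mass to the subgroups
   that meet F, whereas the Dirac measure at the trivial subgroup gives them mass 0. *)

From HB Require Import structures.
Require Import Defs.
From mathcomp Require Import all_boot all_order all_algebra finmap.
From mathcomp Require Import all_classical all_reals all_analysis.
From mathcomp Require Import summability complex.
From mathcomp Require Import ring lra zify.

Set Implicit Arguments.
Unset Strict Implicit.
Unset Printing Implicit Defensive.

Import Order.TTheory GRing.Theory Num.Theory.
Import numFieldNormedType.Exports.
Import ComplexField.Normc.

Local Open Scope classical_set_scope.
Local Open Scope complex_scope.
Local Open Scope ring_scope.

(* Maximising the convex functional serves to make variances small: a state for which a
   multiplication operator has variance near 0 treats it almost as a scalar, on either side of a
   product. When this holds for the Poisson transforms of [A] and [g A], which [lambda g]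
   intertwines, the product of [rho (lambda g)] and [m (g A) - m A] is almost 0. In the limit every
   [g] that the state does not kill stabilises [m], and a state far from the trace cannot kill too
   many [g]. The maximum is only approached, for finitely many sets at a time; ultralimits over
   finite sets of constraints play the role of weak compactness. Since [F] is finite, the subgroups
   meeting it form a clopen set, whose measure is read off the content.

   In part (1), amenability supplies an invariant finitely additive measure, while the norm estimate
   wants almost invariant vectors in l^2. Without such vectors there is a spectral gap, hence a
   positive function that averaging shrinks by a fixed factor; the increments of its logarithm would
   then have mean sum both 0 and negative. *)
#[local] Existing Instance totally_filter.

(** * Unordered sums and the inner product of l^2(G) *)

Section unordered_sums.
Context {R : realType} {I : choiceType}.
Implicit Types (a : I -> R) (A B : {fset I}).

Lemma partial_sumE (V : zmodType) (x : I -> V) A :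
  partial_sum x A = \sum_(i <- A) x i.
Proof. by rewrite /partial_sum -(big_seq_fsetE _ A xpredT). Qed.

Lemma partial_sum_le_esum a A : (forall i, 0 <= a i) ->
  ((partial_sum a A)%:E <= \esum_(i in [set: I]) (a i)%:E)%E.
Proof.
move=> a0; apply: esum_ge; exists [set` A]; first by split => //; exact: finite_fset.
by rewrite fsbig_finite//= set_fsetK sumEFin lee_fin partial_sumE.
Qed.

Lemma partial_sum_mono a A B : (forall i, 0 <= a i) -> (A `<=` B)%fset ->
  partial_sum a A <= partial_sum a B.
Proof.
move=> a0 AB; rewrite !partial_sumE [leRHS](big_fsetID _ (mem A))/=.
have -> : [fset x | x in B & x \in A]%fset = A.
  by apply/fsetP => x; rewrite !inE/= andbC; case: (boolP (x \in A)) => //= /(fsubsetP AB).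
by rewrite lerDl; apply: sumr_ge0.
Qed.

Lemma cvg_partial_sum a (l : R) : (forall i, 0 <= a i) ->
  (\esum_(i in [set: I]) (a i)%:E = l%:E)%E ->
  partial_sum a @ totally --> l.
Proof.
move=> a0 al; apply/(@cvgrPdist_le _ R) => e e0.
have : (l%:E - e%:E < \esum_(i in [set: I]) (a i)%:E)%E.
  by rewrite al -EFinB lte_fin ltrBlDr ltrDl.
move=> /ereal_sup_gt[_ [F [finF _] <-] lF].
exists (fset_set F) => // A /= FA.
have := partial_sum_le_esum A a0; rewrite al lee_fin => Al.
rewrite ger0_norm ?subr_ge0// lerBlDl -lerBlDr.
apply: le_trans (partial_sum_mono a0 FA).
by move: lF; rewrite fsbig_finite// sumEFin -EFinB lte_fin partial_sumE => /ltW.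
Qed.

End unordered_sums.

Section complex_limits.
Context {R : realType}.

Lemma normc_sqr (z : R[i]) : normc z ^+ 2 = complex.Re z ^+ 2 + complex.Im z ^+ 2.
Proof. by case: z => a b; rewrite /= sqr_sqrtr// addr_ge0 ?sqr_ge0. Qed.

Lemma normc_def (z : R[i]) : `|z| = (normc z)%:C.
Proof. by case: z. Qed.

Lemma cvg_realC {T} (F : set_system T) {FF : Filter F} (f : T -> R) (l : R) :
  f @ F --> l -> (fun t => (f t)%:C : (R[i])^o) @ F --> (l%:C : (R[i])^o).
Proof.
move=> fl; apply/cvgrPdist_lt => e e0.
(* In the order of [R[i]], a positive number is real. *)
have [Re0 Ie0] : 0 < complex.Re e /\ complex.Im e = 0.
  by move: e0; rewrite ltcE => /andP[/eqP-> /=].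
have eE : e = (complex.Re e)%:C by case: e Ie0 {e0 Re0} => a b /= ->.
move/cvgrPdist_lt : fl => /(_ _ Re0); apply: filterS => t.
rewrite eE -rmorphB/= normc_def /= ltcR; congr (_ < _).
by rewrite expr0n addr0 sqrtr_sqr.
Qed.

End complex_limits.

Lemma conjC_real {R : realType} (a : R) : (a%:C)^* = a%:C :> R[i].
Proof. exact: conjc_real. Qed.

Section pointwise.
Context {R : realType} {G : groupType}.
Implicit Types (f h : ell2 R G) (S T : bop R G).

Lemma ell2DE f h x : (f + h : ell2 R G) x = f x + h x.
Proof. by []. Qed.

Lemma ell2ZE (c : R[i]) f x : (c *: f : ell2 R G) x = c * f x.
Proof. by []. Qed.

Lemma bopDE S T f : (S + T : bop R G) f = S f + T f.
Proof. by []. Qed.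

Lemma bopNE T f : (- T : bop R G) f = - T f.
Proof. by []. Qed.

Lemma bop1E f : (1 : bop R G) f = f.
Proof. by []. Qed.

Lemma bopZE (c : R[i]) T f : (c *: T : bop R G) f = c *: T f.
Proof. by []. Qed.

Lemma bopME S T f : (S * T : bop R G) f = S (T f).
Proof. by []. Qed.

Lemma bop_sumE (I : Type) (r : seq I) (F : I -> bop R G) f :
  (\sum_(i <- r) F i : bop R G) f = \sum_(i <- r) F i f.
Proof.
elim: r => [|i r IH]; first by rewrite !big_nil.
by rewrite !big_cons bopDE IH.
Qed.

Lemma ell2_sumE (I : Type) (r : seq I) (P : pred I) (F : I -> ell2 R G) x :
  (\sum_(i <- r | P i) F i : ell2 R G) x = \sum_(i <- r | P i) F i x.
Proof.
elim: r => [|i r IH]; first by rewrite !big_nil.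
by rewrite !big_cons; case: (P i); rewrite ?ell2DE IH.
Qed.

End pointwise.

Section inner_product.
Context {R : realType} {G : groupType}.
Local Notation ell2 := (ell2 R G).
Implicit Types (f h k : ell2) (z : R[i]).

Lemma polarization_pt (z w : R[i]) :
  z * w^* = 4^-1 * ((normc (z + w) ^+ 2 - normc (z - w) ^+ 2)%:C +
    'i * (normc (z + 'i * w) ^+ 2 - normc (z - 'i * w) ^+ 2)%:C).
Proof.
apply: (@mulfI _ 4%:R); first by rewrite pnatr_eq0.
rewrite mulVKf ?pnatr_eq0// !normc_sqr.
by case: z w => [a b] [c d]; simpc; congr (_ +i* _)%C; rewrite /=; ring.
Qed.

Lemma cvg_sqnorm f :
  partial_sum (fun g => (normc (f g) ^+ 2)%:C : (R[i])^o) @ totally -->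
  ((ell2_norm f ^+ 2)%:C : (R[i])^o).
Proof.
have := @cvg_partial_sum R G (fun g => normc (f g) ^+ 2) (ell2_norm f ^+ 2)
  (fun=> sqr_ge0 _) (sqnorm_ell2 f).
move=> /(@cvg_realC R _ totally _).
rewrite (_ : (fun A => _) = partial_sum (fun g => (normc (f g) ^+ 2)%:C)) //.
by apply/funext => A; rewrite /partial_sum -rmorph_sum.
Qed.

(** Polarization reduces the convergence of the unordered sum to that of four sums of squares, which
    are monotone in the finite set. *)
Lemma cvg_inner_polar f h :
  partial_sum (fun g => f g * (h g)^* : (R[i])^o) @ totally -->
  (4^-1 * ((ell2_norm (f + h) ^+ 2 - ell2_norm (f - h) ^+ 2)%:C +
     'i * (ell2_norm (f + 'i *: h) ^+ 2 - ell2_norm (f - 'i *: h) ^+ 2)%:C)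
   : (R[i])^o).
Proof.
have -> : partial_sum (fun g => f g * (h g)^* : (R[i])^o) = (fun A =>
   4^-1 * ((partial_sum (fun g => (normc ((f + h : ell2) g) ^+ 2)%:C : (R[i])^o) A -
     partial_sum (fun g => (normc ((f - h : ell2) g) ^+ 2)%:C : (R[i])^o) A) + 'i *
    (partial_sum (fun g => (normc ((f + 'i *: h : ell2) g) ^+ 2)%:C : (R[i])^o) A -
     partial_sum (fun g => (normc ((f - 'i *: h : ell2) g) ^+ 2)%:C : (R[i])^o) A))).
  apply/funext => A; rewrite !partial_sumE -!sumrB mulr_sumr -big_split/= mulr_sumr.
  apply: eq_bigr => g _; rewrite polarization_pt !rmorphB; congr (_ * (_ + _)).
rewrite !rmorphB.
apply: cvgMr; apply: cvgD; first by apply: cvgB; exact: cvg_sqnorm.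
by apply: cvgMr; apply: cvgB; exact: cvg_sqnorm.
Qed.

Lemma cvg_inner f h :
  partial_sum (fun g => f g * (h g)^* : (R[i])^o) @ totally --> (inner f h : (R[i])^o).
Proof.
have cl := @cvg_inner_polar f h.
suff -> : inner f h = lim (partial_sum (fun g => f g * (h g)^* : (R[i])^o) @ totally).
  by rewrite (cvg_lim _ cl)//; exact: norm_hausdorff.
by [].
Qed.

Lemma inner_unique f h l :
  partial_sum (fun g => f g * (h g)^* : (R[i])^o) @ totally --> (l : (R[i])^o) ->
  inner f h = l.
Proof. by apply: (@cvg_lim (R[i])^o); exact: norm_hausdorff. Qed.

Lemma inner_polar f h : inner f h =
  4^-1 * ((ell2_norm (f + h) ^+ 2 - ell2_norm (f - h) ^+ 2)%:C +
     'i * (ell2_norm (f + 'i *: h) ^+ 2 - ell2_norm (f - 'i *: h) ^+ 2)%:C).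
Proof. exact/inner_unique/cvg_inner_polar. Qed.

Lemma inner_linear h : scalar (fun f => inner f h).
Proof.
move=> z f' k'; pose f : ell2 := f'; pose k : ell2 := k'.
rewrite -[f']/f -[k']/k; apply: inner_unique.
have -> : partial_sum (fun g => (z *: f + k : ell2) g * (h g)^* : (R[i])^o) = (fun A =>
    z * partial_sum (fun g => f g * (h g)^* : (R[i])^o) A +
    partial_sum (fun g => k g * (h g)^* : (R[i])^o) A).
  apply/funext => A; rewrite !partial_sumE mulr_sumr -big_split/=.
  by apply: eq_bigr => g _; rewrite mulrA -mulrDl.
by apply: cvgD; [apply: cvgMr|]; exact: cvg_inner.
Qed.

Lemma innerDl f k h : inner (f + k) h = inner f h + inner k h.
Proof. by have := inner_linear h 1 f k; rewrite scale1r mul1r. Qed.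

Lemma inner0l h : inner 0 h = 0.
Proof. by apply: (@addIr _ (inner 0 h)); rewrite -innerDl !add0r. Qed.

Lemma innerZl z f h : inner (z *: f) h = z * inner f h.
Proof. by have := inner_linear h z f 0; rewrite addr0 inner0l addr0. Qed.

Lemma innerNl f h : inner (- f) h = - inner f h.
Proof. by rewrite -scaleN1r innerZl mulN1r. Qed.

Lemma innerBl f k h : inner (f - k) h = inner f h - inner k h.
Proof. by rewrite innerDl innerNl. Qed.

Lemma inner_conj f h : inner f h = (inner h f)^*.
Proof.
rewrite !inner_polar.
have e1 : ell2_norm (h - f) = ell2_norm (f - h).
  by rewrite -opprB -scaleN1r ell2_normZ normcN normc1 mul1r.
have i1 : normc 'i = 1 :> R by rewrite /= expr0n expr1n add0r sqrtr1.
have e2 : ell2_norm (h + 'i *: f) = ell2_norm (f - 'i *: h).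
  rewrite -[RHS]mul1r -i1 -ell2_normZ scalerBr scalerA -expr2 sqr_i scaleN1r opprK.
  by rewrite addrC.
have e3 : ell2_norm (h - 'i *: f) = ell2_norm (f + 'i *: h).
  rewrite -[LHS]mul1r -i1 -ell2_normZ scalerBr scalerA -expr2 sqr_i scaleN1r opprK.
  by rewrite addrC.
rewrite (addrC h f) e1 e2 e3.
set A := ell2_norm _ ^+ 2 - _; set B := ell2_norm _ ^+ 2 - _.
have -> : ell2_norm (f - 'i *: h) ^+ 2 - ell2_norm (f + 'i *: h) ^+ 2 = - B.
  by rewrite opprB.
move: A B => A B; rewrite rmorphM rmorphD rmorphM fmorphV/= !conjC_real.
rewrite (_ : (4%:R : R[i])^* = 4%:R); last by rewrite rmorph_nat.
rewrite (_ : ('i : R[i])^* = - 'i); last by simpc.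
by rewrite rmorphN mulrNN.
Qed.

Lemma innerDr f h k : inner f (h + k) = inner f h + inner f k.
Proof. by rewrite inner_conj innerDl rmorphD/= -!inner_conj. Qed.

Lemma innerZr z f h : inner f (z *: h) = z^* * inner f h.
Proof. by rewrite inner_conj innerZl rmorphM/= -inner_conj. Qed.

Lemma innerNr f h : inner f (- h) = - inner f h.
Proof. by rewrite inner_conj innerNl rmorphN/= -inner_conj. Qed.

Lemma innerBr f h k : inner f (h - k) = inner f h - inner f k.
Proof. by rewrite innerDr innerNr. Qed.

Lemma inner_norm f : inner f f = (ell2_norm f ^+ 2)%:C.
Proof.
apply: inner_unique; have := @cvg_sqnorm f.
rewrite (_ : partial_sum (fun g => _) = partial_sum (fun g => f g * (f g)^*)) //.
apply/funext => A; rewrite !partial_sumE; apply: eq_bigr => g _.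
by rewrite -sqr_normc normc_def rmorphXn.
Qed.

End inner_product.

Section inner_bounds.
Context {R : realType} {G : groupType}.
Local Notation ell2 := (ell2 R G).
Implicit Types (f h k : ell2) (z : R[i]).

Lemma normcRe_le (z : R[i]) : `|complex.Re z| <= normc z.
Proof.
rewrite -ler_sqr ?nnegrE ?normc_ge0// normc_sqr -[leLHS]/(`|complex.Re z| ^+ 2).
by rewrite real_normK ?num_real// lerDl sqr_ge0.
Qed.

Lemma ell2_normB_sqr f h : ell2_norm (f - h) ^+ 2 =
  ell2_norm f ^+ 2 + ell2_norm h ^+ 2 - 2 * complex.Re (inner f h).
Proof.
apply: (@complexI R); rewrite -inner_norm innerBl !innerBr (inner_conj h f).
rewrite !rmorphB !rmorphD/= -!inner_norm rmorphM/=.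
by case: (inner f h) => a b; case: (inner f f) => c d; case: (inner h h) => c' d';
  simpc; congr (_ +i* _)%C; rewrite /=; ring.
Qed.

Lemma ell2_normD_sqr f h : ell2_norm (f + h) ^+ 2 =
  ell2_norm f ^+ 2 + ell2_norm h ^+ 2 + 2 * complex.Re (inner f h).
Proof.
by rewrite -[h in LHS]opprK ell2_normB_sqr -scaleN1r ell2_normZ normcN normc1 mul1r
  scaleN1r innerNr raddfN/= mulrN opprK.
Qed.

(** Expand the squared norms of [t f - h] and [t f + h]. The free weight [t] later allows an
    operator to be dominated by a quadratic form. *)
Lemma Re_inner_le f h (t : R) : 0 < t ->
  2 * `|complex.Re (inner f h)| <= t * ell2_norm f ^+ 2 + t^-1 * ell2_norm h ^+ 2.
Proof.
move=> t0; set n1 := ell2_norm f; set n2 := ell2_norm h.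
have normR (c : R) k : ell2_norm (c%:C *: k) ^+ 2 = c ^+ 2 * ell2_norm k ^+ 2.
  by rewrite ell2_normZ exprMn normc_sqr/= expr0n addr0.
have ReZ (c : R) : complex.Re (inner (c%:C *: f) h) = c * complex.Re (inner f h).
  by rewrite innerZl; case: (inner f h) => a b; simpc.
have := sqr_ge0 (ell2_norm (t%:C *: f - h)); rewrite ell2_normB_sqr normR ReZ.
have := sqr_ge0 (ell2_norm (t%:C *: f + h)); rewrite ell2_normD_sqr normR ReZ.
rewrite -/n1 -/n2; set r := complex.Re _ => h1 h2.
have -> : t * n1 ^+ 2 + t^-1 * n2 ^+ 2 = t^-1 * (t ^+ 2 * n1 ^+ 2 + n2 ^+ 2).
  by field; rewrite gt_eqF.
rewrite ler_pdivlMl//.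
have [r0|r0] := leP 0 r; first by rewrite ger0_norm//; nra.
by rewrite ltr0_norm//; nra.
Qed.

Lemma Re_inner_CS f h : `|complex.Re (inner f h)| <= ell2_norm f * ell2_norm h.
Proof.
have [/ell2_norm_eq0->|f0] := eqVneq (ell2_norm f) 0.
  by rewrite inner0l normr0 ell2_norm0 mul0r.
have [/ell2_norm_eq0->|h0] := eqVneq (ell2_norm h) 0.
  by rewrite inner_conj inner0l conjC0 normr0 ell2_norm0 mulr0.
have {}f0 : 0 < ell2_norm f by rewrite lt_neqAle eq_sym f0 ell2_norm_ge0.
have {}h0 : 0 < ell2_norm h by rewrite lt_neqAle eq_sym h0 ell2_norm_ge0.
have := @Re_inner_le f h (ell2_norm h / ell2_norm f) (divr_gt0 h0 f0).
rewrite invf_div; set a := ell2_norm f in f0 *; set b := ell2_norm h in h0 *.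
have -> : b / a * a ^+ 2 + a / b * b ^+ 2 = 2 * (a * b).
  by field; rewrite !gt_eqF.
by rewrite ler_pM2l.
Qed.

Lemma Re_innerii f : complex.Re (inner f f) = ell2_norm f ^+ 2.
Proof. by rewrite inner_norm. Qed.

(** Polarization again: [lambda g] preserves norms. *)
Lemma inner_lambda g f h : inner (lambda R g f) h = inner f (lambda R g^-1 h).
Proof.
have lK k : k = lambda R g (lambda R g^-1 k).
  by rewrite -[RHS]/((lambda R g * lambda R g^-1 : bop R G) k) -lambdaM mulgV lambda1.
have iso k : ell2_norm (lambda R g k) = ell2_norm k.
  by rewrite /ell2_norm/= sqnorm_translate.
rewrite !inner_polar [in LHS](lK h) -!linearZ/= -!linearD -!linearB/= !iso.
by [].
Qed.

Lemma ell2_norm_lambda g f : ell2_norm (lambda R g f) = ell2_norm f.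
Proof. by rewrite /ell2_norm/= sqnorm_translate. Qed.

Lemma opnorm_leP (T : bop R G) (M : R) : 0 <= M ->
  (forall f, ell2_norm (T f) <= M * ell2_norm f) -> opnorm T <= M.
Proof.
move=> M0 TM; apply: opnorm_le => f f1; apply: le_trans (TM f) _.
by rewrite ler_piMr.
Qed.

Lemma opnormM (S T : bop R G) : opnorm (S * T) <= opnorm S * opnorm T.
Proof.
apply: opnorm_leP => [|f]; first by rewrite mulr_ge0// opnorm_ge0.
rewrite -[(S * T : bop R G) f]/(S (T f)) (le_trans (opnormP _ _))// -mulrA.
by rewrite ler_wpM2l ?opnorm_ge0 ?opnormP.
Qed.

Lemma opnorm_lambda_le g : opnorm (lambda R g : bop R G) <= 1.
Proof. by apply: opnorm_leP => // f; rewrite ell2_norm_lambda mul1r. Qed.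

Lemma opnormN (T : bop R G) : opnorm (- T) = opnorm T.
Proof. by rewrite -scaleN1r opnormZ normcN normc1 mul1r. Qed.

End inner_bounds.

(** * Means and finitely additive probabilities *)

Section ultralimits.
Context {R : realType} {T : Type}.

Definition bfun (f : T -> R) := exists M, forall x, `|f x| <= M.

Lemma bfunD f h : bfun f -> bfun h -> bfun (fun x => f x + h x).
Proof.
move=> [M fM] [N hN]; exists (M + N) => x.
by rewrite (le_trans (ler_normD _ _))// lerD.
Qed.

Lemma bfunM f h : bfun f -> bfun h -> bfun (fun x => f x * h x).
Proof.
move=> [M fM] [N hN]; exists (M * N) => x.
by rewrite normrM ler_pM.
Qed.

Lemma bfun_cst c : bfun (fun=> c).
Proof. by exists `|c|. Qed.

Lemma bfunZ c f : bfun f -> bfun (fun x => c * f x).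
Proof. exact/bfunM/bfun_cst. Qed.

Lemma bfunB f h : bfun f -> bfun h -> bfun (fun x => f x - h x).
Proof.
move=> bf bh; have := bfunD bf (bfunZ (-1) bh).
by congr bfun; apply/funext => x; rewrite mulN1r.
Qed.

Lemma bfun_ge0_le1 f : (forall x, 0 <= f x <= 1) -> bfun f.
Proof.
by move=> f01; exists 1 => x; have /andP[f0 f1] := f01 x; rewrite ger0_norm.
Qed.

Lemma bfun_sum (I : Type) (s : seq I) (F : I -> T -> R) :
  (forall i, bfun (F i)) -> bfun (fun x => \sum_(i <- s) F i x).
Proof.
move=> bF; elim: s => [|i s IH].
  by exists 0 => x; rewrite big_nil normr0.
have := bfunD (bF i) IH; congr bfun; apply/funext => x.
by rewrite big_cons.
Qed.

(** The laws are restricted to bounded functions because [ulim] takes a default value where the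
    limit does not exist. *)
Definition mean (n : (T -> R) -> R) :=
  [/\ n (fun=> 1) = 1,
      forall f h, bfun f -> bfun h -> n (fun x => f x + h x) = n f + n h,
      forall c f, bfun f -> n (fun x => c * f x) = c * n f &
      forall f, bfun f -> (forall x, 0 <= f x) -> 0 <= n f].

Variables (U : set_system T) (UU : UltraFilter U).

Definition ulim (f : T -> R) : R := lim (f @ U).

(** The image of an ultrafilter is an ultrafilter, and one that lives on a compact segment
    converges. *)
Lemma ulim_cvg f : bfun f -> f @ U --> ulim f.
Proof.
move=> [M fM].
have FU : UltraFilter (f @ U).
  apply: Build_UltraFilter => F FF' UF; apply/seteqP; split => // A FA.
  have [//|UA] := in_ultra_setVsetC (f @^-1` A) UU.
  have : F (A `&` ~` A) by apply: filterI => //; exact: UF.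
  by rewrite setICr => /filter_not_empty.
have /[!compact_ultra]/(_ _ FU)[] := @segment_compact R (- M) M.
  by apply: (@filterE _ U) => x /=; rewrite in_itv/= -ler_norml.
move=> l [_ /= fl]; rewrite /ulim (cvg_lim _ fl)//; exact: Rhausdorff.
Qed.

Lemma ulim_eq f l : f @ U --> l -> ulim f = l.
Proof.
by have FF := @ultra_proper _ _ UU; move=> fl; apply: (@cvg_lim R); first exact: Rhausdorff.
Qed.

Lemma ulim_cst c : ulim (fun=> c) = c.
Proof. by have FF := @ultra_proper _ _ UU; apply: ulim_eq; exact: cvg_cst. Qed.

Lemma ulimD f h : bfun f -> bfun h -> ulim (fun x => f x + h x) = ulim f + ulim h.
Proof.
have FF := @ultra_proper _ _ UU; move=> bf bh; apply: ulim_eq.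
by apply: (@cvgD _ R); exact: ulim_cvg.
Qed.

Lemma ulimM f h : bfun f -> bfun h -> ulim (fun x => f x * h x) = ulim f * ulim h.
Proof.
have FF := @ultra_proper _ _ UU; move=> bf bh; apply: ulim_eq.
by apply: (@cvgM R); exact: ulim_cvg.
Qed.

Lemma ulimZ c f : bfun f -> ulim (fun x => c * f x) = c * ulim f.
Proof. by move=> bf; rewrite ulimM ?ulim_cst//; exact: bfun_cst. Qed.

Lemma ulimB f h : bfun f -> bfun h -> ulim (fun x => f x - h x) = ulim f - ulim h.
Proof.
have FF := @ultra_proper _ _ UU; move=> bf bh; apply: ulim_eq.
by apply: (@cvgB _ R); exact: ulim_cvg.
Qed.

Lemma ulim_norm f : bfun f -> ulim (fun x => `|f x|) = `|ulim f|.
Proof.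
have FF := @ultra_proper _ _ UU; move=> bf; apply: ulim_eq.
by apply: (@cvg_norm _ R); exact: ulim_cvg.
Qed.

Lemma ulim_near_le f c : bfun f -> U [set x | f x <= c] -> ulim f <= c.
Proof.
have FF := @ultra_proper _ _ UU; move=> bf Uf; apply: limr_le => //.
by apply/cvg_ex; exists (ulim f); exact: ulim_cvg.
Qed.

Lemma ulim_near_ge f c : bfun f -> U [set x | c <= f x] -> c <= ulim f.
Proof.
have FF := @ultra_proper _ _ UU; move=> bf Uf; apply: limr_ge => //.
by apply/cvg_ex; exists (ulim f); exact: ulim_cvg.
Qed.

Lemma ulim_mean : mean ulim.
Proof.
split; [exact: ulim_cst|exact: ulimD|exact: ulimZ|].
by move=> f bf f0; apply: ulim_near_ge => //; exact: filterE.
Qed.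

Lemma ulim_sum (I : Type) (s : seq I) (F : I -> T -> R) :
  (forall i, bfun (F i)) ->
  ulim (fun x => \sum_(i <- s) F i x) = \sum_(i <- s) ulim (F i).
Proof.
move=> bF; elim: s => [|i s IH].
  by rewrite big_nil -[RHS]ulim_cst; congr ulim; apply/funext => x; rewrite big_nil.
rewrite big_cons -IH -ulimD//; last exact: bfun_sum.
by congr ulim; apply/funext => x; rewrite big_cons.
Qed.

End ultralimits.

Section means.
Context {R : realType} {T : Type} (n : (T -> R) -> R) (mn : mean n).
Implicit Types f h : T -> R.

Lemma mean_le f h : bfun f -> bfun h -> (forall x, f x <= h x) -> n f <= n h.
Proof.
have [_ nD nZ n0] := mn; move=> bf bh fh; rewrite -subr_ge0.
have -> : n h - n f = n (fun x => h x + -1 * f x).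
  by rewrite nD ?nZ ?mulN1r//; exact: bfunZ.
apply: n0; first by apply: bfunD => //; exact: bfunZ.
by move=> x; rewrite mulN1r subr_ge0.
Qed.

Lemma mean_cst c : n (fun=> c) = c.
Proof.
have [n1 _ nZ _] := mn.
rewrite -[RHS]mulr1 -[in RHS]n1 -nZ; last exact: bfun_cst.
by congr n; apply/funext => x; rewrite mulr1.
Qed.

Lemma mean_norm f (c : R) : bfun f -> (forall x, `|f x| <= c) -> `|n f| <= c.
Proof.
move=> bf fc; rewrite ler_norml -[X in X <= _]mean_cst -[X in _ && (_ <= X)]mean_cst.
by rewrite !mean_le//; try exact: bfun_cst; move=> x;
  have := fc x; rewrite ler_norml => /andP[].
Qed.

End means.

(** Serves to pass from objects that satisfy any finite set of constraints to one that satisfies all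
    of them. *)
Lemma ultra_totally (I : choiceType) : exists U : set_system {fset I},
  UltraFilter U /\ forall i, U [set A : {fset I} | i \in A].
Proof.
have [U [UU tU]] := ultraFilterLemma (@totally_filter I).
exists U; split => // i; apply: tU; exists [fset i]%fset => // A /=.
by rewrite fsub1set.
Qed.

Section finitely_additive.
Context {R : realType} {X : Type}.

(** [D] is the class on which [m] is additive: all sets for a finitely additive probability, the
    measurable sets for a Borel measure. *)
Lemma fa_partition (m : set X -> R) (D : set (set X)) (T : finType) (q : X -> T) :
  (forall A B, D A -> D B -> A `&` B = set0 -> m (A `|` B) = m A + m B) ->
  (forall P : pred T, D [set x | P (q x)]) ->
  forall P : pred T, m [set x | P (q x)] = \sum_(t | P t) m [set x | q x = t].
Proof.
move=> mD Dq P.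
have Dt t : D [set x | q x = t].
  by have := Dq (pred1 t); congr D; apply/seteqP; split => x /eqP.
have D0 : D set0 by have := Dq pred0; congr D; apply/seteqP; split.
have m0 : m set0 = 0.
  apply: (@addrI _ (m set0)); rewrite addr0 -mD ?set0U//; exact: set0I.
have main (s : seq T) : uniq s ->
    m [set x | q x \in s] = \sum_(t <- s) m [set x | q x = t].
  elim: s => [_|t s IH /= /andP[ts us]].
    by rewrite big_nil -[RHS]m0; congr m; apply/seteqP; split.
  rewrite big_cons -IH// -mD; first 1 last.
  - exact: Dt.
  - exact: (Dq (mem s)).
  - by apply/seteqP; split => // x [/= -> ts']; rewrite ts' in ts.
  congr m; apply/seteqP; split => x /=; rewrite in_cons.
    by move=> /orP[/eqP|]; [left|right].
  by move=> [->|->]; rewrite ?eqxx ?orbT.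
rewrite -big_enum -main ?enum_uniq//; congr m.
by apply/seteqP; split => x /=; rewrite mem_enum.
Qed.

(** Change of variables for simple functions: both sides are the integral of [F \o p \o q]. *)
Lemma fa_image (m : set X -> R) (D : set (set X)) (T T' : finType) (q : X -> T)
    (p : T -> T') (F : T' -> R) :
  (forall A B, D A -> D B -> A `&` B = set0 -> m (A `|` B) = m A + m B) ->
  (forall P : pred T, D [set x | P (q x)]) ->
  \sum_t' F t' * m [set x | p (q x) = t'] = \sum_t F (p t) * m [set x | q x = t].
Proof.
move=> mD Dq; rewrite [RHS](partition_big p xpredT)//=; apply: eq_bigr => t' _.
have -> : [set x | p (q x) = t'] = [set x | (fun t => p t == t') (q x)].
  by apply/seteqP; split => x /eqP.
by rewrite (fa_partition mD Dq (fun t => p t == t')) mulr_sumr; apply: eq_bigr => t /eqP ->.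
Qed.

Definition fap (m : set X -> R) :=
  [/\ forall A, 0 <= m A, m setT = 1 &
      forall A B, A `&` B = set0 -> m (A `|` B) = m A + m B].

Lemma fap_setC m A : fap m -> m (~` A) = 1 - m A.
Proof.
move=> [m0 m1 mD]; rewrite -m1 -(setUv A) mD ?setICr//.
by rewrite addrAC subrr add0r.
Qed.

Lemma fap_le1 m A : fap m -> m A <= 1.
Proof. by move=> fm; have [m0 _ _] := fm; rewrite -subr_ge0 -fap_setC. Qed.

Lemma fap_le m A B : fap m -> A `<=` B -> m A <= m B.
Proof.
move=> [m0 m1 mD] AB; rewrite -(setDUK AB) mD; first by rewrite lerDl.
by rewrite setIDA setDE setIC setIA [~` A `&` A]setIC setICr set0I.
Qed.

Lemma fap_setI m A B : fap m -> m B = 1 -> m (A `&` B) = m A.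
Proof.
move=> fm mB; have [m0 _ mD] := fm.
rewrite -[in RHS](setUIDK A B) mD; last first.
  by apply/seteqP; split => // x [[_ +] [_ +]].
suff -> : m (A `\` B) = 0 by rewrite addr0.
apply/le_anti; rewrite m0 andbT -(subrr 1) -[X in _ - X]mB -fap_setC//.
by apply: fap_le => // x [].
Qed.

Lemma ulim_fap (T : Type) (U : set_system T) (m : T -> set X -> R) :
  UltraFilter U -> (forall t, fap (m t)) -> fap (fun A => ulim U (m^~ A)).
Proof.
move=> UU fm; have bm A : bfun (m^~ A).
  by apply: bfun_ge0_le1 => t; have [-> _ _] := fm t; rewrite fap_le1.
have [n1 _ _ n0] := @ulim_mean R _ _ UU.
split=> [A||A B AB].
- by apply: n0 => // t; have [-> _ _] := fm t.
- by rewrite -[RHS](ulim_cst UU); congr ulim; apply/funext => t; have [_ -> _] := fm t.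
- rewrite -ulimD//; congr ulim; apply/funext => t.
  by have [_ _ ->] := fm t.
Qed.

End finitely_additive.

Section amenability.
Context {R : realType} {G : groupType}.
Implicit Types (m : set G -> R) (H : {ptws G -> bool}).

Definition ltranslate (h : G) (A : set G) : set G := [set (h * x)%g | x in A].

Lemma ltranslateE h A x : ltranslate h A x <-> A (h^-1 * x)%g.
Proof.
by split=> [[y Ay <-]|Ax]; [rewrite mulKg|exists (h^-1 * x)%g; rewrite ?mulVKg].
Qed.

(** [amenable] constrains [m] on subsets of [H] only; intersecting with [H] first carries it to all
    subsets of [G]. *)
Lemma amenable_invariant H : amenable_subgroup R H ->
  exists m, [/\ fap m, m [set x | H x] = 1 &
    forall h, H h -> forall A, m (ltranslate h A) = m A].
Proof.
move=> [[H1 HF] [m [m0 mH mD mM]]].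
have HV x : H x -> H x^-1%g by move=> Hx; rewrite -div1g; exact: HF.
exists (fun A => m (A `&` [set x | H x])); split; last 2 first.
- by rewrite setIid.
- move=> h Hh A; rewrite -(mM h (A `&` [set x | H x]))//.
  congr m; apply/seteqP; split => x /=.
    move=> [/ltranslateE Ax Hx]; exists (h^-1 * x)%g; rewrite ?mulVKg//; split => //=.
    have := HF _ _ (HV _ Hh) (HV _ Hx); rewrite !unfold_in.
    by rewrite invgK.
  move=> [y [Ay Hy] <-]; split; first by exists y.
  by have := HF _ _ Hh (HV _ Hy); rewrite !unfold_in invgK.
- split=> [A|//|A B AB]; first exact: m0.
  + by rewrite setTI.
  + rewrite setIUl mD//; try exact: subIsetr.
    by rewrite setIACA AB set0I.
Qed.

(** Push [m] forward along the map from [G] to [H] sending [x] to [x * (t x)^-1], where [t x]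
    represents the coset [H x]. It is [H]-equivariant because [xget] depends only on the coset. *)
Lemma invariant_amenable H : Defs.Sub H ->
  (exists m, fap m /\ forall h, H h -> forall A, m (ltranslate h A) = m A) ->
  amenable_subgroup R H.
Proof.
move=> sH [m [[m0 m1 mD] mM]]; split=> //.
have [H1 HF] := sH.
have HV x : H x -> H x^-1%g by move=> Hx; rewrite -div1g; exact: HF.
have HM x y : H x -> H y -> H (x * y)%g.
  by move=> Hx Hy; have := HF _ _ Hx (HV _ Hy); rewrite !unfold_in invgK.
pose t x : G := xget 1%g [set y | H (x * y^-1)%g].
have tH x : H (x * (t x)^-1)%g.
  rewrite /t; case: xgetP => [y -> //|/(_ x)]; rewrite /= mulgV => /(_ H1) //.
have tM h x : H h -> t (h * x)%g = t x.
  move=> Hh; congr (xget 1%g _); apply/seteqP; split => y /=.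
    by move=> /(HM _ _ (HV _ Hh)); rewrite -mulgA mulKg.
  by move=> Hx; rewrite -mulgA; exact: HM.
exists (fun A => m [set x | A (x * (t x)^-1)%g]); split=> [A||A B _ _ AB|h A Hh AH] //.
- by rewrite -[RHS]m1; congr m; apply/seteqP; split => // x _; exact: tH.
- rewrite -mD//; apply/seteqP; split => // x [Ax Bx].
  by have : (A `&` B) (x * (t x)^-1)%g by []; rewrite AB.
- rewrite -[RHS](mM h)//; congr m; apply/seteqP; split => x.
    move=> /= /ltranslateE Ax; apply/ltranslateE => /=.
    by rewrite tM ?HV// -mulgA.
  move=> /ltranslateE/= ; rewrite tM ?HV// => Ax; apply/ltranslateE.
  by rewrite mulgA.
Qed.

(* Finitely additive probabilities form a compact space, so invariance can be obtained
   by an ultralimit over the finite subsets of [H]. *)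
Lemma invariant_compact (H : set G) :
  (forall S : {fset G}, (forall h, h \in S -> H h) ->
     exists m, fap m /\ forall h, h \in S -> forall A, m (ltranslate h A) = m A) ->
  exists m, fap m /\ forall h, H h -> forall A, m (ltranslate h A) = m A.
Proof.
move=> loc; have [U [UU tU]] := ultra_totally G.
have /choice[m mP] : forall S : {fset G}, exists m, fap m /\
    forall h, h \in S -> H h -> forall A, m (ltranslate h A) = m A.
  move=> S; have [|m [fm mS]] := loc [fset x in S | x \in H]%fset.
    by move=> x; rewrite !inE/= => /andP[_ /set_mem].
  by exists m; split => // h hS Hh; apply: mS; rewrite !inE/= hS/= mem_set.
have fm S : fap (m S) by have [] := mP S.
exists (fun A => ulim U (m^~ A)); split; first exact: ulim_fap.
move=> h Hh A; have bm B : bfun (m^~ B).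
  by apply: bfun_ge0_le1 => S; have [-> _ _] := fm S; rewrite fap_le1.
have b := bfunB (bm (ltranslate h A)) (bm A).
apply/eqP; rewrite -subr_eq0 -ulimB// -normr_eq0 -ulim_norm//.
have b' : bfun (fun S => `|m S (ltranslate h A) - m S A|).
  by move: b => [M bM]; exists M => S; rewrite normr_id.
apply/eqP/le_anti/andP; split.
  apply: ulim_near_le => //; apply: filterS (tU h) => S /= hS.
  by have [_ ->] := mP S; rewrite ?subrr ?normr0.
by apply: ulim_near_ge => //; apply: (@filterE _ U) => S /=.
Qed.

End amenability.

(** * The quasi-regular representation of an amenable subgroup *)

Section multiplication_operators.
Context {R : realType} {G : groupType}.
Local Notation ell2 := (ell2 R G).
Local Notation bop := (bop R G).
Implicit Types (f h : ell2) (phi psi : G -> R).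

Lemma normc_realC (a : R) : normc a%:C = `|a|.
Proof. by rewrite /= expr0n addr0 sqrtr_sqr. Qed.

Lemma sqnorm_mul phi (f : G -> R[i]) (M : R) : (forall x, `|phi x| <= M) ->
  (sqnorm (fun x => (phi x)%:C * f x)%R <= (M ^+ 2)%:E * sqnorm f)%E.
Proof.
move=> phiM; rewrite -esumZl ?sqr_ge0//; last by move=> g; exact: sqr_ge0.
apply: le_esum => x _; rewrite lee_fin normcM exprMn normc_realC.
rewrite ler_wpM2r ?sqr_ge0// lerXn2r ?nnegrE//.
exact: le_trans (phiM x).
Qed.

Lemma square_summable_mul phi f : bfun phi ->
  square_summable (fun x => (phi x)%:C * f x).
Proof.
move=> [M phiM]; rewrite /square_summable/=.
apply: le_lt_trans (sqnorm_mul f phiM) _.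
by rewrite sqnorm_ell2 -EFinM ltry.
Qed.

Lemma bounded_mul phi (bphi : bfun phi) :
  bounded_operator (fun f : ell2 => mk_ell2 (square_summable_mul f bphi) : ell2).
Proof.
split.
  move=> c f h; apply/ell2P => x.
  rewrite -[LHS]/((phi x)%:C * (c * (f : ell2) x + (h : ell2) x)).
  rewrite -[RHS]/(c * ((phi x)%:C * (f : ell2) x) + (phi x)%:C * (h : ell2) x).
  by rewrite mulrDr mulrCA.
have [M phiM] := bphi; exists M => f0; pose f : ell2 := f0; rewrite -[f0]/f.
have M0 : 0 <= M by apply: le_trans (phiM 1%g).
rewrite -ler_sqr ?nnegrE ?mulr_ge0 ?ell2_norm_ge0// -lee_fin -sqnorm_ell2.
apply: le_trans (sqnorm_mul (f : ell2) phiM) _.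
by rewrite sqnorm_ell2 -EFinM exprMn.
Qed.

(* Multiplication by [phi]; the junk value [0] is used for unbounded [phi]. *)
Definition mult phi : bop :=
  if pselect (bfun phi) is left bphi then mk_bop (bounded_mul bphi) else 0.

Lemma multE phi f x : bfun phi -> mult phi f x = (phi x)%:C * f x.
Proof. by rewrite /mult; case: pselect. Qed.

Lemma mult_norm phi f (M : R) : (forall x, `|phi x| <= M) ->
  ell2_norm (mult phi f) <= M * ell2_norm f.
Proof.
move=> phiM; have bphi : bfun phi by exists M.
have M0 : 0 <= M by apply: le_trans (phiM 1%g).
rewrite -ler_sqr ?nnegrE ?mulr_ge0 ?ell2_norm_ge0// -lee_fin -sqnorm_ell2.
have -> : sqnorm (mult phi f) = sqnorm (fun x => (phi x)%:C * f x).
  by congr sqnorm; apply/funext => x; exact: multE.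
apply: le_trans (sqnorm_mul f phiM) _.
by rewrite sqnorm_ell2 -EFinM exprMn.
Qed.

Lemma mult_cst (c : R) : mult (fun=> c) = c%:C *: 1.
Proof. by apply/bopP => f; apply/ell2P => x; rewrite multE//; exact: bfun_cst. Qed.

Lemma multD phi psi : bfun phi -> bfun psi ->
  mult (fun x => phi x + psi x) = mult phi + mult psi.
Proof.
move=> bphi bpsi; apply/bopP => f; apply/ell2P => x.
rewrite multE; last exact: bfunD.
by rewrite -[RHS]/(mult phi f x + mult psi f x) !multE// rmorphD mulrDl.
Qed.

Lemma multM phi psi : bfun phi -> bfun psi ->
  mult (fun x => phi x * psi x) = mult phi * mult psi.
Proof.
move=> bphi bpsi; apply/bopP => f; apply/ell2P => x.
rewrite multE; last exact: bfunM.
by rewrite -[RHS]/(mult phi (mult psi f) x) !multE// rmorphM mulrA.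
Qed.

Lemma multZ (c : R) phi : bfun phi -> mult (fun x => c * phi x) = c%:C *: mult phi.
Proof.
move=> bphi; rewrite multM ?mult_cst//; last exact: bfun_cst.
by rewrite -scalerAl mul1r.
Qed.

Lemma inner_mult phi f h : bfun phi -> inner (mult phi f) h = inner f (mult phi h).
Proof.
move=> bphi; apply: inner_unique; have := @cvg_inner R G f (mult phi h).
rewrite (_ : partial_sum _ = partial_sum (fun g => mult phi f g * (h g)^*)) //.
apply/funext => A; rewrite !partial_sumE; apply: eq_bigr => g _.
by rewrite !multE// rmorphM/= conjC_real mulrCA mulrA.
Qed.

(** The covariance relation between bounded functions and translations, on which both [conv_rconv]
    and [almost_stabilizer] rest. *)
Lemma lambda_mult g phi : bfun phi ->
  lambda R g * mult phi = mult (fun x => phi (g^-1 * x)%g) * lambda R g.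
Proof.
move=> bphi; apply/bopP => f; apply/ell2P => x.
rewrite -[LHS]/(mult phi f (g^-1 * x)%g) multE//.
rewrite -[RHS]/(mult (fun x => phi (g^-1 * x)%g) (lambda R g f) x) multE//.
by have [M phiM] := bphi; exists M.
Qed.

End multiplication_operators.

(** * Almost invariant vectors supported in an amenable subgroup *)

Section almost_invariant_vectors.
Context {R : realType} {G : groupType}.
Local Notation ell2 := (ell2 R G).
Local Notation bop := (bop R G).
Local Notation lambda := (lambda R).
Implicit Types (f : ell2) (H : {ptws G -> bool}) (L : seq G).

(** For [k] vectors, [k] times the sum of the squared norms exceeds the squared norm of the sum by
    the squared distances over all pairs; only the pairs containing [v0] are kept. *)
Lemma ell2_norm_sum_le (v0 : ell2) (w : seq ell2) :
  ell2_norm (v0 + \sum_(v <- w) v) ^+ 2 <=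
  (size w).+1%:R * (ell2_norm v0 ^+ 2 + \sum_(v <- w) ell2_norm v ^+ 2) -
  \sum_(v <- w) ell2_norm (v - v0) ^+ 2.
Proof.
elim: w => [|w' w IH].
  by rewrite !big_nil addr0 subr0 mul1r addr0.
rewrite !big_cons (addrC w') addrA (ell2_normD_sqr (v0 + \sum_(v <- w) v) w').
have : 0 <= \sum_(v <- w) ell2_norm (v - w') ^+ 2.
  by apply: sumr_ge0 => v _; exact: sqr_ge0.
rewrite (eq_bigr (fun v => (ell2_norm v ^+ 2 - 2 * complex.Re (inner v w')) +
  ell2_norm w' ^+ 2)); last by move=> v _; rewrite (ell2_normB_sqr v w'); ring.
rewrite big_split sumrB -mulr_sumr big_const_seq iter_addr_0 count_predT/=.
have -> : complex.Re (inner (v0 + \sum_(v <- w) v) w') =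
    complex.Re (inner v0 w') + \sum_(v <- w) complex.Re (inner v w').
  rewrite innerDl raddfD/=; congr (_ + _); elim: w {IH} => [|v w IH].
    by rewrite !big_nil inner0l.
  by rewrite !big_cons innerDl raddfD/= IH.
move: IH; set B := \sum_(v <- w) ell2_norm (v - v0) ^+ 2.
rewrite (ell2_normB_sqr w' v0).
have -> : inner w' v0 = (inner v0 w')^* by exact: inner_conj.
have -> : complex.Re (inner v0 w')^* = complex.Re (inner v0 w').
  by case: (inner v0 w').
set X := ell2_norm (v0 + _) ^+ 2; set A := \sum_(v <- w) ell2_norm v ^+ 2.
set C := \sum_(v <- w) complex.Re _; set a := ell2_norm w' ^+ 2.
set b := ell2_norm v0 ^+ 2; set c := complex.Re _.
rewrite -[a *+ size w]mulr_natl -[(size w).+2]addn1 -[(size w).+1]addn1 !natrD.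
by move: ((size w)%:R : R) => k; lra.
Qed.

Definition average L : bop := (size L)%:R^-1 *: \sum_(h <- L) lambda h.

Lemma averageE L f x : average L f x = (size L)%:R^-1 * \sum_(h <- L) f (h^-1 * x)%g.
Proof.
by rewrite /average bopZE ell2ZE bop_sumE ell2_sumE.
Qed.

(** With the identity in the list, [f] itself is one of the averaged vectors, so every displacement
    [lambda h f - f] costs norm. *)
Lemma average_contracts L f :
  ell2_norm (average (1%g :: L) f) ^+ 2 <= ell2_norm f ^+ 2 -
  (size L).+1%:R ^- 2 * \sum_(h <- L) ell2_norm (lambda h f - f) ^+ 2.
Proof.
have -> : average (1%g :: L) f =
    (size L).+1%:R^-1 *: (f + \sum_(v <- [seq lambda h f | h <- L]) v).
  by rewrite /average bopZE big_cons lambda1 bopDE bop_sumE big_map.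
have := ell2_norm_sum_le f [seq lambda h f | h <- L].
rewrite !big_map size_map ell2_normZ exprMn normcV.
have -> : normc ((size L).+1%:R : R[i]) = (size L).+1%:R.
  by rewrite -(rmorph_nat (real_complex R)) normc_realC ger0_norm.
rewrite [in leRHS](eq_bigr (fun=> ell2_norm f ^+ 2)); last first.
  by move=> h _; rewrite ell2_norm_lambda.
rewrite big_const_seq iter_addr_0 count_predT -mulrS.
move=> le1; have n0 : (0 : R) < (size L).+1%:R ^- 2 by rewrite invr_gt0 exprn_gt0.
rewrite exprVn -(ler_pM2l n0) in le1 *; apply: le_trans le1 _.
rewrite mulrBr lerD2r; set N := (size L).+1%:R; set a := ell2_norm f ^+ 2.
have -> : a *+ (size L).+1 = N * a by rewrite mulr_natl.
by rewrite [N * (N * a)]mulrA -expr2 mulrA mulVf ?mul1r// expf_neq0// pnatr_eq0.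
Qed.

Lemma Re_realM (a : R) (z : R[i]) : complex.Re (a%:C * z) = a * complex.Re z.
Proof. by case: z => x y; simpc. Qed.

Lemma Re_average L f x : complex.Re (average L f x) =
  (size L)%:R^-1 * \sum_(h <- L) complex.Re (f (h^-1 * x)%g).
Proof.
rewrite averageE.
have -> : (size L)%:R^-1 = ((size L)%:R^-1 : R)%:C :> R[i].
  by rewrite fmorphV rmorph_nat.
by rewrite Re_realM raddf_sum.
Qed.

(** Geometric weights along an injection of [G] into [nat]; being at most 1, they dominate their
    squares. *)
Lemma positive_ell2 : countable [set: G] ->
  exists f : ell2, forall x, exists2 r : R, 0 < r & f x = r%:C.
Proof.
move=> /countable_injP[e /in2TT einj].
pose w (x : G) : R := (2^-1) ^+ (e x).
have w0 x : 0 < w x by rewrite exprn_gt0 // invr_gt0.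
suff sw : square_summable (fun x => (w x)%:C).
  by exists (mk_ell2 sw) => x; exists (w x).
apply: (@le_lt_trans _ _ (2%:E : \bar R)); last exact: ltry.
apply: ge_ereal_sup => _ [F [finF _] <-].
rewrite fsbig_finite// sumEFin lee_fin.
pose A : {fset nat} := (e @` fset_set F)%fset.
have [N AN] : exists N, forall k, k \in A -> (k < N)%N.
  exists (\max_(k <- A) k).+1 => k kA; rewrite ltnS.
  exact: (@leq_bigmax_seq _ _ (fun=> true) id).
apply: (@le_trans _ _ (\sum_(x <- fset_set F) w x)).
  apply: ler_sum => x _; rewrite normc_realC ger0_norm ?(ltW (w0 _))//.
  rewrite expr2 ler_piMl ?(ltW (w0 _))//.
  by rewrite exprn_ile1 ?invr_ge0// invf_le1// ler1n.
have -> : \sum_(x <- fset_set F) w x = partial_sum (fun k : nat => 2^-1 ^+ k : R) A.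
  rewrite partial_sumE /A big_imfset//=.
  by move=> x y _ _; exact: einj.
apply: (@le_trans _ _ (partial_sum (fun k : nat => 2^-1 ^+ k : R) [fset k in iota 0 N]%fset)).
  apply: partial_sum_mono => [k|]; first by rewrite exprn_ge0 ?invr_ge0.
  by apply/fsubsetP => k /AN kN; rewrite !inE/= mem_iota.
rewrite partial_sumE (perm_big (index_iota 0 N))/=; last first.
  apply: uniq_perm; rewrite ?fset_uniq ?iota_uniq// => k.
  by rewrite !inE/= /index_iota subn0.
suff -> : \sum_(0 <= k < N) 2^-1 ^+ k = 2 - 2 * 2^-1 ^+ N :> R.
  by rewrite gerBl mulr_ge0// exprn_ge0// invr_ge0.
elim: {AN} N => [|N IH]; first by rewrite big_geq// mulr1 subrr.
by rewrite big_nat_recr//= IH exprS; field.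
Qed.

Section superharmonic.
Variables (H : {ptws G -> bool}) (sH : Defs.Sub H) (L : seq G) (kappa : R).
Hypotheses (LH : forall h, h \in L -> H h) (L0 : (0 < size L)%N).
Hypotheses (kappa0 : 0 <= kappa) (kappa1 : kappa < 1).
Hypothesis gap : forall f, (forall x, ~~ H x -> f x = 0) ->
  ell2_norm (average L f) ^+ 2 <= kappa * ell2_norm f ^+ 2.
Variables (f0 : ell2) (f0_supp : forall x, ~~ H x -> f0 x = 0).
Hypothesis f0_pos : forall x, H x -> 0 < complex.Re (f0 x).

(** By the inequality of arithmetic and geometric means, [s] lies strictly between [Num.sqrt kappa],
    which bounds the average on vectors supported in [H], and 1. *)
Let s : R := (1 + kappa) / 2.

(* Partial sums of the Neumann series of [(s - P) ^-1], where [P] is the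
   average over [L]. *)
Fixpoint neumann n : ell2 :=
  if n is n'.+1 then f0 + s^-1%:C *: average L (neumann n') else 0.

Let neumannS n x : neumann n.+1 x = f0 x + s^-1%:C * average L (neumann n) x.
Proof. by rewrite [LHS]ell2DE ell2ZE. Qed.

Let s0 : 0 < s. Proof. by rewrite /s divr_gt0// ltr_wpDr. Qed.
Let s1 : s < 1. Proof. by rewrite /s ltr_pdivrMr// mul1r [ltRHS]mulr2n ltrD2l. Qed.

Let HV x : H x -> H x^-1%g.
Proof. by have [H1 HF] := sH; move=> Hx; rewrite -div1g; exact: HF. Qed.

Let HM x y : H x -> H y -> H (x * y)%g.
Proof.
have [H1 HF] := sH.
by move=> Hx Hy; have := HF _ _ Hx (HV Hy); rewrite !unfold_in invgK.
Qed.

Let a n x : R := complex.Re (neumann n x).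

Let aS n x : a n.+1 x = complex.Re (f0 x) +
  s^-1 * ((size L)%:R^-1 * \sum_(h <- L) a n (h^-1 * x)%g).
Proof.
rewrite /a -Re_average -Re_realM.
by rewrite neumannS raddfD.
Qed.

Let f0_ge0 x : 0 <= complex.Re (f0 x).
Proof.
have [/f0_pos/ltW//|Hx] := boolP (H x); by rewrite f0_supp.
Qed.

Let a_mono n x : a n x <= a n.+1 x.
Proof.
elim: n x => [|n IH] x.
  by rewrite aS {1}/a/= big1 ?mulr0 ?addr0.
rewrite aS [leRHS]aS lerD2l ler_pM2l ?invr_gt0// ler_pM2l ?invr_gt0 ?ltr0n//.
by apply: ler_sum.
Qed.

Let neumann_supp n x : ~~ H x -> neumann n x = 0.
Proof.
elim: n x => [//|n IH] x Hx.
rewrite neumannS f0_supp// averageE.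
rewrite big_seq big1 ?mulr0 ?addr0// => h hL; apply: IH.
apply: contra Hx => Hx; rewrite -[x](mulVKg h); apply: HM => //; exact: LH.
Qed.

Let neumann_bounded : exists C, forall n, ell2_norm (neumann n) <= C.
Proof.
pose q := Num.sqrt kappa / s.
have q0 : 0 <= q by rewrite divr_ge0 ?sqrtr_ge0// ltW.
have q1 : q < 1.
  rewrite /q ltr_pdivrMr// mul1r -ltr_sqr ?nnegrE ?sqrtr_ge0 ?(ltW s0)//.
  rewrite sqr_sqrtr// -subr_gt0.
  have -> : s ^+ 2 - kappa = ((1 - kappa) / 2) ^+ 2 by rewrite /s; field.
  by rewrite exprn_gt0// divr_gt0// subr_gt0.
(* The fixed point of the recursive bound [C = ell2_norm f0 + q * C]. *)
exists (ell2_norm f0 / (1 - q)); elim=> [|n IH].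
  by rewrite /= ell2_norm0 divr_ge0 ?ell2_norm_ge0// subr_ge0 ltW.
have -> : neumann n.+1 = f0 + s^-1%:C *: average L (neumann n) by [].
apply: le_trans (ell2_normD _ _) _; rewrite ell2_normZ normc_realC.
rewrite ger0_norm ?invr_ge0 ?(ltW s0)//.
have le1 : ell2_norm (average L (neumann n)) <= Num.sqrt kappa * ell2_norm (neumann n).
  rewrite -ler_sqr ?nnegrE ?mulr_ge0 ?ell2_norm_ge0 ?sqrtr_ge0//.
  by rewrite exprMn [Num.sqrt kappa ^+ 2]sqr_sqrtr//; apply: gap; exact: neumann_supp.
have : s^-1 * ell2_norm (average L (neumann n)) <= q * ell2_norm (neumann n).
  by rewrite /q [_ / s]mulrC -mulrA ler_pM2l ?invr_gt0.
have : q * ell2_norm (neumann n) <= q * (ell2_norm f0 / (1 - q)) by rewrite ler_wpM2l.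
have E : ell2_norm f0 / (1 - q) = ell2_norm f0 + q * (ell2_norm f0 / (1 - q)).
  by field; rewrite subr_eq0 gt_eqF.
by move: E; set X := ell2_norm f0 / (1 - q) => E; lra.
Qed.

(** The real parts of the partial sums increase and are bounded, so they converge at each point. In
    the limit of [aS], dropping the nonnegative [f0] leaves the inequality. *)
Lemma superharmonic : exists2 s' : R, s' < 1 & exists b : G -> R,
  [/\ forall x, 0 <= b x, forall x, H x -> 0 < b x &
   forall x, (size L)%:R^-1 * \sum_(h <- L) b (h^-1 * x)%g <= s' * b x].
Proof.
have [C nC] := neumann_bounded.
have aC n x : a n x <= C.
  apply: le_trans (nC n); apply: le_trans (normc_le_ell2_norm _ x).
  by apply: le_trans (normcRe_le _); exact: ler_norm.
have nda x : nondecreasing_seq (a ^~ x) by apply/nondecreasing_seqP => n.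
have cva x : cvgn (a ^~ x).
  by apply: nondecreasing_is_cvgn => //; exists C => _ [n _ <-].
pose b x := limn (a ^~ x).
have ab n x : a n x <= b x by apply: nondecreasing_cvgn_le.
have b0 x : 0 <= b x by apply: le_trans (ab 0 x); rewrite /a/=.
exists s => //; exists b; split => //.
  move=> x Hx; apply: lt_le_trans (ab 1 x); rewrite aS.
  by rewrite big1 ?mulr0 ?addr0//; exact: f0_pos.
move=> x.
have cv : (fun n => (size L)%:R^-1 * \sum_(h <- L) a n (h^-1 * x)%g) @ \oo -->
    (size L)%:R^-1 * \sum_(h <- L) b (h^-1 * x)%g.
  apply: cvgMr; elim: (L) => [|h l IH].
    rewrite big_nil (_ : (fun n => _) = fun=> 0); first exact: cvg_cst.
    by apply/funext => n; rewrite big_nil.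
  rewrite big_cons (_ : (fun n => _) =
    fun n => a n (h^-1 * x)%g + \sum_(h <- l) a n (h^-1 * x)%g).
    by apply: cvgD => //; exact: cva.
  by apply/funext => n; rewrite big_cons.
rewrite -(cvg_lim _ cv)//; apply: limr_le; first by apply/cvg_ex; eexists; exact: cv.
apply: nearW => n; rewrite -ler_pdivrMl//; apply: le_trans (ab n.+1 x).
by rewrite aS lerDr.
Qed.

End superharmonic.

Lemma absz_shift (e : int) (K : nat) : - K%:Z <= e <= K%:Z ->
  (absz (e + K%:Z))%:Z = e + K%:Z /\ (absz (e + K%:Z)%R < (2 * K).+1)%N.
Proof. by move=> /andP[e1 e2]; split; lia. Qed.

(* The logarithm [v] of a strictly superharmonic function satisfies
   [average v <= v - c]. Its increments are bounded and antisymmetric under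
   [h -> h^-1], so their integrals against an invariant mean add up to 0; they
   are discretized so that a finitely additive measure can integrate them. *)
Lemma no_superharmonic H (L : seq G) (b : G -> R) (s : R) :
  amenable_subgroup R H ->
  (forall h, h \in L -> H h) -> perm_eq [seq h^-1%g | h <- L] L -> s < 1 ->
  (0 < size L)%N -> (forall x, 0 <= b x) -> (forall x, H x -> 0 < b x) ->
  ~ (forall x, (size L)%:R^-1 * \sum_(h <- L) b (h^-1 * x)%g <= s * b x).
Proof.
move=> aH LH LV s1 L0 b0 bpos sup; have [[H1 HF] _] := aH.
have HV x : H x -> H x^-1%g by move=> Hx; rewrite -div1g; exact: HF.
have HM x y : H x -> H y -> H (x * y)%g.
  by move=> Hx Hy; have := HF _ _ Hx (HV _ Hy); rewrite !unfold_in invgK.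
have [m [fm mH mM]] := amenable_invariant aH.
have LVin h : h \in L -> h^-1%g \in L.
  by move=> hL; rewrite -(perm_mem LV); apply: map_f.
pose n : R := (size L)%:R; have n0 : 0 < n by rewrite ltr0n.
(* A single term of a nonnegative sum is at most the whole sum; this bounds the increments of [ln b]
   from above, and symmetry of [L] from below. *)
have harnack h x : h \in L -> b (h^-1 * x)%g <= n * b x.
  move=> hL; have := sup x; rewrite ler_pdivrMl// => le1.
  apply: (@le_trans _ _ (n * (s * b x))); last first.
    by rewrite ler_pM2l// ler_piMl// ltW.
  apply: le_trans le1; rewrite (big_rem h)//= lerDl.
  by apply: sumr_ge0.
pose v x := ln (b x).
pose d h x := v (h^-1 * x)%g - v x.
have Hhx h x : h \in L -> H x -> H (h^-1 * x)%g.
  by move=> hL Hx; apply: HM => //; exact/HV/LH.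
have d_le h x : h \in L -> H x -> d h x <= ln n.
  move=> hL Hx; rewrite /d /v lerBlDr -lnM ?posrE ?bpos//.
    by rewrite ler_ln ?posrE ?mulr_gt0 ?bpos ?Hhx//; exact: harnack.
have d_ge h x : h \in L -> H x -> - ln n <= d h x.
  move=> hL Hx; have := d_le h^-1%g (h^-1 * x)%g (LVin _ hL) (Hhx _ _ hL Hx).
  by rewrite /d invgK mulVKg => le1; rewrite lerNl opprB.
(* Uses [ln r <= r - 1] for the ratios of values of [b]. *)
have d_sum x : H x -> \sum_(h <- L) d h x <= - (n * (1 - s)).
  move=> Hx; apply: (@le_trans _ _ (\sum_(h <- L) (b (h^-1 * x)%g / b x - 1))).
    rewrite big_seq [leRHS]big_seq; apply: ler_sum => h hL.
    rewrite /d /v -ln_div ?posrE ?bpos ?Hhx//.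
    have : 0 < b (h^-1 * x)%g / b x by rewrite divr_gt0 ?bpos ?Hhx.
    move: (b _ / b x) => r r0; rewrite -[r in ln r](subrK 1) addrC le_ln1Dx//.
    by rewrite ltrBrDl subrr.
  rewrite sumrB -mulr_suml big_const_seq iter_addr_0 count_predT.
  have := sup x; rewrite ler_pdivrMl// => le1.
  have : (\sum_(h <- L) b (h^-1 * x)%g) / b x <= n * s.
    by rewrite ler_pdivrMr ?bpos// -mulrA.
  by rewrite -/n; lra.
pose c := n * (1 - s); have c0 : 0 < c by rewrite mulr_gt0// subr_gt0.
(* Rounding changes each of the [n] increments by at most 1, so the rounded sum is still at most
   [n - N * c <= -1]. *)
have [N Nc] : exists N : nat, n + 1 <= N%:R * c.
  exists (Num.truncn ((n + 1) / c)).+1; rewrite -ler_pdivrMr// ltW//.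
  exact: truncnS_gt.
(* Rounding [v] rather than the increments keeps them exact differences, so that their antisymmetry
   survives. *)
pose w x : int := Num.floor (N%:R * v x).
pose dw h x : int := w (h^-1 * x)%g - w x.
have dwE h x : `|(dw h x)%:~R - N%:R * d h x| <= 1.
  rewrite /dw /w /d rmorphB/= mulrBr; set y := N%:R * _; set z := N%:R * v x.
  have /andP[y1 y2] := floor_itv y; have /andP[z1 z2] := floor_itv z.
  rewrite !intrD in y2 z2; rewrite ler_norml; apply/andP; split; lra.
have [K dwK] : exists K : nat, forall h x, h \in L -> H x -> - K%:Z <= dw h x <= K%:Z.
  exists (Num.truncn (N%:R * ln n + 1)).+1 => h x hL Hx.
  have lt1 := truncnS_gt (N%:R * ln n + 1).
  have := dwE h x; rewrite ler_norml => /andP[e1 e2].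
  have := d_le h x hL Hx; have := d_ge h x hL Hx => e3 e4.
  have {}e3 : N%:R * - ln n <= N%:R * d h x by rewrite ler_wpM2l.
  have {}e4 : N%:R * d h x <= N%:R * ln n by rewrite ler_wpM2l.
  rewrite -!(ler_int R) !rmorphN/=; apply/andP; split; lra.
have dw_sum x : H x -> \sum_(h <- L) (dw h x)%:~R <= -1 :> R.
  move=> Hx; apply: (@le_trans _ _ (\sum_(h <- L) (N%:R * d h x + 1))).
    apply: ler_sum => h _; have := dwE h x; rewrite ler_norml => /andP[_ e2]; lra.
  rewrite big_split/= -mulr_sumr big_const_seq iter_addr_0 count_predT -/n.
  have := d_sum x Hx; rewrite -/c => e1.
  have {}e1 : N%:R * (\sum_(h <- L) d h x) <= N%:R * - c by rewrite ler_wpM2l.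
  lra.
pose F (j : 'I_(2 * K).+1) : R := j%:R - K%:R.
(* The integral of [dw h] over [H]; its values in [[-K, K]] are shifted to ordinals. *)
pose J h := \sum_j F j * m [set x | H x /\ dw h x = j%:Z - K%:Z].
(* [dw h^-1] at [h^-1 * x] is minus [dw h] at [x], and [m] is invariant under this translation. *)
have JV h : h \in L -> J h^-1%g = - J h.
  move=> hL; rewrite /J (reindex_inj rev_ord_inj)/= -sumrN; apply: eq_bigr => j _.
  have jK : (j <= 2 * K)%N by rewrite -ltnS.
  have -> : F (rev_ord j) = - F j.
    by rewrite /F/= subSS natrB// natrM; ring.
  rewrite mulNr; congr (- (_ * _)); rewrite -[RHS](mM h^-1%g); last exact/HV/LH.
  congr m; apply/seteqP; split => x /=.
    move=> [Hx dx]; apply/ltranslateE; rewrite invgK; split; first by apply: HM => //; exact: LH.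
    rewrite /dw mulKg; move: dx; rewrite /dw invgK subSS => dx.
    by rewrite -[LHS]opprB dx -subzn// PoszM; ring.
  move=> /ltranslateE; rewrite invgK => -[Hx dx]; split.
    by rewrite -[x](mulKg h); apply: HM => //; exact/HV/LH.
  move: dx; rewrite /dw mulKg invgK subSS => dx.
  by rewrite -[LHS]opprB dx -subzn// PoszM; ring.
have sumJ0 : \sum_(h <- L) J h = 0.
  have : \sum_(h <- L) J h = - \sum_(h <- L) J h.
    rewrite -[in LHS](perm_big _ LV)/= big_map -sumrN big_seq [RHS]big_seq.
    by apply: eq_bigr => h; exact: JV.
  by move=> ?; lra.
(* [q] records all increments at once, so that the pointwise bound [dw_sum] can be integrated atom
   by atom. Outside [H] it may take default values, but [H] has full mass. *)
pose T := {ffun 'I_(size L) -> 'I_(2 * K).+1}.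
pose q x : T :=
  [ffun i : 'I_(size L) => inord (absz (dw (nth 1%g L i) x + K%:Z))].
have qE i x (j : 'I_(2 * K).+1) : H x -> (q x i = j) <-> dw (nth 1%g L i) x = j%:Z - K%:Z.
  move=> Hx; rewrite ffunE.
  have [e3 lt1] := absz_shift (dwK (nth 1%g L i) x (mem_nth _ (ltn_ord i)) Hx).
  split=> [<-|eE]; first by rewrite inordK// e3 addrK.
  by apply: val_inj; rewrite /= inordK// eE subrK.
have [m0 m1 mD] := fm.
have mDT A B : setT A -> setT B -> A `&` B = set0 -> m (A `|` B) = m A + m B.
  by move=> _ _; exact: mD.
have JE i : J (nth 1%g L (i : 'I_(size L))) =
    \sum_(t : T) F (t i) * m [set x | q x = t].
  rewrite -(@fa_image _ _ m setT _ _ q (fun t : T => t i) F mDT)//.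
  apply: eq_bigr => j _; congr (_ * _).
  rewrite -[RHS](fap_setI _ fm mH); congr m.
  by apply/seteqP; split => x /= [] => [Hx /(qE i x j Hx)|/[swap] Hx /(qE i x j Hx)].
have : \sum_(h <- L) J h <= -1.
  rewrite (big_nth 1%g) big_mkord (eq_bigr _ (fun i _ => JE i)) exchange_big/=.
  apply: (@le_trans _ _ (\sum_(t : T) -1 * m [set x | q x = t])).
    apply: ler_sum => t _; rewrite -mulr_suml.
    have [[x [Hx xt]]|nex] := pselect (exists x, H x /\ q x = t).
      rewrite ler_wpM2r//; apply: le_trans (dw_sum x Hx).
      rewrite (big_nth 1%g) big_mkord; apply: ler_sum => i _.
      have -> : dw (nth 1%g L i) x = (t i)%:Z - K%:Z by apply/qE; rewrite ?xt.
      by rewrite rmorphB.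
    (* A value not attained on [H] has mass 0, because [H] has mass 1. *)
    suff -> : m [set x | q x = t] = 0 by rewrite !mulr0.
    rewrite -(fap_setI _ fm mH) -[RHS](subrr 1) -[X in _ = _ - X]m1 -(fap_setC _ fm).
    by rewrite setCT; congr m; apply/seteqP; split => // x [xt Hx]; case: nex; exists x.
  rewrite -mulr_sumr -(fa_partition mDT (q := q) _ predT)//=.
  by rewrite (_ : [set x | true] = setT) ?m1 ?mulr1//; apply/seteqP; split.
by rewrite sumJ0; lra.
Qed.

(** By contradiction: otherwise averaging over a symmetric list contracts all vectors supported in
    [H] by a fixed factor, and [superharmonic] contradicts [no_superharmonic]. *)
Lemma almost_invariant_vectors H (S : seq G) (e : R) : countable [set: G] ->
  amenable_subgroup R H -> (forall h, h \in S -> H h) -> 0 < e ->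
  exists f : ell2, [/\ forall x, ~~ H x -> f x = 0, 0 < ell2_norm f &
    \sum_(h <- S) ell2_norm (lambda h f - f) ^+ 2 <= e * ell2_norm f ^+ 2].
Proof.
move=> cG aH SH e0; apply: contrapT => noinv.
(* The cap at 1 makes [kappa] nonnegative. *)
pose d := Num.min e 1.
have d0 : 0 < d by rewrite lt_min e0 ltr01.
have d1 : d <= 1 by rewrite ge_min lexx orbT.
have far (f : ell2) : (forall x, ~~ H x -> f x = 0) ->
    d * ell2_norm f ^+ 2 <= \sum_(h <- S) ell2_norm (lambda h f - f) ^+ 2.
  move=> fH; have [f0|f0] := eqVneq (ell2_norm f) 0.
    by rewrite f0 expr0n mulr0; apply: sumr_ge0 => h _; exact: sqr_ge0.
  rewrite leNgt; apply/negP => lt1; apply: noinv; exists f; split => //.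
    by rewrite lt_neqAle eq_sym f0 ell2_norm_ge0.
  by apply: le_trans (ltW lt1) _; rewrite ler_wpM2r ?sqr_ge0// ge_min lexx.
have [[H1 HF] _] := aH.
have HV x : H x -> H x^-1%g by move=> Hx; rewrite -div1g; exact: HF.
pose L' := S ++ [seq h^-1%g | h <- S]; pose L := 1%g :: L'.
have LH h : h \in L -> H h.
  rewrite in_cons mem_cat => /or3P[/eqP->//|/SH//|/mapP[k /SH/HV Hk ->]] //.
have LV : perm_eq [seq h^-1%g | h <- L] L.
  rewrite /= invg1 perm_cons map_cat -map_comp.
  by rewrite (eq_map (fun h => invgK h)) map_id perm_catC.
pose n : R := (size L)%:R; have n0 : 0 < n by rewrite ltr0n.
pose kappa := 1 - n ^- 2 * d.
have nd : 0 < n ^- 2 * d by rewrite mulr_gt0// invr_gt0 exprn_gt0.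
have kappa1 : kappa < 1 by rewrite /kappa ltrBlDr ltrDl.
have kappa0 : 0 <= kappa.
  rewrite subr_ge0 -[leRHS]mul1r ler_pM ?(ltW d0)//; first by rewrite invr_ge0 exprn_ge0// ltW.
  by rewrite invf_le1 ?exprn_gt0// exprn_ege1// ler1n.
have gap (f : ell2) : (forall x, ~~ H x -> f x = 0) ->
    ell2_norm (average L f) ^+ 2 <= kappa * ell2_norm f ^+ 2.
  move=> fH; apply: le_trans (average_contracts _ _) _.
  rewrite /kappa mulrBl mul1r lerD2l lerN2 -mulrA.
  rewrite ler_pM2l; last by rewrite invr_gt0 exprn_gt0.
  apply: le_trans (far _ fH) _; rewrite big_cat/= lerDl.
  by apply: sumr_ge0 => h _; exact: sqr_ge0.
have [w w0] := positive_ell2 cG.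
pose ind (x : G) : R := (H x)%:R.
have bind : bfun ind by exists 1 => x; rewrite /ind; case: (H x); rewrite ?normr0 ?normr1.
have wE x : mult ind w x = (ind x)%:C * w x by rewrite multE.
have supp x : ~~ H x -> mult ind w x = 0.
  by move=> /negbTE Hx; rewrite wE /ind Hx mul0r.
have pos x : H x -> 0 < complex.Re (mult ind w x).
  by move=> Hx; rewrite wE /ind Hx mul1r; have [r r0 ->] := w0 x.
have [s s1 [b [b0 bpos bsup]]] :=
  superharmonic aH.1 LH isT kappa0 kappa1 gap supp pos.
exact: (no_superharmonic aH LH LV s1 isT b0 bpos bsup).
Qed.

Definition lcomb (s : seq (R[i] * G)) : bop := \sum_(p <- s) p.1 *: lambda p.2.

(* The quasi-regular representation on [G / H] is weakly contained in the
   regular one (Hulanicki), so the indicator function of [H] defines a functional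
   of norm one. *)
Lemma sum_subgroup_le_opnorm H (s : seq (R[i] * G)) : countable [set: G] ->
  amenable_subgroup R H ->
  normc (\sum_(p <- s | H p.2) p.1) <= opnorm (lcomb s).
Proof.
move=> cG aH; have [[H1 HF] _] := aH.
have HV x : H x -> H x^-1%g by move=> Hx; rewrite -div1g; exact: HF.
have HM x y : H x -> H y -> H (x * y)%g.
  by move=> Hx Hy; have := HF _ _ Hx (HV _ Hy); rewrite !unfold_in invgK.
pose C := \sum_(p <- s | H p.2) normc p.1.
have C0 : 0 <= C by apply: sumr_ge0 => p _; exact: normc_ge0.
apply/ler_addgt0Pr => e e0.
(* The added 1 covers the case [C = 0]. *)
pose d := e / (C + 1).
have d0 : 0 < d by rewrite divr_gt0// ltr_wpDl.
pose S := [seq p.2 | p <- s & H p.2].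
have SH h : h \in S -> H h by move=> /mapP[p]; rewrite mem_filter => /andP[Hp _] ->.
have d20 : 0 < d ^+ 2 by rewrite exprn_gt0.
have [f [fH f0 finv]] := almost_invariant_vectors cG aH SH d20.
have near h : h \in S -> ell2_norm (lambda h f - f) <= d * ell2_norm f.
  move=> hS; rewrite -ler_sqr ?nnegrE ?ell2_norm_ge0 ?(mulr_ge0 (ltW d0) (ell2_norm_ge0 _))//.
  rewrite exprMn; apply: le_trans finv; rewrite (big_rem h)//= lerDl.
  by apply: sumr_ge0 => ? _; exact: sqr_ge0.
pose ind (x : G) : R := (H x)%:R.
have ind1 x : `|ind x| <= 1 by rewrite /ind; case: (H x); rewrite ?normr0 ?normr1.
have bind : bfun ind by exists 1.
(* Since [f] is supported in [H], its translate by [p.2] lives on the coset [p.2 H], which either is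
   [H] or misses it. *)
have restr : mult ind (lcomb s f) = \sum_(p <- s | H p.2) p.1 *: lambda p.2 f.
  apply/ell2P => x; rewrite multE// bop_sumE !ell2_sumE.
  rewrite mulr_sumr [RHS]big_mkcond/=; apply: eq_bigr => p _.
  rewrite bopZE ell2ZE -[lambda p.2 f x]/(f (p.2^-1 * x)%g) /ind.
  have [Hx|Hx] := boolP (H x); last first.
    rewrite mul0r; case: ifP => // Hp; rewrite fH ?mulr0//.
    by apply: contra Hx => Hx; rewrite -[x](mulVKg p.2); exact: HM.
  rewrite mul1r; case: ifPn => // Hp; rewrite fH ?mulr0//.
  apply: contra Hp => Hp; rewrite -[p.2]invgK; apply/HV.
  by rewrite -[_^-1%g](mulgK x); apply: HM => //; exact: HV.
have le1 : ell2_norm (\sum_(p <- s | H p.2) p.1 *: lambda p.2 f) <=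
    opnorm (lcomb s) * ell2_norm f.
  by rewrite -restr (le_trans (mult_norm _ ind1))// mul1r opnormP.
have le2 : ell2_norm (\sum_(p <- s | H p.2) p.1 *: (lambda p.2 f - f)) <=
    C * (d * ell2_norm f).
  rewrite /C mulr_suml big_seq_cond [leRHS]big_seq_cond.
  elim/big_ind2 : _ => [|x1 x2 y1 y2 h1 h2|p /andP[ps Hp]].
  - by rewrite ell2_norm0.
  - by rewrite (le_trans (ell2_normD _ _))// lerD.
  - rewrite ell2_normZ ler_wpM2l ?normc_ge0//; apply: near.
    by apply: map_f; rewrite mem_filter Hp.
rewrite -(ler_pM2r f0) -ell2_normZ scaler_suml.
have -> : \sum_(p <- s | H p.2) p.1 *: f =
    \sum_(p <- s | H p.2) p.1 *: lambda p.2 f -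
    \sum_(p <- s | H p.2) p.1 *: (lambda p.2 f - f).
  by rewrite -sumrB; apply: eq_bigr => p _; rewrite scalerBr subKr.
apply: le_trans (ell2_normD _ _) _; rewrite -scaleN1r ell2_normZ normcN normc1 mul1r.
rewrite mulrDl lerD//; apply: le_trans le2 _.
rewrite mulrA ler_pM2r// /d mulrA ler_pdivrMr ?ltr_wpDl//.
by rewrite mulrC ler_pM2l// lerDl.
Qed.

End almost_invariant_vectors.

(** * States of the reduced C*-algebra *)

Section complex_ultralimits.
Context {R : realType} {T : Type} (U : set_system T) (UU : UltraFilter U).
Implicit Types (f h : T -> R[i]).

Definition bcfun f := exists M, forall x, normc (f x) <= M.

Definition culim f : R[i] :=
  (ulim U (fun x => complex.Re (f x))) +i* (ulim U (fun x => complex.Im (f x))).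

Lemma normcIm_le (z : R[i]) : `|complex.Im z| <= normc z.
Proof.
rewrite -ler_sqr ?nnegrE ?normc_ge0// normc_sqr -[leLHS]/(`|complex.Im z| ^+ 2).
by rewrite real_normK ?num_real// lerDr sqr_ge0.
Qed.

Lemma bcfun_Re f : bcfun f -> bfun (fun x => complex.Re (f x)).
Proof. by move=> [M fM]; exists M => x; apply: le_trans (fM x); exact: normcRe_le. Qed.

Lemma bcfun_Im f : bcfun f -> bfun (fun x => complex.Im (f x)).
Proof. by move=> [M fM]; exists M => x; apply: le_trans (fM x); exact: normcIm_le. Qed.

Lemma bcfunZ c f : bcfun f -> bcfun (fun x => c * f x).
Proof.
move=> [M fM]; exists (normc c * M) => x.
by rewrite normcM ler_wpM2l ?normc_ge0.
Qed.

Lemma culimD f h : bcfun f -> bcfun h -> culim (fun x => f x + h x) = culim f + culim h.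
Proof.
move=> bf bh; rewrite /culim; simpc; rewrite -!ulimD//; try exact: bcfun_Re; try exact: bcfun_Im.
by congr (_ +i* _)%C; congr ulim; apply/funext => x; case: (f x) (h x) => ? ? [].
Qed.

Lemma culimZ c f : bcfun f -> culim (fun x => c * f x) = c * culim f.
Proof.
move=> bf; rewrite /culim; case: c => a b; simpc.
have bRe := bcfun_Re bf; have bIm := bcfun_Im bf.
rewrite -!ulimZ// -ulimB// -?ulimD//; try exact: bfunZ.
by congr (_ +i* _)%C; congr ulim; apply/funext => x; case: (f x) => u v; simpc.
Qed.

(** Multiplying by the conjugate of the limit [z] turns the modulus into a real part, where the real
    ultralimit applies. *)
Lemma culim_norm f c : bcfun f -> U [set x | normc (f x) <= c] -> normc (culim f) <= c.
Proof.
move=> bf Uf; have FF := @ultra_proper _ _ UU.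
have c0 : 0 <= c by have [x xc] := filter_ex Uf; apply: le_trans xc; exact: normc_ge0.
have [->|z0] := eqVneq (culim f) 0; first by rewrite normc0.
have [z zE] : exists z, z = culim f by exists (culim f).
rewrite -zE in z0 *.
have nz : normc z != 0 by apply: contra_neq z0; exact: eq0_normc.
have nz0 : 0 < normc z by rewrite lt_neqAle eq_sym nz normc_ge0.
have bzf : bcfun (fun x => z^* * f x) by exact: bcfunZ.
have zz : complex.Re (z^* * z) = normc z ^+ 2.
  by rewrite normc_sqr; case: (z) => u v; simpc; rewrite /= !expr2.
have nzC : normc z^* = normc z.
  by case: (z) => u v; rewrite /= sqrrN.
suff : normc z ^+ 2 <= normc z * c by rewrite expr2 ler_pM2l.
rewrite -zz [X in z^* * X]zE -culimZ//; apply: ulim_near_le; first exact: bcfun_Re.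
apply: filterS Uf => x /= fc.
apply: le_trans (ler_norm _) _; apply: le_trans (normcRe_le _) _.
by rewrite normcM nzC ler_wpM2l// normc_ge0.
Qed.

End complex_ultralimits.

Section density.
Context {R : realType} {G : groupType}.
Local Notation bop := (bop R G).
Local Notation Cstar := (Cstar R G).
Implicit Types (s t : seq (R[i] * G)) (S T : bop).

Lemma lcomb_cat s t : lcomb (s ++ t) = lcomb s + lcomb t :> bop.
Proof. by rewrite /lcomb big_cat. Qed.

Definition scale_comb (c : R[i]) s := [seq (c * p.1, p.2) | p <- s].

Lemma lcomb_scale c s : lcomb (scale_comb c s) = c *: lcomb s :> bop.
Proof.
rewrite /lcomb big_map scaler_sumr; apply: eq_bigr => p _.
by rewrite scalerA.
Qed.

Definition mul_comb s t := [seq (p.1 * q.1, (p.2 * q.2)%g) | p <- s, q <- t].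

Lemma lcomb_mul s t : lcomb (mul_comb s t) = lcomb s * lcomb t :> bop.
Proof.
rewrite /lcomb big_allpairs_dep/= mulr_suml; apply: eq_bigr => p _.
rewrite mulr_sumr; apply: eq_bigr => q _.
by rewrite lambdaM -scalerAl -scalerAr scalerA.
Qed.

Definition adj_comb s := [seq (p.1^*, p.2^-1%g) | p <- s].

Lemma is_adjointD S S' T T' : is_adjoint S S' -> is_adjoint T T' ->
  is_adjoint (S + T : bop) (S' + T').
Proof. by move=> aS aT f h; rewrite !bopDE innerDl innerDr aS aT. Qed.

Lemma is_adjointZ (c : R[i]) S S' : is_adjoint S S' -> is_adjoint (c *: S : bop) (c^* *: S').
Proof. by move=> aS f h; rewrite !bopZE innerZl innerZr conjCK aS. Qed.

Lemma is_adjointN S S' : is_adjoint S S' -> is_adjoint (- S : bop) (- S').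
Proof. by move=> aS f h; rewrite !bopNE innerNl innerNr aS. Qed.

Lemma is_adjoint_sym S T : is_adjoint S T -> is_adjoint T S.
Proof. by move=> aST f h; rewrite inner_conj -aST -inner_conj. Qed.

Lemma lcomb_adj s : is_adjoint (lcomb s : bop) (lcomb (adj_comb s)).
Proof.
rewrite /lcomb big_map; elim: s => [|p s IH].
  by move=> f h; rewrite !big_nil inner0l inner_conj inner0l conjC0.
rewrite !big_cons; apply: is_adjointD => //; apply: is_adjointZ => f h.
exact: inner_lambda.
Qed.

Lemma adjoint_opnorm S T : is_adjoint S T -> opnorm T <= opnorm S.
Proof.
move=> aST; apply: opnorm_leP => [|f]; first exact: opnorm_ge0.
have [->|Tf0] := eqVneq (ell2_norm (T f)) 0.
  by rewrite mulr_ge0 ?opnorm_ge0 ?ell2_norm_ge0.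
have {}Tf0 : 0 < ell2_norm (T f) by rewrite lt_neqAle eq_sym Tf0 ell2_norm_ge0.
rewrite -(ler_pM2l Tf0) -expr2 -Re_innerii -aST.
apply: le_trans (ler_norm _) _; apply: le_trans (Re_inner_CS _ _) _.
rewrite mulrCA mulrA ler_wpM2r ?ell2_norm_ge0//.
exact: opnormP.
Qed.

Lemma opnorm0 : opnorm (0 : bop) = 0.
Proof. by rewrite -(scale0r 0) opnormZ normc0 mul0r. Qed.

Lemma mul_small (k x d : R) : 0 <= k -> 0 <= x -> x < d / (k + 1) -> k * x < d.
Proof.
move=> k0 x0; rewrite ltr_pdivlMr ?ltr_wpDl// mulrC; apply: le_lt_trans.
by rewrite ler_wpM2r// lerDl.
Qed.

Lemma bop_norm_def T : `|T| = (opnorm T)%:C.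
Proof. by []. Qed.

(** The norm limits of combinations of the [lambda g] form a closed star subalgebra containing the
    generators, and [cstar_lambda] is the least such set. *)
Lemma cstar_lambda_dense T : cstar_lambda T -> forall e, 0 < e ->
  exists s, opnorm (T - lcomb s) < e.
Proof.
pose A : set bop := [set T | forall e, 0 < e -> exists s, opnorm (T - lcomb s) < e].
suff : @cstar_lambda R G `<=` A by apply.
clear T.
apply: cstar_lambda_sub.
- split; first split.
  + apply: (@mem_set _ A) => e e0; exists [:: (1, 1%g)].
    by rewrite /lcomb big_seq1 lambda1 scale1r subrr opnorm0.
  + move=> c S T /(@set_mem _ A) AS /(@set_mem _ A) AT.
    apply: (@mem_set _ A) => e e0.
    have d0 : 0 < e / 2 / (normc c + 1).
      by rewrite !divr_gt0// ltr_wpDl ?normc_ge0.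
    have [s sS] := AS _ d0; have [t tT] := AT _ (divr_gt0 e0 (ltr0Sn _ 1)).
    exists (scale_comb c s ++ t); rewrite lcomb_cat lcomb_scale opprD addrACA -scalerBr.
    apply: le_lt_trans (opnormD _ _) _; rewrite (splitr e) ltrD// opnormZ.
    by apply: mul_small => //; rewrite ?normc_ge0 ?opnorm_ge0.
  + move=> S T /(@set_mem _ A) AS /(@set_mem _ A) AT.
    apply: (@mem_set _ A) => e e0.
    have e20 : 0 < e / 2 by rewrite divr_gt0.
    have d0 : 0 < e / 2 / (opnorm S + 1) by rewrite divr_gt0// ltr_wpDl ?opnorm_ge0.
    have [t tT] := AT _ d0.
    have d'0 : 0 < e / 2 / (opnorm (lcomb t : bop) + 1).
      by rewrite divr_gt0// ltr_wpDl ?opnorm_ge0.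
    have [s sS] := AS _ d'0; exists (mul_comb s t); rewrite lcomb_mul.
    have -> : S * T - lcomb s * lcomb t = S * (T - lcomb t) + (S - lcomb s) * lcomb t.
      by rewrite mulrBr mulrBl addrA subrK.
    apply: le_lt_trans (opnormD _ _) _; rewrite (splitr e) ltrD//.
      apply: le_lt_trans (opnormM _ _) _.
      by apply: mul_small => //; rewrite ?opnorm_ge0.
    apply: le_lt_trans (opnormM _ _) _; rewrite mulrC.
    by apply: mul_small => //; rewrite ?opnorm_ge0.
  (* Taking adjoints does not increase the norm, so the adjoint of the approximant approximates the
     adjoint. *)
  + move=> S T AS aST e /AS[s sS]; exists (adj_comb s); apply: le_lt_trans sS.
    apply: adjoint_opnorm; apply: is_adjointD => //; apply: is_adjointN.
    exact: lcomb_adj.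
- move=> T clT e e0; have e20 : 0 < e / 2 by rewrite divr_gt0.
  have [|S [AS TS]] := clT (ball T (e / 2)%:C).
    by apply: nbhsx_ballx; rewrite ltcR.
  have [s sS] := AS _ e20; exists s.
  have -> : T - lcomb s = (T - S) + (S - lcomb s) by rewrite addrA subrK.
  apply: le_lt_trans (opnormD _ _) _; rewrite (splitr e) ltrD//.
  by move: TS; rewrite -ball_normE /ball_/= bop_norm_def ltcR.
- move=> _ [g _ <-] e e0; exists [:: (1, g)].
  by rewrite /lcomb big_seq1 scale1r subrr opnorm0.
Qed.

End density.

Section contractive_states.
Context {R : realType} {G : groupType}.
Local Notation bop := (bop R G).
Local Notation Cstar := (Cstar R G).

Lemma inner_gram (a b : bop) f : is_adjoint a b ->
  inner ((b * a : bop) f) f = (ell2_norm (a f) ^+ 2)%:C.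
Proof. by move=> ab; rewrite bopME (is_adjoint_sym ab) inner_norm. Qed.

(** Write [p] for [b * a]. Contractivity on [p + i r] for all real [r] makes [tau p] real;
    contractivity on [1 - t p] for a small [t] makes it nonnegative. *)
Lemma contractive_state (tau : {scalar Cstar}) :
  (forall a, normc (tau a) <= opnorm (val a)) -> tau 1 = 1 -> state tau.
Proof.
move=> contr tau1; split=> // a b ab.
set p := b * a.
have pE f : inner ((val p : bop) f) f = (ell2_norm ((val a : bop) f) ^+ 2)%:C.
  exact: (inner_gram f ab).
have Im0 : complex.Im (tau p) = 0.
  set P := opnorm (val p); pose x := complex.Re (tau p); pose y := complex.Im (tau p).
  have key (r : R) : x ^+ 2 + (y + r) ^+ 2 <= P ^+ 2 + r ^+ 2.
    have -> : x ^+ 2 + (y + r) ^+ 2 = normc (tau (p + (0 +i* r)%C *: 1)) ^+ 2.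
      rewrite linearD linearZ/= tau1 normc_sqr /x /y.
      by case: (tau p) => u v; simpc.
    have le1 : opnorm (val (p + (0 +i* r)%C *: 1)) <= Num.sqrt (P ^+ 2 + r ^+ 2).
      apply: opnorm_leP => [|f]; first exact: sqrtr_ge0.
      rewrite -ler_sqr ?nnegrE ?mulr_ge0 ?ell2_norm_ge0 ?sqrtr_ge0//.
      rewrite exprMn [Num.sqrt (P ^+ 2 + _) ^+ 2]sqr_sqrtr ?addr_ge0 ?sqr_ge0//.
      have -> : (val (p + (0 +i* r)%C *: 1) : bop) f = (val p : bop) f + (0 +i* r)%C *: f by [].
      rewrite ell2_normD_sqr ell2_normZ innerZr pE.
      have -> : complex.Re ((0 +i* r)%C^* * (ell2_norm ((val a : bop) f) ^+ 2)%:C) = 0.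
        by simpc.
      rewrite mulr0 addr0 exprMn normc_sqr/= expr0n add0r mulrDl lerD2r.
      rewrite -exprMn lerXn2r ?nnegrE ?mulr_ge0 ?ell2_norm_ge0 ?opnorm_ge0//.
      exact: opnormP.
    rewrite -[leRHS](@sqr_sqrtr _ (P ^+ 2 + r ^+ 2)) ?addr_ge0 ?sqr_ge0//.
    rewrite lerXn2r ?nnegrE ?normc_ge0 ?sqrtr_ge0//.
    exact: le_trans (contr _) le1.
  apply/eqP; apply: contraT => y0; rewrite -/y in y0.
  (* Chosen so that [2 y r = P^2 + 1], which exceeds the [P^2] allowed by [key]. *)
  have := key ((P ^+ 2 + 1) / (2 * y)).
  have -> : (y + (P ^+ 2 + 1) / (2 * y)) ^+ 2 =
    y ^+ 2 + (P ^+ 2 + 1) + ((P ^+ 2 + 1) / (2 * y)) ^+ 2 by field.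
  by have := sqr_ge0 x; have := sqr_ge0 y; lra.
have Re0 : 0 <= complex.Re (tau p).
  (* The norm of [p f] is at most [B] times that of [a f], so with [t B^2 <= 1] the quadratic term
     in [t] is absorbed by the linear one. *)
  pose B := opnorm (val b); pose t := (B ^+ 2 + 1)^-1.
  have B0 : 0 <= B ^+ 2 by exact: sqr_ge0.
  have t0 : 0 < t by rewrite invr_gt0 ltr_wpDl.
  have le1 : opnorm (val (1 - t%:C *: p)) <= 1.
    apply: opnorm_leP => // f; rewrite mul1r.
    rewrite -ler_sqr ?nnegrE ?ell2_norm_ge0//.
    have -> : (val (1 - t%:C *: p) : bop) f = f - t%:C *: (val p : bop) f by [].
    rewrite ell2_normB_sqr ell2_normZ normc_realC ger0_norm ?(ltW t0)//.
    rewrite innerZr inner_conj pE !conjC_real Re_realM.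
    rewrite -[complex.Re _%:C]/(ell2_norm ((val a : bop) f) ^+ 2).
    have : ell2_norm ((val p : bop) f) ^+ 2 <= B ^+ 2 * ell2_norm ((val a : bop) f) ^+ 2.
      rewrite -exprMn lerXn2r ?nnegrE ?mulr_ge0 ?ell2_norm_ge0 ?opnorm_ge0//.
      exact: (opnormP (val b) ((val a : bop) f)).
    set A := ell2_norm ((val a : bop) f) ^+ 2 => le2; rewrite exprMn.
    have A0 : 0 <= A by exact: sqr_ge0.
    have tB : t * B ^+ 2 <= 1.
      by rewrite /t mulrC ler_pdivrMr ?ltr_wpDl// mul1r lerDl.
    have : t ^+ 2 * ell2_norm ((val p : bop) f) ^+ 2 <= t * A.
      apply: (@le_trans _ _ (t ^+ 2 * (B ^+ 2 * A))); first by rewrite ler_wpM2l ?sqr_ge0.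
      have -> : t ^+ 2 * (B ^+ 2 * A) = t * B ^+ 2 * (t * A) by ring.
      by rewrite ler_piMl// mulr_ge0// ltW.
    have : 0 <= t * A by rewrite mulr_ge0// ltW.
    by lra.
  have := le_trans (contr _) le1; rewrite linearB linearZ/= tau1.
  move=> /(le_trans (normcRe_le _)) /(le_trans (ler_norm _)).
  rewrite raddfB/= Re_realM lerBlDr lerDl pmulr_rge0//.
by rewrite lecE Im0 Re0 eqxx.
Qed.

End contractive_states.

(** * Extending a contractive function on the group to a state *)

Section contractive_extension.
Context {R : realType} {G : groupType}.
Local Notation bop := (bop R G).
Local Notation Cstar := (Cstar R G).
Variable phi : G -> R[i].

Definition comb_val (s : seq (R[i] * G)) : R[i] := \sum_(p <- s) p.1 * phi p.2.

Hypothesis contr : forall s, normc (comb_val s) <= opnorm (lcomb s : bop).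

Lemma comb_val_cat s t : comb_val (s ++ t) = comb_val s + comb_val t.
Proof. by rewrite /comb_val big_cat. Qed.

Lemma comb_val_scale c s : comb_val (scale_comb c s) = c * comb_val s.
Proof.
by rewrite /comb_val big_map mulr_sumr; apply: eq_bigr => p _; rewrite mulrA.
Qed.

Let approx_ex (a : Cstar) (n : nat) :
  exists s, opnorm (val a - lcomb s) < n.+1%:R^-1.
Proof.
by apply: cstar_lambda_dense; [exact: (set_mem (valP a))|rewrite invr_gt0].
Qed.

Definition approx (a : Cstar) (n : nat) : seq (R[i] * G) := projT1 (cid (approx_ex a n)).

Let approxP a n : opnorm (val a - lcomb (approx a n)) < n.+1%:R^-1.
Proof. exact: projT2 (cid (approx_ex a n)). Qed.

Let ultra_ex := ultraFilterLemma (@eventually_filter).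

Let U : set_system nat := projT1 (cid ultra_ex).

Let UU : UltraFilter U. Proof. exact: (projT2 (cid ultra_ex)).1. Qed.

(** [approx] is an arbitrary choice of approximants; [extend_near] shows that the limit does not
    depend on it. *)
Definition extend_fun (a : Cstar) : R[i] := culim U (fun n => comb_val (approx a n)).

Let bapprox a : bcfun (fun n => comb_val (approx a n)).
Proof.
exists (opnorm (val a) + 1) => n; apply: le_trans (contr _) _.
have -> : lcomb (approx a n) = val a - (val a - lcomb (approx a n)) by rewrite subKr.
apply: le_trans (opnormD _ _) _; rewrite opnormN lerD2l.
apply: le_trans (ltW (approxP a n)) _.
by rewrite invf_le1// ler1n.
Qed.

(** This one estimate yields linearity, contractivity (with [s] empty) and the values on
    generators. *)
Lemma extend_near (a : Cstar) s : normc (extend_fun a - comb_val s) <= opnorm (val a - lcomb s).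
Proof.
apply/ler_addgt0Pr => e e0.
have -> : extend_fun a - comb_val s = culim U (fun n => comb_val (approx a n ++ scale_comb (-1) s)).
  rewrite (_ : (fun n => _) = (fun n => comb_val (approx a n) + - comb_val s)).
    rewrite (@culimD _ _ _ UU)//; last by exists (normc (- comb_val s)).
    congr (_ + _); rewrite /culim !(@ulim_cst _ _ _ UU).
    by case: (- comb_val s).
  by apply/funext => n; rewrite comb_val_cat comb_val_scale mulN1r.
have [N Ne] : exists N : nat, N.+1%:R^-1 <= e.
  exists (Num.truncn e^-1); rewrite -[leRHS]invrK lef_pV2 ?posrE ?invr_gt0//.
  by rewrite ltW// truncnS_gt.
apply: (@culim_norm _ _ _ UU) => //.
  have [M bM] := bapprox a; exists (M + normc (comb_val s)) => n.
  rewrite comb_val_cat comb_val_scale mulN1r.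
  by rewrite (le_trans (le_normcD _ _))// normcN lerD.
apply: (projT2 (cid ultra_ex)).2; exists N => // n /= Nn.
apply: le_trans (contr _) _; rewrite lcomb_cat lcomb_scale scaleN1r.
have -> : lcomb (approx a n) - lcomb s =
    (val a - lcomb s) - (val a - lcomb (approx a n)) :> bop.
  by rewrite opprB [RHS]addrC addrA subrK.
apply: le_trans (opnormD _ _) _; rewrite opnormN lerD2l.
apply: le_trans (ltW (approxP a n)) _; apply: le_trans Ne.
by rewrite lef_pV2 ?posrE// ler_nat.
Qed.

Lemma extend_linear : scalar extend_fun.
Proof.
move=> c a b; apply/eqP; rewrite -subr_eq0; apply/eqP/eq0_normc/eqP.
rewrite eq_le normc_ge0 andbT; apply/ler_addgt0Pr => e e0; rewrite add0r.
have d0 : 0 < e / 2 / (2 * normc c + 1).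
  by rewrite !divr_gt0// ltr_wpDl ?mulr_ge0 ?normc_ge0.
have [s sa] := cstar_lambda_dense (set_mem (valP a)) d0.
have [t tb] := cstar_lambda_dense (set_mem (valP b)) (divr_gt0 e0 (ltr0Sn _ 3)).
set st := scale_comb c s ++ t.
have stE : comb_val st = c * comb_val s + comb_val t.
  by rewrite comb_val_cat comb_val_scale.
have -> : extend_fun (c *: a + b) - (c * extend_fun a + extend_fun b) =
  (extend_fun (c *: a + b) - comb_val st) - (c * (extend_fun a - comb_val s) +
    (extend_fun b - comb_val t)).
  rewrite stE; move: (extend_fun _) (extend_fun a) (extend_fun b) (comb_val s) (comb_val t).
  by move=> x y z u v; ring.
apply: le_trans (le_normcD _ _) _; rewrite normcN.
have e1 : normc (extend_fun (c *: a + b) - comb_val st) <=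
    normc c * opnorm (val a - lcomb s) + opnorm (val b - lcomb t).
  apply: le_trans (extend_near _ _) _; rewrite lcomb_cat lcomb_scale.
  have -> : val (c *: a + b) - (c *: lcomb s + lcomb t) =
    c *: (val a - lcomb s) + (val b - lcomb t) by rewrite scalerBr opprD addrACA.
  by apply: le_trans (opnormD _ _) _; rewrite opnormZ.
have e2 : normc (c * (extend_fun a - comb_val s) + (extend_fun b - comb_val t)) <=
    normc c * opnorm (val a - lcomb s) + opnorm (val b - lcomb t).
  apply: le_trans (le_normcD _ _) _; rewrite normcM lerD ?extend_near//.
  by rewrite ler_wpM2l ?normc_ge0 ?extend_near.
have e3 : 2 * normc c * opnorm (val a - lcomb s) < e / 2.
  by apply: mul_small => //; rewrite ?mulr_ge0 ?normc_ge0 ?opnorm_ge0.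
by lra.
Qed.

HB.instance Definition _ :=
  GRing.isLinear.Build R[i] Cstar R[i] *%R extend_fun extend_linear.

Definition extend : {scalar Cstar} := extend_fun.

Lemma extend_contractive a : normc (extend a) <= opnorm (val a).
Proof.
have := extend_near a [::].
by rewrite /lcomb /comb_val !big_nil !subr0.
Qed.

Lemma extend_lambda g : extend (Cstar_lambda R g) = phi g.
Proof.
have := extend_near (Cstar_lambda R g) [:: (1, g)].
rewrite /lcomb /comb_val !big_seq1 scale1r mul1r subrr opnorm0 => le0.
apply/eqP; rewrite -subr_eq0; apply/eqP/eq0_normc/le_anti.
by rewrite le0 normc_ge0.
Qed.

Lemma extend_state : phi 1%g = 1 -> state extend.
Proof.
move=> phi1; apply: contractive_state; first exact: extend_contractive.
rewrite -[RHS]phi1 -extend_lambda; congr (extend _).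
by apply: val_inj; rewrite /= lambda1.
Qed.

End contractive_extension.

(** * Stationary measures and stationary states *)

Section cylinders.
Context {R : realType} {G : groupType}.
Local Notation Suba := (Suba R G).

Definition cyl (g : G) : set Suba := [set K | (val K : G -> bool) g].

Lemma continuous_eval (g : G) : continuous (fun K : Suba => (val K : G -> bool) g).
Proof.
move=> K; have c1 := @initial_continuous _ _ (@set_val _ (@amenable_subgroup R G)) K.
have c2 := @proj_continuous G (fun=> bool) g (val K).
exact: (@cvg_comp _ _ _ _ _ _ _ _ c1 c2).
Qed.

Lemma open_eval (g : G) (B : set bool) : open [set K : Suba | B ((val K : G -> bool) g)].
Proof.
apply: (@open_comp _ _ (fun K : Suba => (val K : G -> bool) g) B).
  by move=> K _; exact: continuous_eval.
exact: discrete_open.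
Qed.

Lemma measurable_open (A : set Suba) : open A -> measurable A.
Proof. by move=> oA; exact: sub_sigma_algebra. Qed.

Lemma measurable_cyl g : measurable (cyl g).
Proof. exact: (measurable_open (@open_eval g [set b | is_true b])). Qed.

Lemma measurable_Suba_fin (T : finType) (q : Suba -> T) :
  (forall t, measurable [set K | q K = t]) ->
  forall P : pred T, measurable [set K | P (q K)].
Proof.
move=> mq P; rewrite (_ : [set K | P (q K)] = \bigcup_(t in [set t | P t]) [set K | q K = t]).
  by apply: fin_bigcup_measurable => // ; exact: finite_finset.
apply/seteqP; split => K /=; first by move=> PK; exists (q K).
by move=> [t /= Pt ->].
Qed.

Lemma Suba_act_trivial g : Suba_act g (trivial_subgroup R G) = trivial_subgroup R G.
Proof.
apply: val_inj; apply/funext => x.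
by rewrite /= /conj_subgroup conjg_eq1.
Qed.

End cylinders.

Section stationarity.
Context {R : realType} {G : groupType}.
Local Notation Cstar := (Cstar R G).

Lemma Cstar_act_lambda g k : Cstar_act g^-1%g (Cstar_lambda R k) = @Cstar_lambda R G (k ^ g)%g.
Proof.
apply: val_inj; rewrite /= -[LHS]/(lambda R g^-1 * lambda R k * lambda R g^-1^-1).
by rewrite invgK -!lambdaM conjgE mulgA.
Qed.

Lemma Cstar_act_linear g : linear (@Cstar_act R G g).
Proof.
by move=> c a b; rewrite /Cstar_act mulrDr mulrDl -scalerAr -scalerAl.
Qed.

Lemma opnorm_Cstar_act g (a : Cstar) : opnorm (val (Cstar_act g a)) <= opnorm (val a).
Proof.
rewrite -[val _]/(lambda R g * val a * lambda R g^-1).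
apply: le_trans (opnormM _ _) _; rewrite -[leRHS]mulr1.
apply: ler_pM; [exact: opnorm_ge0|exact: opnorm_ge0| |exact: opnorm_lambda_le].
apply: le_trans (opnormM _ _) _.
by apply: ler_piMl; [exact: opnorm_ge0|exact: opnorm_lambda_le].
Qed.

Variables (mu : G -> R) (pmu : prob mu) (tau : {scalar Cstar}).
Hypothesis contr : forall a, normc (tau a) <= opnorm (val a).

Let F (A : {fset G}) (a : Cstar) : R[i] :=
  partial_sum (fun g => (mu g)%:C * tau (Cstar_act g^-1%g a)) A.

Let Flin A (c : R[i]) (a b : Cstar) : F A (c *: a + b) = c * F A a + F A b.
Proof.
rewrite /F !partial_sumE.
elim: (enum_fset A) => [|g l IH]; first by rewrite !big_nil mulr0 addr0.
rewrite !big_cons IH Cstar_act_linear [tau _]linearP.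
move: (tau _) (tau _) (\sum_(_ <- _) _) (\sum_(_ <- _) _) => x y z t.
rewrite /=; ring.
Qed.

Let Fbound A a : normc (F A a) <= opnorm (val a).
Proof.
have [mu0 mu1] := pmu; rewrite /F partial_sumE.
apply: (@le_trans _ _ (\sum_(g <- A) mu g * opnorm (val a))).
  elim/big_ind2 : _ => [|x1 x2 y1 y2 h1 h2|g _]; first by rewrite normc0.
    by rewrite (le_trans (le_normcD _ _))// lerD.
  rewrite normcM normc_realC ger0_norm// ler_wpM2l//.
  exact: le_trans (contr _) (opnorm_Cstar_act _ _).
rewrite -mulr_suml ler_piMl ?opnorm_ge0// -partial_sumE -lee_fin -mu1.
exact: partial_sum_le_esum.
Qed.

(* By density and contractivity, stationarity can be tested on the unitaries. *)
Lemma stationary_of_lambda :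
  (forall k, partial_sum (fun g => (mu g)%:C * tau (@Cstar_lambda R G (k ^ g)%g)) @ totally -->
    (tau (Cstar_lambda R k) : (R[i])^o)) ->
  stationary_state mu tau.
Proof.
move=> cvl0.
have cvl k : (F^~ (Cstar_lambda R k) : _ -> (R[i])^o) @ totally -->
    (tau (Cstar_lambda R k) : (R[i])^o).
  have := cvl0 k; rewrite (_ : partial_sum _ = F^~ (Cstar_lambda R k))//.
  apply/funext => A; rewrite /F !partial_sumE; apply: eq_bigr => g _.
  by rewrite Cstar_act_lambda.
pose lc (s : seq (R[i] * G)) : Cstar := \sum_(p <- s) p.1 *: Cstar_lambda R p.2.
have lcE s : val (lc s) = lcomb s.
  by rewrite /lc /lcomb raddf_sum; apply: eq_bigr.
have cvs s : (F^~ (lc s) : _ -> (R[i])^o) @ totally --> (tau (lc s) : (R[i])^o).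
  rewrite /lc; elim: s => [|p s IH].
    rewrite big_nil linear0 (_ : F^~ 0 = fun=> 0); first exact: cvg_cst.
    apply/funext => A; have := Fbound A 0; rewrite opnorm0 => F0.
    by apply: eq0_normc; apply: le_anti; rewrite F0 normc_ge0.
  rewrite big_cons linearP/=.
  rewrite (_ : F^~ _ = fun A => p.1 * F A (Cstar_lambda R p.2) +
     F A (\sum_(p <- s) p.1 *: Cstar_lambda R p.2)).
    by apply: cvgD; [apply: cvgMr; exact: cvl|exact: IH].
  by apply/funext => A; rewrite Flin.
move=> a; apply/(@cvgrPdist_le _ (R[i])^o _ totally _) => e e0.
have [Re0 eE] : 0 < complex.Re e /\ e = (complex.Re e)%:C.
  by move: e e0 => [x y]; rewrite ltcE /= => /andP[/eqP-> x0].
have d0 : 0 < complex.Re e / 3 by rewrite divr_gt0.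
have [s sa] := cstar_lambda_dense (set_mem (valP a)) d0.
have d0C : 0 < (complex.Re e / 3)%:C :> R[i] by rewrite ltcR.
have /cvgrPdist_le/(_ _ d0C) := cvs s; apply: filterS => A.
rewrite !normc_def lecR => h; rewrite -/(F A a) eE lecR.
have aE : a = 1 *: (a - lc s) + lc s by rewrite scale1r subrK.
have nas : opnorm (val (a - lc s)) < complex.Re e / 3.
  by rewrite -[val _]/(val a - val (lc s)) lcE.
rewrite [in F A a]aE Flin mul1r.
have -> : tau a - (F A (a - lc s) + F A (lc s)) =
   tau (a - lc s) - F A (a - lc s) + (tau (lc s) - F A (lc s)).
  by rewrite linearB/=; move: (tau a) (F A _) (F A _) (tau _);
    move=> x y z t; ring.
apply: le_trans (le_normcD _ _) _; apply: le_trans (lerD (le_normcD _ _) h) _.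
rewrite normcN.
have h1 := contr (a - lc s).
have h2 := Fbound A (a - lc s).
lra.
Qed.

End stationarity.

Section state_of_measure.
Context {R : realType} {G : groupType} (countG : countable [set: G]).
Local Notation Suba := (Suba R G).
Local Notation bop := (bop R G).
Local Notation Cstar := (Cstar R G).
Variable nu : probability Suba R.

Definition cyl_mass (g : G) : R := fine (nu (cyl g)).

Let fnu A : measurable A -> nu A = (fine (nu A))%:E.
Proof. by move=> mA; rewrite fineK// fin_num_measure. Qed.

(** Only the elements of [K] in the support of [s] matter. Grouping the subgroups by these exhibits
    the value as a finite convex combination of the sums bounded in [sum_subgroup_le_opnorm]. *)
Lemma cyl_mass_contractive s :
  normc (comb_val (fun g => (cyl_mass g)%:C) s) <= opnorm (lcomb s : bop).
Proof.
pose n := size s; pose T := {ffun 'I_n -> bool}.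
pose p0 : R[i] * G := (0, 1%g).
pose gi (i : 'I_n) := (nth p0 s i).2; pose ci (i : 'I_n) := (nth p0 s i).1.
pose q (K : Suba) : T := [ffun i => (val K : G -> bool) (gi i)].
pose m (A : set Suba) := fine (nu A).
have mq (t : T) : measurable [set K | q K = t].
  rewrite (_ : [set K | q K = t] =
    \bigcap_(i in [set: 'I_n]) [set K : Suba | [set t i] ((val K : G -> bool) (gi i))]).
    apply: fin_bigcap_measurable => // i _; apply: measurable_open; exact: open_eval.
  apply/seteqP; split => K /=; first by move=> <- i _; rewrite ffunE.
  by move=> Ki; apply/ffunP => i; rewrite ffunE; exact: Ki.
have mP := measurable_Suba_fin mq.
have mD (A B : set Suba) : measurable A -> measurable B -> A `&` B = set0 ->
    m (A `|` B) = m A + m B.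
  by move=> mA mB AB; rewrite /m measureU// fineD ?fin_num_measure.
have cylE i : cyl_mass (gi i) = \sum_(t : T) (t i)%:R * m [set K | q K = t].
  rewrite -(@fa_image _ _ m measurable _ _ q (fun t : T => t i) (fun b : bool => b%:R) mD mP).
  rewrite big_bool/= mul0r addr0 mul1r; congr m.
  by apply/seteqP; split => K; rewrite /= ffunE.
have -> : comb_val (fun g => (cyl_mass g)%:C) s =
    \sum_(t : T) (\sum_(i < n) ci i * (t i)%:R) * (m [set K | q K = t])%:C.
  rewrite /comb_val (big_nth p0) big_mkord.
  under eq_bigr => i _ do rewrite -/(gi i) cylE rmorph_sum mulr_sumr.
  rewrite exchange_big/=; apply: eq_bigr => t _; rewrite mulr_suml.
  apply: eq_bigr => i _; rewrite rmorphM rmorph_nat mulrA; congr (_ * _ * _).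
have m0 A : 0 <= m A by rewrite fine_ge0.
apply: (@le_trans _ _ (\sum_(t : T) opnorm (lcomb s : bop) * m [set K | q K = t])).
  elim/big_ind2 : _ => [|x1 x2 y1 y2 h1 h2|t _]; first by rewrite normc0.
    by rewrite (le_trans (le_normcD _ _))// lerD.
  rewrite normcM normc_realC ger0_norm//.
  have [[K Kt]|nex] := pselect (exists K, q K = t).
    rewrite ler_wpM2r//.
    apply: le_trans (sum_subgroup_le_opnorm s countG (set_mem (valP K))).
    rewrite [X in _ <= normc X]big_mkcond [X in _ <= normc X](big_nth p0).
    rewrite [X in _ <= normc X]big_mkord le_eqVlt; apply/orP; left; apply/eqP.
    congr normc; apply: eq_bigr => i _; rewrite -Kt ffunE /ci /gi /=.
    by case: (val K _); rewrite ?mulr1 ?mulr0.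
  suff -> : [set K | q K = t] = set0 by rewrite /m measure0 !mulr0.
  by apply/seteqP; split => // K Kt; apply: nex; exists K.
rewrite -mulr_sumr -(fa_partition mD mP predT)/=.
rewrite (_ : [set x | true] = setT); last by apply/seteqP; split.
by rewrite /m probability_setT mulr1.
Qed.

Definition measure_state : {scalar Cstar} := extend cyl_mass_contractive.

Lemma cyl_mass1 : cyl_mass 1%g = 1.
Proof.
rewrite /cyl_mass (_ : cyl 1%g = setT) ?probability_setT//.
apply/seteqP; split => // K _ /=; rewrite /cyl/=.
by have [[]] := set_mem (valP K).
Qed.

Lemma measure_state_state : state measure_state.
Proof. by apply: extend_state; rewrite cyl_mass1. Qed.

Variables (mu : G -> R) (pmu : prob mu) (stat : stationary_measure mu nu).

(** The preimage of [cyl k] under [Suba_act g] is [cyl (k ^ g)] by conversion. *)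
Lemma cyl_mass_stationary k :
  (\esum_(g in [set: G]) (mu g * cyl_mass (k ^ g)%g)%:E = (cyl_mass k)%:E)%E.
Proof.
rewrite -fnu; last exact: measurable_cyl.
rewrite -(stat (measurable_cyl k)); apply: eq_esum => g _.
by rewrite EFinM /cyl_mass -fnu//; exact: measurable_cyl.
Qed.

Lemma measure_state_stationary : stationary_state mu measure_state.
Proof.
have [mu0 mu1] := pmu.
apply: stationary_of_lambda => // [a|k]; first exact: extend_contractive.
rewrite extend_lambda.
have c0 g : 0 <= mu g * cyl_mass (k ^ g)%g by rewrite mulr_ge0// fine_ge0.
have /(@cvg_realC R _ totally _) := cvg_partial_sum c0 (cyl_mass_stationary k).
rewrite (_ : (fun A => _) = partial_sum (fun g => (mu g)%:C *
  measure_state (@Cstar_lambda R G (k ^ g)%g)))//; apply/funext => A.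
rewrite !partial_sumE rmorph_sum; apply: eq_bigr => g _.
by rewrite extend_lambda rmorphM.
Qed.

End state_of_measure.

Section unique_stationary.
Context {R : realType} {G : groupType} (countG : countable [set: G]).
Local Notation Suba := (Suba R G).

Lemma dirac_stationary (mu : G -> R) : prob mu -> stationary_measure mu (dirac_trivial R G).
Proof.
move=> [mu0 mu1] A mA.
have dE g : pushforward (dirac_trivial R G) (Suba_act g) A = dirac_trivial R G A.
  rewrite /pushforward/= /dirac/= !indicE.
  by congr (nat_of_bool _)%:R%:E; apply/idP/idP; rewrite !inE/= Suba_act_trivial.
under eq_esum => g _ do rewrite dE.
have [d dA d0] : exists2 d : R, dirac_trivial R G A = d%:E & 0 <= d.
  by exists (\1_A (trivial_subgroup R G)) => //; rewrite indicE.
rewrite dA (eq_esum (b := fun g => (d * mu g)%:E)).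
  by rewrite esumZl// mu1 mule1.
by move=> g _; rewrite EFinM muleC.
Qed.

Lemma trivial_measure (nu : probability Suba R) :
  (forall g, g != 1%g -> nu (cyl g) = 0%E) ->
  forall A : set Suba, measurable A -> nu A = dirac_trivial R G A.
Proof.
move=> nu0 A mA; have /countable_injP[e /in2TT einj] := countG.
(* The null sets [cyl g], reindexed by [nat] along [e]; their union contains every non-trivial
   subgroup. *)
pose N (n : nat) : set Suba := [set K | exists g, [/\ e g = n, g != 1%g & cyl g K]].
have N0 n : measurable (N n) /\ nu (N n) = 0%E.
  have [[g [gn g1]]|nex] := pselect (exists g, e g = n /\ g != 1%g).
    have -> : N n = cyl g.
      apply/seteqP; split => K; last by move=> gK; exists g.
      by move=> [h [hn h1 hK]]; rewrite (_ : g = h)//; apply: einj; rewrite gn hn.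
    by split; [exact: measurable_cyl|exact: nu0].
  have -> : N n = set0.
    by apply/seteqP; split => // K [g [gn g1 _]]; apply: nex; exists g.
  by rewrite measure0; split => //; exact: measurable0.
have mN : measurable (\bigcup_n N n) by apply: bigcup_measurable => n _; have [] := N0 n.
have nuN : nu (\bigcup_n N n) = 0%E.
  apply/eqP; rewrite eq_le measure_ge0 andbT.
  apply: (le_trans (@measure_sigma_subadditive _ _ _ nu _ N (fun n => (N0 n).1) mN _)) => //.
  by rewrite eseries0// => n _ _; have [] := N0 n.
have triv K : ~ (\bigcup_n N n) K -> K = trivial_subgroup R G.
  move=> NK; apply: val_inj; apply/funext => x /=.
  have [->|x1] := eqVneq x 1%g; first by have [[]] := set_mem (valP K).
  apply/negbTE/negP => Kx; apply: NK; exists (e x) => //; exists x; split => //.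
rewrite /dirac_trivial /= /dirac/= indicE.
have [At|At] := boolP (trivial_subgroup R G \in A).
  have nuAC : nu (~` A) = 0%E.
    apply/eqP; rewrite eq_le measure_ge0 andbT -nuN le_measure ?inE//.
      exact: measurableC.
    by move=> K AK; apply: contrapT => /triv KE; apply: AK; rewrite KE; exact: set_mem.
  have := probability_setC nu mA; rewrite nuAC.
  have : nu A \is a fin_num by rewrite fin_num_measure.
  by case: (nu A) => [r| |]//= _ [] /eqP; rewrite eq_sym subr_eq0 => /eqP <-.
rewrite (_ : false%:R%:E = 0%E :> \bar R)//.
apply/eqP; rewrite eq_le measure_ge0 andbT -nuN le_measure ?inE//.
by move=> K AK; apply: contrapT => /triv KE; move: At; rewrite -KE mem_set.
Qed.

Lemma Cstar_simple_measure_unique (mu : G -> R) : prob mu ->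
  Cstar_simple_measure mu -> unique_stationary_dirac mu.
Proof.
move=> pmu [_ _ uniq]; split; first exact: dirac_stationary.
move=> nu stat; apply: trivial_measure => g g1.
have := uniq _ (measure_state_state countG nu) (measure_state_stationary pmu stat)
  (Cstar_lambda R g).
rewrite extend_lambda canonical_trace_lambda (negbTE g1) => -[m0].
rewrite -[LHS]fineK; last by rewrite fin_num_measure//; exact: measurable_cyl.
by rewrite -/(cyl_mass nu g) m0.
Qed.

End unique_stationary.

(** * Ideals and singular states *)

Section real_states.
Context {R : realType} {G : groupType}.
Local Notation ell2 := (ell2 R G).
Local Notation bop := (bop R G).
Implicit Types (S T : bop) (f h : ell2).

(* Real parts of states on [B(l^2(G))]; positivity is tested on the operators with
   nonnegative real part. *)
Definition rstate (rho : bop -> R) :=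
  [/\ rho 1 = 1, forall S T, rho (S + T) = rho S + rho T,
      forall (c : R) T, rho (c%:C *: T) = c * rho T &
      forall T, (forall f, 0 <= complex.Re (inner (T f) f)) -> 0 <= rho T].

Lemma Re_inner_opnorm T f : `|complex.Re (inner (T f) f)| <= opnorm T * ell2_norm f ^+ 2.
Proof.
apply: le_trans (Re_inner_CS _ _) _.
by rewrite expr2 mulrA ler_wpM2r ?ell2_norm_ge0 ?opnormP.
Qed.

Section rstate_theory.
Variables (rho : bop -> R) (srho : rstate rho).

Lemma rstateB S T : rho (S - T) = rho S - rho T.
Proof.
have [_ rD rZ _] := srho; rewrite rD; congr (_ + _).
have -> : - T = (-1 : R)%:C *: T by rewrite rmorphN1 scaleN1r.
by rewrite rZ mulN1r.
Qed.

Lemma rstate0 : rho 0 = 0.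
Proof. by rewrite -(subrr (1 : bop)) rstateB subrr. Qed.

Lemma rstate_sum (I : Type) (r : seq I) (F : I -> bop) :
  rho (\sum_(i <- r) F i) = \sum_(i <- r) rho (F i).
Proof.
have [_ rD _ _] := srho.
by elim: r => [|i r IH]; rewrite ?big_nil ?rstate0// !big_cons rD IH.
Qed.

Lemma rstate_le S T :
  (forall f, complex.Re (inner (S f) f) <= complex.Re (inner (T f) f)) -> rho S <= rho T.
Proof.
have [_ _ _ r0] := srho; move=> ST; rewrite -subr_ge0 -rstateB; apply: r0 => f.
by rewrite bopDE bopNE innerBl raddfB/= subr_ge0.
Qed.

Lemma rstate_opnorm T : `|rho T| <= opnorm T.
Proof.
have [r1 _ rZ _] := srho.
have E (c : R) : rho (c%:C *: 1) = c by rewrite rZ r1 mulr1.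
have I (c : R) f : complex.Re (inner ((c%:C *: 1 : bop) f) f) = c * ell2_norm f ^+ 2.
  by rewrite bopZE innerZl Re_realM Re_innerii.
rewrite ler_norml -[X in X <= _]E -[X in _ && (_ <= X)]E.
apply/andP; split; apply: rstate_le => f; rewrite I;
  have := Re_inner_opnorm T f; rewrite ler_norml => /andP[h1 h2] //.
by rewrite mulNr.
Qed.

End rstate_theory.

Lemma ulim_vector_rstate (X : Type) (U : set_system X) (F : X -> ell2) :
  UltraFilter U -> (forall x, ell2_norm (F x) = 1) ->
  rstate (fun T => ulim U (fun x => complex.Re (inner (T (F x)) (F x)))).
Proof.
move=> UU F1.
have bd T : bfun (fun x => complex.Re (inner (T (F x)) (F x))).
  exists (opnorm T) => x; have := Re_inner_opnorm T (F x).
  by rewrite F1 expr1n mulr1.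
have [n1 nD nZ n0] := @ulim_mean R _ _ UU.
split=> [|S T|c T|T T0].
- rewrite -[RHS]n1; congr ulim; apply/funext => x.
  by rewrite -[(1 : bop) (F x)]/(F x) Re_innerii F1 expr1n.
- rewrite -nD//; congr ulim; apply/funext => x.
  by rewrite bopDE innerDl raddfD.
- rewrite -nZ//; congr ulim; apply/funext => x.
  by rewrite bopZE innerZl Re_realM.
- exact: n0.
Qed.

End real_states.

(** * Proper ideals and unit vectors on which their elements are small *)

Section ideals.
Context {R : realType} {G : groupType}.
Local Notation ell2 := (ell2 R G).
Local Notation bop := (bop R G).
Local Notation Cstar := (Cstar R G).
Local Notation delta := (delta R).

(** Finite truncations of [f] are combinations of the [delta g], and the squared error is a tail of
    the sum defining the norm. *)
Lemma bop_delta_eq0 (T : bop) : (forall g, T (delta g) = 0) -> T = 0.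
Proof.
move=> T0; apply/bopP => f; apply: ell2_norm_eq0; apply/le_anti.
rewrite ell2_norm_ge0 andbT; apply/ler_addgt0Pr => e e0; rewrite add0r.
pose d := e / (opnorm T + 1).
have d0 : 0 < d by rewrite divr_gt0// ltr_wpDl ?opnorm_ge0.
have d20 : 0 < d ^+ 2 by rewrite exprn_gt0.
have fsum := @cvg_partial_sum R G (fun g => normc (f g) ^+ 2) (ell2_norm f ^+ 2)
  (fun=> sqr_ge0 _) (sqnorm_ell2 f).
have /(@cvgrPdist_le _ _ _ totally _)/(_ _ d20)/filter_ex[A] := fsum.
rewrite partial_sumE => Ad.
pose ind (x : G) : R := (x \in A)%:R.
have b1 x : `|ind x| <= 1 by rewrite /ind; case: (x \in A); rewrite ?normr0 ?normr1.
have bind : bfun ind by exists 1.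
set fA := mult ind f.
have fAE : fA = \sum_(g <- A) f g *: delta g.
  apply/ell2P => x; rewrite multE// ell2_sumE.
  have [xA|xA] := boolP (x \in A).
    rewrite (bigD1_seq x)//=; last exact: fset_uniq.
    rewrite ell2ZE -[delta x x]/((x == x)%:R) eqxx /ind xA mul1r mulr1 big1 ?addr0//.
    by move=> g gx; rewrite ell2ZE -[delta g x]/((x == g)%:R) eq_sym (negbTE gx) mulr0.
  rewrite /ind (negbTE xA) mul0r big_seq big1// => g gA.
  rewrite ell2ZE -[delta g x]/((x == g)%:R); case: eqVneq => [xg|]; rewrite ?mulr0//.
  by rewrite xg gA in xA.
have TfA : T fA = 0.
  by rewrite fAE linear_sum big1// => g _; rewrite linearZ/= T0 scaler0.
have pyth : ell2_norm (f - fA) ^+ 2 = ell2_norm f ^+ 2 - ell2_norm fA ^+ 2.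
  rewrite ell2_normB_sqr.
  have -> : inner f fA = inner fA fA.
    rewrite /fA inner_mult//; congr inner; apply/ell2P => x; rewrite !multE//.
    by rewrite mulrA -rmorphM -natrM mulnb andbb.
  by rewrite Re_innerii; ring.
have fAle : \sum_(g <- A) normc (f g) ^+ 2 <= ell2_norm fA ^+ 2.
  rewrite -partial_sumE -lee_fin -sqnorm_ell2.
  have -> : partial_sum (fun g => normc (f g) ^+ 2) A =
      partial_sum (fun g => normc (fA g) ^+ 2) A.
    rewrite !partial_sumE big_seq [RHS]big_seq; apply: eq_bigr => g gA.
    by rewrite multE// /ind gA mul1r.
  by apply: partial_sum_le_esum => g; exact: sqr_ge0.
have near : ell2_norm (f - fA) <= d.
  rewrite -ler_sqr ?nnegrE ?ell2_norm_ge0 ?(ltW d0)// pyth.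
  by have := le_trans (ler_norm _) Ad; lra.
have -> : T f = T (f - fA) by rewrite linearB/= TfA subr0.
apply: le_trans (opnormP _ _) _.
apply: (@le_trans _ _ (opnorm T * d)); first by rewrite ler_wpM2l ?opnorm_ge0.
rewrite /d mulrA ler_pdivrMr ?ltr_wpDl ?opnorm_ge0//.
by rewrite mulrC ler_pM2l// lerDl.
Qed.

Variables (J : set Cstar) (idJ : closed_ideal J).

Let J0 : J 0.
Proof. by have [[/set_mem]] := idJ. Qed.

Let JD a b : J a -> J b -> J (a + b).
Proof.
have [[_ lin] _ _] := idJ; move=> /mem_set Ja /mem_set Jb.
by have /set_mem := lin 1 a b Ja Jb; rewrite scale1r.
Qed.

Let JM a b : J b -> J (a * b).
Proof. by have [_ mul _] := idJ => /(mul a)[]. Qed.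

Let JMr a b : J b -> J (b * a).
Proof. by have [_ mul _] := idJ => /(mul a)[]. Qed.

Let JZ c a : J a -> J (c *: a).
Proof. by move=> /(JM c%:A); rewrite -scalerAl mul1r. Qed.

(** For small [t] the element [u = 1 - t j] has norm below 1; all [1 - u ^+ n] lie in [J] and tend
    to 1, and [J] is closed. *)
Lemma ideal_bounded_below (j : Cstar) (d : R) : J j -> 0 < d ->
  (forall f, d * ell2_norm f ^+ 2 <= complex.Re (inner ((val j : bop) f) f)) -> J 1.
Proof.
(* With [t B^2 <= d], the gain [2 t d] in the squared norm of [u f] outweighs the loss [t^2 B^2],
   leaving the factor [1 - t d]. *)
move=> Jj d0 jd; pose B := opnorm (val j); pose t := d / (B ^+ 2 + 1).
have B10 : 0 < B ^+ 2 + 1 by rewrite ltr_wpDl ?sqr_ge0.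
have t0 : 0 < t by rewrite divr_gt0.
pose u : Cstar := 1 - t%:C *: j; pose r := Num.sqrt (1 - t * d).
have r1 : r < 1.
  by rewrite -[ltRHS]sqrtr1 ltr_sqrt// ltrBlDr ltrDl mulr_gt0.
have ur : opnorm (val u) <= r.
  apply: opnorm_leP => [|f]; first exact: sqrtr_ge0.
  rewrite -ler_sqr ?nnegrE ?mulr_ge0 ?ell2_norm_ge0 ?sqrtr_ge0// exprMn.
  have h1 : ell2_norm ((val u : bop) f) ^+ 2 <= (1 - t * d) * ell2_norm f ^+ 2.
    have -> : (val u : bop) f = f - t%:C *: (val j : bop) f by [].
    rewrite ell2_normB_sqr ell2_normZ normc_realC ger0_norm ?(ltW t0)//.
    rewrite innerZr inner_conj conjC_real Re_realM.
    have -> : complex.Re (inner ((val j : bop) f) f)^* = complex.Re (inner ((val j : bop) f) f).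
      by case: (inner _ _).
    have h2 : t * (d * ell2_norm f ^+ 2) <= t * complex.Re (inner ((val j : bop) f) f).
      by rewrite ler_wpM2l ?(ltW t0).
    have h3 : (t * ell2_norm ((val j : bop) f)) ^+ 2 <= t * d * ell2_norm f ^+ 2.
      apply: (@le_trans _ _ ((t * (B * ell2_norm f)) ^+ 2)).
        apply: lerXn2r; rewrite ?nnegrE.
        - exact: mulr_ge0 (ltW t0) (ell2_norm_ge0 _).
        - exact: mulr_ge0 (ltW t0) (mulr_ge0 (opnorm_ge0 _) (ell2_norm_ge0 _)).
        - by rewrite ler_wpM2l ?(ltW t0)// opnormP.
      have -> : (t * (B * ell2_norm f)) ^+ 2 = t * (t * B ^+ 2) * ell2_norm f ^+ 2 by ring.
      rewrite ler_wpM2r ?sqr_ge0// ler_wpM2l ?(ltW t0)//.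
      rewrite /t -mulrAC ler_pdivrMr// ler_wpM2l ?(ltW d0)//.
      by rewrite lerDl.
    by lra.
  apply: le_trans h1 _; rewrite ler_wpM2r ?sqr_ge0//.
  by have [x0|x0] := leP 0 (1 - t * d); [rewrite /r sqr_sqrtr|exact: le_trans (ltW x0) (sqr_ge0 _)].
have Ju n : J (1 - u ^+ n).
  elim: n => [|n IH]; first by rewrite expr0 subrr.
  have -> : 1 - u ^+ n.+1 = (1 - u ^+ n) + u ^+ n * (t%:C *: j).
    have -> : t%:C *: j = 1 - u by rewrite /u subKr.
    rewrite exprSr (mulrBr (u ^+ n) 1 u) mulr1.
    exact: (esym (subrKA _ _ _)).
  by apply: JD => //; apply: JM; apply: JZ.
have un n : opnorm (val (u ^+ n)) <= r ^+ n.
  elim: n => [|n IH].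
    rewrite !expr0; apply: opnorm_leP => // f.
    by rewrite mul1r.
  rewrite !exprS -[val _]/(val u * val (u ^+ n)); apply: le_trans (opnormM _ _) _.
  by apply: ler_pM => //; exact: opnorm_ge0.
have [_ _ clJ] := idJ; apply: clJ => W; rewrite nbhsE => -[V [oV V1] VW].
have [V' oV' V'V] : exists2 V' : set bop, open V' & val @^-1` V' = V.
  by move: oV; rewrite /open/= => -[V' oV' V'E]; exists V'.
have : nbhs (1 : bop) V'.
  by apply: open_nbhs_nbhs; split => //; move: V1; rewrite -V'V.
rewrite -nbhs_ballE => -[e /= e0 eV'].
have Re0 : 0 < complex.Re e.
  by move: e e0 {eV'} => [x y]; rewrite ltcE => /andP[].
have eE : e = (complex.Re e)%:C.
  by move: e e0 {eV' Re0} => [x y]; rewrite ltcE /= => /andP[/eqP->].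
have : (fun n => r ^+ n) @ \oo --> (0 : R).
  by apply: cvg_expr; rewrite ger0_norm ?sqrtr_ge0.
move=> /cvgrPdist_lt/(_ _ Re0)/filter_ex[n].
rewrite sub0r normrN ger0_norm ?exprn_ge0 ?sqrtr_ge0// => rn.
exists (1 - u ^+ n); split => //; apply: VW; rewrite -V'V; apply: eV'.
rewrite -ball_normE /ball_/= eE bop_norm_def ltcR; apply: le_lt_trans rn.
have -> : (1 : bop) - val (1 - u ^+ n) = val (u ^+ n).
  exact: (subKr (1 : bop) (val (u ^+ n))).
exact: un.
Qed.

(** Right multiplication by [lambda g] moves [delta 1] to [delta g]. The squared norm of
    [b (delta 1)] is the trace of [b^* b], which thus becomes positive. *)
Lemma ideal_nonzero_delta (a : Cstar) : J a -> a != 0 ->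
  exists2 b : Cstar, J b & 0 < ell2_norm ((val b : bop) (delta 1%g)).
Proof.
move=> Ja a0.
have [g ag] : exists g, (val a : bop) (delta g) <> 0.
  apply: contrapT => nex; move/eqP: a0; apply; apply: val_inj.
  by apply: bop_delta_eq0 => g; apply: contrapT => ag; apply: nex; exists g.
exists (a * Cstar_lambda R g); first exact: JMr.
rewrite lt_neqAle ell2_norm_ge0 andbT eq_sym; apply/eqP => /ell2_norm_eq0 E.
apply: ag; rewrite -[RHS]E -[RHS]/((val a : bop) (lambda R g (delta 1%g))).
suff -> : delta g = lambda R g (delta 1%g) by [].
apply/ell2P => x.
rewrite -[RHS]/((g^-1 * x == 1)%g%:R) -[LHS]/((x == g)%:R).
congr (nat_of_bool _)%:R; apply/eqP/eqP => [->|gx]; first by rewrite mulVg.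
by rewrite -[x](mulVKg g) gx mulg1.
Qed.

Hypothesis J1 : ~ J 1.

Definition Clcomb (s : seq (R[i] * G)) : Cstar :=
  \sum_(p <- s) p.1 *: @Cstar_lambda R G p.2.

Lemma Clcomb_val s : val (Clcomb s) = lcomb s.
Proof. by rewrite /Clcomb /lcomb raddf_sum; apply: eq_bigr. Qed.

(** Otherwise the sum of the conjugates of [a^* a] by the elements of [S] would be bounded below,
    and the ideal would contain 1. *)
Lemma ideal_small_vectors (a : Cstar) (S : seq G) (e : R) : J a -> 0 < e ->
  exists f : ell2, ell2_norm f = 1 /\
    forall h, h \in S -> ell2_norm ((val a : bop) (lambda R h^-1 f)) <= e.
Proof.
move=> Ja e0; apply: contrapT => nex.
have far1 f : ell2_norm f = 1 ->
    e ^+ 2 <= \sum_(h <- S) ell2_norm ((val a : bop) (lambda R h^-1 f)) ^+ 2.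
  move=> f1; apply: contrapT => /negP; rewrite -ltNge => lt1.
  apply: nex; exists f; split => // h hS.
  rewrite -ler_sqr ?nnegrE ?ell2_norm_ge0 ?(ltW e0)//; apply: le_trans (ltW lt1).
  by rewrite (big_rem h)//= lerDl; apply: sumr_ge0 => ? _; exact: sqr_ge0.
have far f : e ^+ 2 * ell2_norm f ^+ 2 <=
    \sum_(h <- S) ell2_norm ((val a : bop) (lambda R h^-1 f)) ^+ 2.
  have [f0|f0] := eqVneq (ell2_norm f) 0.
    by rewrite f0 expr0n mulr0; apply: sumr_ge0 => ? _; exact: sqr_ge0.
  have f0' : 0 < ell2_norm f by rewrite lt_neqAle eq_sym f0 ell2_norm_ge0.
  have := far1 ((ell2_norm f)^-1%:C *: f).
  rewrite ell2_normZ normc_realC ger0_norm ?invr_ge0 ?(ltW f0')// mulVf// => /(_ erefl).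
  rewrite (eq_bigr (fun h => (ell2_norm f)^-1 ^+ 2 *
      ell2_norm ((val a : bop) (lambda R h^-1 f)) ^+ 2)); last first.
    move=> h _; rewrite !linearZ/= ell2_normZ normc_realC ger0_norm ?invr_ge0 ?(ltW f0')//.
    by rewrite exprMn.
  by rewrite -mulr_sumr exprVn ler_pdivlMl ?exprn_gt0// mulrC.
pose n : R := (size S)%:R.
(* Replacing [a^*] by the adjoint of an approximant, which visibly lies in the algebra, costs
   [n * opnorm (val a) * eta], at most half of [e ^+ 2]. *)
pose eta := e ^+ 2 / 2 / (n * opnorm (val a) + 1).
have na0 : 0 < n * opnorm (val a) + 1 by rewrite ltr_wpDl ?mulr_ge0 ?opnorm_ge0.
have e20 : 0 < e ^+ 2 / 2 by rewrite divr_gt0 ?exprn_gt0.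
have eta0 : 0 < eta by rewrite divr_gt0.
have [s sa] := cstar_lambda_dense (set_mem (valP a)) eta0.
pose j : Cstar := \sum_(h <- S) Cstar_lambda R h * (Clcomb (adj_comb s) * a) *
  @Cstar_lambda R G h^-1%g.
have Jj : J j.
  rewrite /j; elim: (S) => [|h l IH]; rewrite ?big_nil ?big_cons//.
  by apply: JD => //; apply: JMr; apply: JM; exact: JM.
apply: J1; apply: (ideal_bounded_below Jj e20) => f.
have jE : complex.Re (inner ((val j : bop) f) f) = \sum_(h <- S)
    complex.Re (inner ((val a : bop) (lambda R h^-1 f)) (lcomb s (lambda R h^-1 f))).
  have -> : val j = \sum_(h <- S) lambda R h * (lcomb (adj_comb s) * val a) * lambda R h^-1.
    rewrite /j raddf_sum; apply: eq_bigr => h _.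
    by rewrite -Clcomb_val.
  rewrite bop_sumE.
  have -> : inner (\sum_(h <- S) (lambda R h * (lcomb (adj_comb s) * val a) *
     lambda R h^-1 : bop) f) f =
     \sum_(h <- S) inner ((lambda R h * (lcomb (adj_comb s) * val a) * lambda R h^-1 : bop) f) f.
    by elim: (S) => [|h l IH]; rewrite ?big_nil ?inner0l// !big_cons innerDl IH.
  rewrite raddf_sum; apply: eq_bigr => h _; congr complex.Re.
  rewrite !bopME inner_lambda.
  by rewrite (is_adjoint_sym (lcomb_adj s)).
rewrite jE; apply: (@le_trans _ _ (\sum_(h <- S)
  (ell2_norm ((val a : bop) (lambda R h^-1 f)) ^+ 2 -
   opnorm (val a) * eta * ell2_norm f ^+ 2))).
  rewrite sumrB big_const_seq iter_addr_0 count_predT.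
  have h1 : n * opnorm (val a) * eta <= e ^+ 2 / 2.
    have : (n * opnorm (val a) + 1) * eta = e ^+ 2 / 2.
      by rewrite /eta mulrC divfK// gt_eqF.
    by lra.
  have h2 : n * opnorm (val a) * eta * ell2_norm f ^+ 2 <= e ^+ 2 / 2 * ell2_norm f ^+ 2.
    by rewrite ler_wpM2r ?sqr_ge0.
  have h3 := far f.
  rewrite -mulr_natl -/n; lra.
apply: ler_sum => h _; set v := lambda R h^-1 f.
have -> : lcomb s v = (val a : bop) v - (val a - lcomb s : bop) v.
  by rewrite bopDE bopNE subKr.
rewrite innerBr raddfB/= Re_innerii lerD2l lerN2.
apply: le_trans (ler_norm _) _; apply: le_trans (Re_inner_CS _ _) _.
have nv : ell2_norm v = ell2_norm f by rewrite ell2_norm_lambda.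
have -> : opnorm (val a) * eta * ell2_norm f ^+ 2 =
  (opnorm (val a) * ell2_norm v) * (eta * ell2_norm v) by rewrite nv; ring.
rewrite ler_pM ?ell2_norm_ge0 ?opnormP//.
by apply: le_trans (opnormP _ _) _; rewrite ler_wpM2r ?ell2_norm_ge0// ltW.
Qed.

End ideals.

Section noncommutative_witness.
Context {R : realType} {G : groupType}.
Local Notation ell2 := (ell2 R G).
Local Notation bop := (bop R G).
Local Notation Cstar := (Cstar R G).
Local Notation delta := (delta R).

Lemma lcomb_delta (s : seq (R[i] * G)) :
  (lcomb s : bop) (delta 1%g) 1%g = \sum_(p <- s | p.2 == 1%g) p.1.
Proof.
rewrite bop_sumE ell2_sumE [RHS]big_mkcond/=; apply: eq_bigr => p _.
rewrite bopZE ell2ZE -[lambda R p.2 (delta 1%g) 1%g]/((p.2^-1 * 1 == 1)%g%:R).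
by rewrite mulg1 invg_eq1; case: eqP; rewrite ?mulr1 ?mulr0.
Qed.

Lemma lcomb_adj_mul_delta (s : seq (R[i] * G)) :
  \sum_(p <- mul_comb (adj_comb s) s | p.2 == 1%g) p.1 =
  (ell2_norm ((lcomb s : bop) (delta 1%g)) ^+ 2)%:C.
Proof.
rewrite -lcomb_delta lcomb_mul -inner_delta bopME.
by rewrite (is_adjoint_sym (lcomb_adj s)) inner_norm.
Qed.

(* A functional killing a non-trivial ideal is far from the canonical trace,
   uniformly over the whole orbit under conjugation. *)
Definition far_from_trace (b : seq (R[i] * G)) (theta : R) (rho : bop -> R) :=
  forall h, `|rho (lambda R h * lcomb b * lambda R h^-1)| <= theta.

Lemma half_le (x y z : R) : x <= y + z -> z <= x / 2 -> x / 2 <= y.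
Proof. by lra. Qed.

Lemma eighth_le (x y z : R) : z <= x / 16 + y -> y <= x / 16 -> z <= x / 8.
Proof. by lra. Qed.

(** Here [b] is [s^* s] for an approximant [s] of an element [c] of the ideal, and [beta] is its
    trace. The state is a limit of vector states at vectors whose translates [c] makes small, hence
    small on all conjugates of [b]. *)
Lemma not_simple_witness : ~ Cstar_simple R G ->
  exists b : seq (R[i] * G), exists beta theta : R, exists rho : bop -> R,
    [/\ rstate rho, theta < beta, \sum_(p <- b | p.2 == 1%g) p.1 = beta%:C &
       far_from_trace b theta rho].
Proof.
move=> nsimple.
have [J [idJ Jn0 JnT]] : exists J : set Cstar,
    [/\ closed_ideal J, J <> [set 0] & J <> setT].
  apply: contrapT => nex; apply: nsimple => J idJ; apply: contrapT => /not_orP[J0 JT].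
  by apply: nex; exists J.
have [[J0 lin] mul _] := idJ.
have J1 : ~ J 1.
  move=> J1; apply: JnT; apply/seteqP; split => // a _.
  by rewrite -[a]mulr1; exact: (mul a 1 J1).1.
have [a [Ja a0]] : exists a, J a /\ a != 0.
  apply: contrapT => nex; apply: Jn0; apply/seteqP; split => [x Jx|_ ->]; last exact: set_mem.
  by apply: contrapT => /eqP x0; apply: nex; exists x.
have [c Jc c0] := ideal_nonzero_delta idJ Ja a0.
pose v := ell2_norm ((val c : bop) (delta 1%g)).
pose B := opnorm (val c); have B0 : 0 <= B by exact: opnorm_ge0.
have v160 : 0 < v ^+ 2 / 16 by rewrite divr_gt0 ?exprn_gt0.
(* The three bounds give, in turn, [beta >= v^2 / 4], a norm of [lcomb s] at most [B + 1], and an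
   error at most [v^2 / 16]; a second such error from [e] makes [theta = v^2 / 8]. *)
pose eta := Num.min (v / 2) (Num.min 1 (v ^+ 2 / 16 / (B + 1))).
have eta0 : 0 < eta by rewrite !lt_min ltr01 !divr_gt0 ?exprn_gt0// ltr_wpDl.
have eta_v : eta <= v / 2 by rewrite ge_min lexx.
have eta_1 : eta <= 1 by rewrite !ge_min lexx orbT.
have eta_B : (B + 1) * eta <= v ^+ 2 / 16.
  by rewrite mulrC -ler_pdivlMr ?ltr_wpDl// !ge_min lexx !orbT.
have [s sc] := cstar_lambda_dense (set_mem (valP c)) eta0.
have ns : opnorm (lcomb s : bop) <= B + 1.
  have -> : lcomb s = val c - (val c - lcomb s) :> bop by rewrite subKr.
  apply: le_trans (opnormD _ _) _; rewrite opnormN lerD2l.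
  exact: le_trans (ltW sc) eta_1.
pose beta := ell2_norm ((lcomb s : bop) (delta 1%g)) ^+ 2.
have nd : ell2_norm (delta (1%g : G)) = 1.
  by rewrite /ell2_norm sqnorm_delta sqrtr1.
have beta_v : v ^+ 2 / 4 <= beta.
  have : v <= ell2_norm ((lcomb s : bop) (delta 1%g)) + eta.
    have E : (val c : bop) (delta 1%g) =
        (lcomb s : bop) (delta 1%g) + (val c - lcomb s : bop) (delta 1%g).
      by rewrite bopDE bopNE addrC subrK.
    rewrite /v E; apply: le_trans (ell2_normD _ _) _; rewrite lerD2l.
    apply: le_trans (opnormP _ _) _; rewrite nd mulr1; exact: ltW.
  move=> h1; have h2 := half_le h1 eta_v.
  have -> : v ^+ 2 / 4 = (v / 2) ^+ 2 by field.
  by rewrite /beta lerXn2r ?nnegrE ?ell2_norm_ge0// divr_ge0// ltW.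
pose e := v ^+ 2 / 16 / (B + 1); have e0 : 0 < e by rewrite divr_gt0// ltr_wpDl.
have eB : (B + 1) * e = v ^+ 2 / 16 by rewrite /e mulrC divfK// gt_eqF// ltr_wpDl.
have /choice[F FP] (S : {fset G}) := ideal_small_vectors idJ J1 S Jc e0.
have [U [UU tU]] := ultra_totally G; have FF := @ultra_proper _ _ UU.
pose rho (T : bop) := ulim U (fun S => complex.Re (inner (T (F S)) (F S))).
exists (mul_comb (adj_comb s) s), beta, (v ^+ 2 / 8), rho; split.
- by apply: ulim_vector_rstate => // S; have [] := FP S.
- apply: lt_le_trans beta_v; rewrite ltr_pM2l ?exprn_gt0//.
  by rewrite ltf_pV2 ?posrE ?ltr_nat.
- exact: lcomb_adj_mul_delta.
move=> h; pose T : bop := lambda R h * lcomb (mul_comb (adj_comb s) s) * lambda R h^-1.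
rewrite -/T /rho.
have bT : bfun (fun S => complex.Re (inner (T (F S)) (F S))).
  exists (opnorm T) => S; have := Re_inner_opnorm T (F S).
  by have [-> _] := FP S; rewrite expr1n mulr1.
have key : U [set S | `|complex.Re (inner (T (F S)) (F S))| <= v ^+ 2 / 8].
  apply: filterS (tU h) => S /= hS; have [nF Fh] := FP S.
  set w := lambda R h^-1 (F S).
  have nw : ell2_norm w = 1 by rewrite ell2_norm_lambda nF.
  have -> : inner (T (F S)) (F S) = inner ((lcomb s : bop) w) ((lcomb s : bop) w).
    rewrite /T !bopME inner_lambda lcomb_mul bopME.
    by rewrite (is_adjoint_sym (lcomb_adj s)).
  rewrite Re_innerii ger0_norm ?sqr_ge0//.
  have h1 : ell2_norm ((lcomb s : bop) w) <= e + eta.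
    have -> : (lcomb s : bop) w = (val c : bop) w - (val c - lcomb s : bop) w.
      by rewrite bopDE bopNE subKr.
    apply: le_trans (ell2_normD _ _) _; rewrite -scaleN1r ell2_normZ normcN normc1 mul1r.
    apply: lerD; first exact: Fh.
    by apply: le_trans (opnormP _ _) _; rewrite nw mulr1 ltW.
  have h2 : ell2_norm ((lcomb s : bop) w) <= B + 1.
    by apply: le_trans (opnormP _ _) _; rewrite nw mulr1.
  have : ell2_norm ((lcomb s : bop) w) ^+ 2 <= (B + 1) * (e + eta).
    by rewrite expr2 ler_pM ?ell2_norm_ge0.
  rewrite mulrDr eB => h3; exact: eighth_le h3 eta_B.
rewrite ler_norml; apply/andP; split.
  by apply: ulim_near_ge => //; apply: filterS key => S /=; rewrite ler_norml => /andP[].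
by apply: ulim_near_le => //; apply: filterS key => S /=; rewrite ler_norml => /andP[].
Qed.

End noncommutative_witness.

(** * Recurrent amenable subgroups *)

Section convolution.
Context {R : realType} {G : groupType}.
Local Notation ell2 := (ell2 R G).
Local Notation bop := (bop R G).
Implicit Types (phi psi : G -> R) (n y : (G -> R) -> R) (rho : bop -> R).

Lemma bfun_lshift phi g : bfun phi -> bfun (fun x => phi (g * x)%g).
Proof. by move=> [M pM]; exists M. Qed.

Definition poisson y phi : G -> R := fun g => y (fun x => phi (g * x)%g).

Definition conv n y : (G -> R) -> R := fun phi => n (poisson y phi).

Lemma poisson_bounded y phi : mean y -> bfun phi -> bfun (poisson y phi).
Proof.
by move=> my [M pM]; exists M => g; apply: (mean_norm my) => //; exists M.
Qed.

Lemma conv_mean n y : mean n -> mean y -> mean (conv n y).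
Proof.
move=> mn my; have [n1 nD nZ n0] := mn; have [y1 yD yZ y0] := my; split.
- by rewrite -[RHS]n1; congr n; apply/funext => g; exact: y1.
- move=> f h bf bh; rewrite -nD; try exact: poisson_bounded.
  by congr n; apply/funext => g; apply: yD; exact: bfun_lshift.
- move=> c f bf; rewrite -nZ; last exact: poisson_bounded.
  by congr n; apply/funext => g; apply: yZ; exact: bfun_lshift.
- move=> f bf f0; apply: n0; first exact: poisson_bounded.
  by move=> g; apply: y0 => //; exact: bfun_lshift.
Qed.

Definition rmean rho : (G -> R) -> R := fun phi => rho (mult phi).

Lemma bfun_sqrt phi : bfun phi -> bfun (fun x => Num.sqrt (phi x)).
Proof.
move=> [M pM]; exists (Num.sqrt M) => x.
rewrite ger0_norm ?sqrtr_ge0// ler_wsqrtr//; exact: le_trans (ler_norm _) (pM x).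
Qed.

Lemma Re_inner_mult_sqr psi f : bfun psi ->
  complex.Re (inner (mult (fun x => psi x * psi x) f) f) = ell2_norm (mult psi f) ^+ 2.
Proof. by move=> bpsi; rewrite multM// bopME inner_mult// Re_innerii. Qed.

Lemma rmean_mean rho : rstate rho -> mean (rmean rho).
Proof.
move=> [r1 rD rZ r0]; split.
- by rewrite /rmean mult_cst rZ r1 mulr1.
- by move=> f h bf bh; rewrite /rmean multD// rD.
- by move=> c f bf; rewrite /rmean multZ// rZ.
- move=> f bf f0; apply: r0 => v.
  (* As a square, [f] has a quadratic form that is a squared norm. *)
  have -> : f = (fun x => Num.sqrt (f x) * Num.sqrt (f x)).
    by apply/funext => x; rewrite -expr2 sqr_sqrtr.
  by rewrite Re_inner_mult_sqr ?sqr_ge0//; exact: bfun_sqrt.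
Qed.

(** Convolution of [n] with [rho] for the conjugation action. [far_from_trace] survives it because
    that bound is uniform over the orbit. *)
Definition rconv n rho : bop -> R := fun T =>
  n (fun g => rho (lambda R g^-1 * T * lambda R g)).

Lemma rconv_bounded rho T : rstate rho ->
  bfun (fun g => rho (lambda R g^-1 * T * lambda R g)).
Proof.
move=> sr; exists (opnorm T) => g; apply: le_trans (rstate_opnorm sr _) _.
apply: le_trans (opnormM _ _) _; rewrite -[leRHS]mulr1.
apply: ler_pM; [exact: opnorm_ge0|exact: opnorm_ge0| |exact: opnorm_lambda_le].
apply: le_trans (opnormM _ _) _.
by apply: ler_piMl; [exact: opnorm_ge0|exact: opnorm_lambda_le].
Qed.

Lemma rconv_rstate n rho : mean n -> rstate rho -> rstate (rconv n rho).
Proof.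
move=> [n1 nD nZ n0] sr; have [r1 rD rZ r0] := sr; split.
- rewrite -[RHS]n1; congr n; apply/funext => g.
  by rewrite mulr1 -lambdaM mulVg lambda1 r1.
- move=> S T; rewrite /rconv -nD; try exact: rconv_bounded.
  by congr n; apply/funext => g; rewrite mulrDr mulrDl rD.
- move=> c T; rewrite /rconv -nZ; last exact: rconv_bounded.
  by congr n; apply/funext => g; rewrite -scalerAr -scalerAl rZ.
- move=> T T0; apply: n0; first exact: rconv_bounded.
  move=> g; apply: r0 => f; rewrite !bopME inner_lambda invgK; exact: T0.
Qed.

Lemma rconv_far n rho b theta : mean n -> rstate rho ->
  far_from_trace b theta rho -> far_from_trace b theta (rconv n rho).
Proof.
move=> mn sr far h; apply: (mean_norm mn); first exact: rconv_bounded.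
move=> g; rewrite !mulrA -lambdaM -!mulrA -lambdaM !mulrA.
by have := far (g^-1 * h)%g; rewrite invgM invgK.
Qed.

(** Associativity of convolution, as conjugating a multiplication operator by [lambda g] translates
    its symbol. *)
Lemma conv_rconv n y rho phi : mean y -> bfun phi ->
  conv (rmean (rconv n rho)) y phi = conv n (conv (rmean rho) y) phi.
Proof.
move=> my bphi; rewrite /conv /rmean /rconv; congr n; apply/funext => g.
rewrite lambda_mult; last exact: poisson_bounded.
rewrite -mulrA -lambdaM mulVg lambda1 mulr1; congr (rho (mult _)).
apply/funext => x; rewrite invgK /poisson; congr y; apply/funext => z.
by rewrite mulgA.
Qed.

Definition ind (A : set G) : G -> R := fun x => (x \in A)%:R.

Lemma ind01 A x : 0 <= ind A x <= 1.
Proof. by rewrite /ind; case: (x \in A); rewrite lexx ler01. Qed.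

Lemma bfun_ind A : bfun (ind A).
Proof. exact/bfun_ge0_le1/ind01. Qed.

Lemma mean_fap n : mean n -> fap (fun A => n (ind A)).
Proof.
move=> mn; have [n1 nD nZ n0] := mn; split.
- by move=> A; apply: n0; [exact: bfun_ind|move=> x; have /andP[] := ind01 A x].
- rewrite -[RHS]n1; congr n; apply/funext => x.
  by rewrite /ind in_setT.
- move=> A B AB; rewrite -nD; try exact: bfun_ind.
  congr n; apply/funext => x; rewrite /ind in_setU -natrD.
  have := in_setI x A B.
  by rewrite AB in_set0; case: (_ \in A) (_ \in B) => -[].
Qed.

(* Perturbing the density by [1 + s (w - n w)] with [s = 1] and [s = -1] shows that a
   near maximum of the convex function [\sum_i m(phi_i)^2] over the means [conv n y]
   is attained at an [n] for which the Poisson transforms of the [phi_i] have small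
   variance. *)
Lemma small_variance (rho0 : bop -> R) b theta (L : seq (set G)) (e : R) :
  rstate rho0 -> far_from_trace b theta rho0 -> 0 < e ->
  exists rho y, [/\ rstate rho, far_from_trace b theta rho, mean y &
    forall A, A \in L ->
      rmean rho (fun x => (poisson y (ind A) x - conv (rmean rho) y (ind A)) *
                          (poisson y (ind A) x - conv (rmean rho) y (ind A))) <= e].
Proof.
move=> sr0 far0 e0.
pose q (m : (G -> R) -> R) : R := \sum_(A <- L) m (ind A) ^+ 2.
have m01 m A : mean m -> 0 <= m (ind A) <= 1.
  move=> mm; have fm := mean_fap mm; have [m0 _ _] := fm.
  by rewrite m0 (fap_le1 A fm).
have qle m : mean m -> q m <= (size L)%:R.
  move=> mm; apply: (@le_trans _ _ (\sum_(A <- L) 1)).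
    by apply: ler_sum => A _; have /andP[m0 m1] := m01 _ A mm; rewrite expr_le1.
  by rewrite big_const_seq iter_addr_0 count_predT.
have q0 m : 0 <= q m by apply: sumr_ge0 => ? _; exact: sqr_ge0.
pose n0 := rmean rho0; have mn0 : mean n0 := rmean_mean sr0.
pose Q y : set R := [set q (conv n y) | n in mean].
have supQ y : mean y -> has_sup (Q y).
  move=> my; split; first by exists (q (conv n0 y)), n0.
  by exists (size L)%:R => _ [n mn <-]; exact/qle/conv_mean.
pose Gs y := sup (Q y).
have leG n y : mean n -> mean y -> q (conv n y) <= Gs y.
  by move=> mn my; apply: (ub_le_sup (supQ y my).2); exists n.
pose D := [set Gs y | y in mean].
have infD : has_inf D.
  split; first by exists (Gs n0), n0.
  by exists 0 => _ [y my <-]; apply: le_trans (leG n0 y mn0 my); exact: q0.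
pose d := e ^+ 2 / 2; have d0 : 0 < d by rewrite divr_gt0 ?exprn_gt0.
(* The near maximiser must be the restriction of a state that is far from the trace. By
   associativity, convolving [n] with [conv n0 y] is convolving [y] with the restriction of
   [rconv n rho0]; near minimality of [Gs y] ensures that passing to [conv n0 y] lowers the supremum
   by less than [d]. *)
have [_ [y my <-] yI] := inf_adherent d0 infD.
have my' : mean (conv n0 y) by exact: conv_mean.
have [_ [n mn <-] nI] := sup_adherent d0 (supQ _ my').
pose rho := rconv n rho0.
have sr : rstate rho by exact: rconv_rstate.
pose m := conv (rmean rho) y.
have mr : mean (rmean rho) := rmean_mean sr.
have qm : Gs y < q m + 2 * d.
  have -> : q m = q (conv n (conv n0 y)).
    apply: eq_bigr => A _; congr (_ ^+ 2).
    by rewrite /m conv_rconv//; exact: bfun_ind.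
  have : inf D <= Gs (conv n0 y) by apply: (ge_inf infD.2); exists (conv n0 y).
  by rewrite -/(Gs (conv n0 y)) in nI; lra.
exists rho, y; split => //; first exact: rconv_far.
move=> A0 A0L; rewrite -/m; have [r1 rD rZ r0] := mr.
set w := poisson y (ind A0); set c := conv (rmean rho) y (ind A0).
have bw : bfun w by apply: poisson_bounded => //; exact: bfun_ind.
have w01 x : 0 <= w x <= 1.
  have [_ _ _ y0] := my.
  apply/andP; split.
    apply: y0; first exact/bfun_lshift/bfun_ind.
    by move=> z; have /andP[] := ind01 A0 (x * z)%g.
  rewrite -(mean_cst my 1); apply: (mean_le my); last first.
  - by move=> z; have /andP[] := ind01 A0 (x * z)%g.
  - exact: bfun_cst.
  - exact/bfun_lshift/bfun_ind.
have c01 : 0 <= c <= 1 by apply: m01 => //; exact: conv_mean.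
have cE : rmean rho w = c by [].
have bwc : bfun (fun x => w x - c) by apply: bfunB => //; exact: bfun_cst.
have wc0 : rmean rho (fun x => w x - c) = 0.
  rewrite (_ : (fun x => w x - c) = fun x => w x + -1 * c); last first.
    by apply/funext => x; rewrite mulN1r.
  rewrite rD//; last exact: bfun_cst.
  by rewrite (mean_cst mr) cE mulN1r subrr.
pose C A := rmean rho (fun x => poisson y (ind A) x * (w x - c)).
have bP A : bfun (poisson y (ind A)).
  by apply: poisson_bounded => //; exact: bfun_ind.
have tilt (s : R) : -1 <= s <= 1 ->
    \sum_(A <- L) (m (ind A) + s * C A) ^+ 2 <= Gs y.
  move=> /andP[s1 s2].
  pose dens x := 1 + s * (w x - c).
  have bdens : bfun dens by apply: bfunD; [exact: bfun_cst|exact: bfunZ].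
  have dens0 x : 0 <= dens x.
    have /andP[w0 w1] := w01 x; have /andP[c0 c1] := c01.
    have : `|s * (w x - c)| <= 1.
      rewrite normrM -[leRHS]mulr1 ler_pM// ler_norml; first by apply/andP; split.
      by apply/andP; split; lra.
    by rewrite /dens ler_norml => /andP[]; lra.
  pose ns f := rmean rho (fun x => f x * dens x).
  have mns : mean ns.
    split.
    - rewrite /ns (_ : (fun x => _) = fun x => 1 + s * (w x - c)); last first.
        by apply/funext => x; rewrite mul1r.
      rewrite rD; [|exact: bfun_cst|exact: bfunZ].
      by rewrite r1 rZ// wc0 mulr0 addr0.
    - move=> f h bf bh; rewrite /ns -rD; try exact: bfunM.
      by congr (rmean rho); apply/funext => x; rewrite mulrDl.
    - move=> k f bf; rewrite /ns -rZ; last exact: bfunM.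
      by congr (rmean rho); apply/funext => x; rewrite mulrA.
    - move=> f bf f0; apply: r0; first exact: bfunM.
      by move=> x; rewrite mulr_ge0.
  apply: le_trans (leG ns y mns my); rewrite le_eqVlt /q; apply/orP; left; apply/eqP.
  apply: eq_bigr => A _; congr (_ ^+ 2).
  rewrite /conv /ns /C -rZ; last exact: bfunM.
  rewrite /m /conv -rD; [|exact: bP|by apply: bfunZ; exact: bfunM].
  by congr (rmean rho); apply/funext => x; rewrite /dens; ring.
have le1 : C A0 ^+ 2 <= \sum_(A <- L) C A ^+ 2.
  by rewrite (big_rem A0)//= lerDl; apply: sumr_ge0 => ? _; exact: sqr_ge0.
have le2 : \sum_(A <- L) C A ^+ 2 <= 2 * d.
  have t1 := tilt 1; have t2 := tilt (-1).
  have {}t1 := t1 ltac:(by rewrite lexx andbT lerNl; lra).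
  have {}t2 := t2 ltac:(by rewrite lexx/=; lra).
  (* Adding the two tilted bounds cancels the cross terms. *)
  have E : \sum_(A <- L) (m (ind A) + 1 * C A) ^+ 2 +
      \sum_(A <- L) (m (ind A) + -1 * C A) ^+ 2 = 2 * q m + 2 * \sum_(A <- L) C A ^+ 2.
    by rewrite /q !mulr_sumr -!big_split/=; apply: eq_bigr => A _; ring.
  by lra.
(* For the set [A0] itself the covariance is the variance, since [w - c] has mean 0. *)
have CE : C A0 = rmean rho (fun x => (w x - c) * (w x - c)).
  have -> : (fun x => (w x - c) * (w x - c)) =
      (fun x => poisson y (ind A0) x * (w x - c) + - c * (w x - c)).
    by apply/funext => x; rewrite -/w; ring.
  rewrite rD; [|exact: bfunM|exact: bfunZ].
  by rewrite rZ// wc0 mulr0 addr0.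
rewrite -CE; have : C A0 ^+ 2 <= e ^+ 2.
  by apply: le_trans le1 _; apply: le_trans le2 _; rewrite /d; lra.
move=> le3; have := le_trans (ler_norm (C A0)) (_ : `|C A0| <= e); apply.
by rewrite -ler_sqr ?nnegrE// ?(ltW e0)// real_normK ?num_real.
Qed.

(** A linearised Cauchy-Schwarz inequality: both [2 T] and [-2 T] are dominated in real part by the
    positive operator [S], whose value is at most [2 a eta]. *)
Lemma rstate_CS rho (T : bop) psi (a eta : R) : rstate rho -> bfun psi -> 0 < eta -> 0 <= a ->
  (forall f, 2 * `|complex.Re (inner (T f) f)| <=
     a * (eta * ell2_norm f ^+ 2 + eta^-1 * ell2_norm (mult psi f) ^+ 2)) ->
  rmean rho (fun x => psi x * psi x) <= eta ^+ 2 -> `|rho T| <= a * eta.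
Proof.
move=> sr bpsi eta0 a0 bd var; have [r1 rD rZ r0] := sr.
pose M : bop := mult (fun x => psi x * psi x).
pose S : bop := (a * eta)%:C *: 1 + (a * eta^-1)%:C *: M.
have SE f : complex.Re (inner (S f) f) =
    a * (eta * ell2_norm f ^+ 2 + eta^-1 * ell2_norm (mult psi f) ^+ 2).
  rewrite /S bopDE !bopZE innerDl !innerZl raddfD/= !Re_realM.
  by rewrite bop1E Re_innerii Re_inner_mult_sqr// mulrDr !mulrA.
have rS : rho S <= 2 * (a * eta).
  rewrite /S rD !rZ r1.
  have h1 : a * eta^-1 * rho M <= a * eta^-1 * eta ^+ 2.
    by apply: ler_wpM2l var; rewrite mulr_ge0// invr_ge0 ltW.
  have h2 : a * eta^-1 * eta ^+ 2 = a * eta by field; rewrite gt_eqF.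
  by lra.
have r2 (c : R) : rho (c%:C *: T) = c * rho T by rewrite rZ.
have le (c : R) : `|c| = 2 -> c * rho T <= rho S.
  move=> c2; rewrite -r2; apply: (rstate_le sr) => f.
  rewrite SE bopZE innerZl Re_realM; apply: le_trans (bd f).
  by apply: le_trans (ler_norm _) _; rewrite normrM c2.
have := le 2 (ger0_norm (ler0n _ _)); have := le (-2).
by rewrite normrN ger0_norm// => /(_ erefl) h1 h2; rewrite ler_norml; lra.
Qed.

(* If [lambda g] is not killed by a state for which the Poisson transforms of
   [A] and [g A] are almost constant, then these constants almost agree, since
   [lambda g] conjugates the first transform into the second. *)
Lemma almost_stabilizer (rho : bop -> R) y (g : G) (A : set G) (eta : R) (z : R[i]) :
  rstate rho -> mean y -> 0 < eta ->
  (forall B, B = A \/ B = ltranslate g A ->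
    rmean rho (fun x => (poisson y (ind B) x - conv (rmean rho) y (ind B)) *
                        (poisson y (ind B) x - conv (rmean rho) y (ind B))) <= eta ^+ 2) ->
  `|rho (z *: lambda R g)| *
    `|conv (rmean rho) y (ind (ltranslate g A)) - conv (rmean rho) y (ind A)| <= 2 * normc z * eta.
Proof.
move=> sr my eta0 var; have [r1 rD rZ r0] := sr.
have [->|z0] := eqVneq z 0.
  by rewrite scale0r (rstate0 sr) normr0 mul0r normc0 mulr0 mul0r.
have nz0 : 0 < normc z.
  by rewrite lt_neqAle normc_ge0 andbT eq_sym; apply: contra_neq z0; exact: eq0_normc.
set B := ltranslate g A; set mA := conv _ y (ind A); set mB := conv _ y (ind B).
have bPA : bfun (poisson y (ind A)) by apply: poisson_bounded => //; exact: bfun_ind.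
have bPB : bfun (poisson y (ind B)) by apply: poisson_bounded => //; exact: bfun_ind.
pose psiA x := poisson y (ind A) x - mA; pose psiB x := poisson y (ind B) x - mB.
have bA : bfun psiA by apply: bfunB => //; exact: bfun_cst.
have bB : bfun psiB by apply: bfunB => //; exact: bfun_cst.
have rA : `|rho (z *: lambda R g * mult psiA)| <= normc z * eta.
  apply: (rstate_CS sr bA eta0 (ltW nz0)); last by apply: var; left.
  move=> f; set t := (normc z * eta)^-1.
  have t0 : 0 < t by rewrite invr_gt0 mulr_gt0.
  apply: le_trans (Re_inner_le _ _ t0) _.
  rewrite -scalerAl bopZE bopME ell2_normZ ell2_norm_lambda le_eqVlt; apply/orP; left.
  by apply/eqP; rewrite /t; field; rewrite !gt_eqF.
(* Here the multiplication stands on the left, so it is moved to the other side of the inner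
   product. *)
have rB : `|rho (z *: (mult psiB * lambda R g))| <= normc z * eta.
  apply: (rstate_CS sr bB eta0 (ltW nz0)); last by apply: var; right.
  move=> f; set t := eta / normc z; have t0 : 0 < t by rewrite divr_gt0.
  rewrite bopZE bopME -linearZ/= inner_mult//.
  apply: le_trans (Re_inner_le _ _ t0) _.
  rewrite ell2_normZ ell2_norm_lambda le_eqVlt; apply/orP; left.
  by apply/eqP; rewrite /t; field; rewrite !gt_eqF.
have shift x : poisson y (ind A) (g^-1 * x)%g = poisson y (ind B) x.
  rewrite /poisson; congr y; apply/funext => w; rewrite /ind -mulgA.
  congr (nat_of_bool _)%:R; apply/idP/idP => /set_mem h; apply/mem_set.
    exact/ltranslateE.
  by apply/ltranslateE.
have E : z *: lambda R g * mult psiA - z *: (mult psiB * lambda R g) =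
    (mB - mA)%:C *: (z *: lambda R g).
  rewrite -scalerAl lambda_mult// -scalerBr -mulrBl scalerA mulrC -scalerA; congr (_ *: _).
  have -> : (fun x => psiA (g^-1 * x)%g) = fun x => psiB x + (mB - mA).
    by apply/funext => x; rewrite /psiA /psiB shift; ring.
  rewrite multD//; last exact: bfun_cst.
  by rewrite addrAC subrr add0r mult_cst -scalerAl mul1r.
have : `|rho (z *: lambda R g * mult psiA) - rho (z *: (mult psiB * lambda R g))| <=
    normc z * eta + normc z * eta.
  by apply: le_trans (ler_normB _ _) _; rewrite lerD.
rewrite -(rstateB sr) E rZ normrM mulrC => le1; apply: le_trans le1 _.
by rewrite le_eqVlt; apply/orP; left; apply/eqP; ring.
Qed.

(** One state serves all pairs, by controlling the variances of all [A] and [g A] together. The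
    complex [z] stays inside because [rho] is only real linear. *)
Lemma almost_stabilizers (rho0 : bop -> R) b theta (L : seq (G * set G)) (eta : R) :
  rstate rho0 -> far_from_trace b theta rho0 -> 0 < eta ->
  exists rho m, [/\ rstate rho, far_from_trace b theta rho, fap m &
    forall p, p \in L -> forall z,
      `|rho (z *: lambda R p.1)| * `|m (ltranslate p.1 p.2) - m p.2| <= 2 * normc z * eta].
Proof.
move=> sr0 far0 eta0.
pose L' := [seq p.2 | p <- L] ++ [seq ltranslate p.1 p.2 | p <- L].
have eta20 : 0 < eta ^+ 2 by rewrite exprn_gt0.
have [rho [y [sr far my var]]] := small_variance L' sr0 far0 eta20.
exists rho, (fun A => conv (rmean rho) y (ind A)); split => //.
  by apply: mean_fap; apply: conv_mean => //; exact: rmean_mean.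
move=> p pL z; apply: almost_stabilizer => // B BE; apply: var.
rewrite mem_cat; apply/orP; case: BE => ->; [left|right].
  by apply/mapP; exists p.
by apply/mapP; exists p.
Qed.

End convolution.

(** * The recurrent subgroup as the stabiliser of a limit measure *)

Section recurrent_subgroup.
Context {R : realType} {G : groupType}.
Local Notation bop := (bop R G).

(** The limit [m] is invariant under its stabiliser [H], which is therefore amenable. If no
    non-trivial support element of [b] were conjugated by [h] into [H], the limit state would send
    the conjugate of [b] to [beta], above [theta]. *)
Lemma not_simple_recurrent : ~ Cstar_simple R G ->
  exists (H : {ptws G -> bool}) (F : seq G), [/\ amenable_subgroup R H,
    forall g, g \in F -> g != 1%g &
    forall h, exists2 g, g \in F & H (h * g * h^-1)%g].
Proof.
move=> nsimple.
have [b [beta [theta [rho0 [sr0 tb bE far0]]]]] := not_simple_witness nsimple.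
(* A constraint consists of a group element, a set and a precision. *)
pose I := ((G * set G) * nat)%type.
have /choice[P PP] (A : {fset I}) : exists P : (bop -> R) * (set G -> R),
    [/\ rstate P.1, far_from_trace b theta P.1, fap P.2 &
    forall i, i \in A -> forall z,
      `|P.1 (z *: lambda R i.1.1)| * `|P.2 (ltranslate i.1.1 i.1.2) - P.2 i.1.2| <=
      2 * normc z * i.2.+1%:R^-1].
  (* At most [i.2.+1%:R^-1] for every constraint [i] in [A]. *)
  pose eta : R := (\sum_(i <- A) i.2).+1%:R^-1.
  have eta0 : 0 < eta by rewrite invr_gt0.
  have [rho [m [sr far fm st]]] := almost_stabilizers [seq i.1 | i <- A] sr0 far0 eta0.
  exists (rho, m); split => //= i iA z; apply: le_trans (st i.1 (map_f _ iA) z) _.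
  rewrite ler_wpM2l ?mulr_ge0 ?normc_ge0// lef_pV2 ?posrE// ler_nat ltnS.
  by rewrite (big_rem i)//= leq_addr.
have [U [UU tU]] := ultra_totally I; have FF := @ultra_proper _ _ UU.
pose m (X : set G) := ulim U (fun A => (P A).2 X).
pose r (T : bop) := ulim U (fun A => (P A).1 T).
have bm X : bfun (fun A => (P A).2 X).
  by apply: bfun_ge0_le1 => A; have [_ _ fm _] := PP A; have [-> _ _] := fm; rewrite fap_le1.
have br T : bfun (fun A => (P A).1 T).
  by exists (opnorm T) => A; have [sr _ _ _] := PP A; exact: rstate_opnorm.
have fm : fap m by apply: ulim_fap => A; have [] := PP A.
have bn (f : {fset I} -> R) : bfun f -> bfun (fun x => `|f x|).
  by move=> [M fM]; exists M => x; rewrite normr_id.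
have stab z g X : r (z *: lambda R g) != 0 -> m (ltranslate g X) = m X.
  move=> rz; apply/eqP; rewrite -subr_eq0; apply: contraNT rz => mX.
  have key (n : nat) : `|r (z *: lambda R g)| * `|m (ltranslate g X) - m X| <=
      2 * normc z * n.+1%:R^-1.
    have bB := bfunB (bm (ltranslate g X)) (bm X).
    rewrite /r /m -ulimB// -!ulim_norm// -ulimM; [|exact: bn|exact: bn].
    apply: ulim_near_le; first by apply: bfunM; exact: bn.
    by apply: filterS (tU (g, X, n)) => A iA; have [_ _ _ /(_ _ iA z)] := PP A.
  rewrite -normr_eq0; apply/eqP/le_anti; rewrite normr_ge0 andbT.
  have mX0 : 0 < `|m (ltranslate g X) - m X| by rewrite normr_gt0.
  rewrite -(ler_pM2r mX0) mul0r; apply/ler_addgt0Pr => e e0; rewrite add0r.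
  pose k := 2 * normc z; have k0 : 0 <= k by rewrite mulr_ge0// normc_ge0.
  have := key (Num.truncn (k / e)); have := truncnS_gt (k / e).
  set N := _.+1%:R => Nk /le_trans; apply.
  rewrite -/k ler_pdivrMr ?ltr0n// mulrC -ler_pdivrMr//; exact: ltW.
pose H : {ptws G -> bool} := fun g => `[< forall X, m (ltranslate g X) = m X >].
have ltrM g h X : ltranslate (g * h)%g X = ltranslate g (ltranslate h X).
  apply/seteqP; split => x.
    by move=> /ltranslateE; rewrite invgM -mulgA => ?; apply/ltranslateE/ltranslateE.
  by move=> /ltranslateE/ltranslateE; rewrite mulgA -invgM => ?; apply/ltranslateE.
have ltr1 X : ltranslate 1%g X = X.
  by apply/seteqP; split => x; [move=> /ltranslateE|move=> ?; apply/ltranslateE]; rewrite invg1 mul1g.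
have sH : Defs.Sub H.
  split; first by rewrite unfold_in; apply/asboolP => X; rewrite ltr1.
  move=> x y; rewrite !unfold_in => /asboolP Hx /asboolP Hy; apply/asboolP => X.
  by rewrite ltrM Hx -Hy -ltrM mulgV ltr1.
exists H, [seq p.2 | p <- b & p.2 != 1%g]; split.
- by apply: invariant_amenable => //; exists m; split => // h /asboolP.
- by move=> g /mapP[p]; rewrite mem_filter => /andP[p1 _] ->.
move=> h; apply: contrapT => nex.
have zero p : p \in b -> p.2 != 1%g -> r (p.1 *: lambda R (h * p.2 * h^-1)%g) = 0.
  move=> pb p1; apply/eqP; apply: contraT => rp; exfalso; apply: nex; exists p.2.
    by apply: map_f; rewrite mem_filter p1.
  by apply/asboolP => X; exact: stab rp.
have rE A : (P A).1 (lambda R h * lcomb b * lambda R h^-1) =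
    beta + \sum_(p <- b | p.2 != 1%g) (P A).1 (p.1 *: lambda R (h * p.2 * h^-1)%g).
  have [sr _ _ _] := PP A; have [r1 rD rZ _] := sr.
  rewrite /lcomb mulr_sumr mulr_suml (rstate_sum sr) (bigID (fun p => p.2 == 1%g))/=.
  congr (_ + _); last first.
    by apply: eq_bigr => p _; rewrite -scalerAr -scalerAl -!lambdaM.
  rewrite -[RHS]mulr1 -r1 -rZ -bE scaler_suml -[in RHS]big_filter (rstate_sum sr) big_filter.
  apply: eq_bigr => p /eqP pE; congr ((P A).1 _); rewrite pE.
  by rewrite -scalerAr -scalerAl -!lambdaM mulg1 mulgV lambda1.
have : r (lambda R h * lcomb b * lambda R h^-1) <= theta.
  apply: ulim_near_le => //; apply: (@filterE _ U) => A /=; have [_ far _ _] := PP A.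
  exact: le_trans (ler_norm _) (far h).
have -> : r (lambda R h * lcomb b * lambda R h^-1) = beta.
  rewrite /r (_ : (fun A => _) = fun A => beta +
    \sum_(p <- [seq p <- b | p.2 != 1%g]) (P A).1 (p.1 *: lambda R (h * p.2 * h^-1)%g)).
    rewrite ulimD//; [|exact: bfun_cst|by apply: bfun_sum => p; exact: br].
    rewrite ulim_cst ulim_sum; last by move=> p; exact: br.
    by rewrite big_filter big_seq_cond big1 ?addr0// => p /andP[pb p1]; exact: zero.
  by apply/funext => A; rewrite rE big_filter.
by rewrite leNgt tb.
Qed.

End recurrent_subgroup.

(** * Stationary measures on the space of amenable subgroups *)

Section stationary_means.
Context {R : realType} {G : groupType}.
Variables (mu : G -> R) (pmu : prob mu).
Implicit Types (f phi : G -> R) (n y : (G -> R) -> R) (A : {fset G}).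

Let ps f A := partial_sum (fun g => mu g * f g) A.

Let mu0 g : 0 <= mu g. Proof. by have [] := pmu. Qed.

Let ps_mu1 A : partial_sum mu A <= 1.
Proof. by have [_ mu1] := pmu; rewrite -lee_fin -mu1 partial_sum_le_esum. Qed.

(** Monotonicity of partial sums, applied to the nonnegative functions [M + f] and [M - f]. *)
Lemma partial_sum_tail f M A B : (forall g, `|f g| <= M) -> (A `<=` B)%fset ->
  `|ps f B - ps f A| <= M * (1 - partial_sum mu A).
Proof.
move=> fM AB.
have M0 : 0 <= M by exact: le_trans (normr_ge0 _) (fM 1%g).
have split_sum (c : R) D : partial_sum (fun g => mu g * (M + c * f g)) D =
    M * partial_sum mu D + c * ps f D.
  rewrite /ps !partial_sumE !mulr_sumr -big_split/=; apply: eq_bigr => g _.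
  by ring.
have mono (c : R) : `|c| = 1 -> M * partial_sum mu A + c * ps f A <=
    M * partial_sum mu B + c * ps f B.
  move=> c1; rewrite -!split_sum; apply: partial_sum_mono => // g.
  apply: mulr_ge0 => //; have : `|c * f g| <= M by rewrite normrM c1 mul1r.
  by rewrite ler_norml => /andP[]; lra.
have h1 := mono 1 (normr1 _); have h2 := mono (-1) (normrN1 _).
have h3 : M * partial_sum mu B <= M * 1 by apply: ler_wpM2l.
rewrite ler_norml; move: (ps f A) (ps f B) h1 h2 h3 => a b; rewrite mulrBr.
move: (M * _) (M * partial_sum mu B) (M * 1) => x z t h1 h2 h3.
by apply/andP; split; lra.
Qed.

Lemma partial_sum_weighted_bfun f : bfun f -> bfun (ps f).
Proof.
move=> [M fM]; exists M => A; have := partial_sum_tail fM (fsub0set A).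
rewrite /ps [in X in _ - X]partial_sumE big_seq_fset0 [partial_sum mu _]partial_sumE.
by rewrite big_seq_fset0 !subr0 mulr1.
Qed.

Lemma exists_partial_sum_ge (e : R) : 0 < e -> exists A, 1 - partial_sum mu A <= e.
Proof.
have [_ mu1] := pmu; move=> e0.
have := @cvg_partial_sum _ _ mu 1 mu0 mu1.
move=> /cvgrPdist_le/(_ _ e0)[A _ /(_ A)] h; exists A.
by apply: le_trans (h _); [exact: ler_norm|exact: fsubset_refl].
Qed.

(** [n] is integration against [mu]. Convolution by a general mean need not commute with the
    ultralimit defining [y]; here it does because the tails of [mu] are small uniformly in the
    integrand. *)
Lemma stationary_mean : exists n, [/\ mean n,
  forall f, bfun f -> (forall g, 0 <= f g) ->
    (\esum_(g in [set: G]) (mu g * f g)%:E = (n f)%:E)%E &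
  exists2 y, mean y & forall phi, bfun phi -> conv n y phi = y phi].
Proof.
have [U [UU tU]] := ultraFilterLemma (@totally_filter G).
pose n f := ulim U (ps f).
have n_cvg f l : ps f @ totally --> l -> n f = l.
  by move=> fl; apply: ulim_eq => B /fl; exact: tU.
have n_tail f M A : (forall g, `|f g| <= M) ->
    `|n f - ps f A| <= M * (1 - partial_sum mu A).
  move=> fM; have bf : bfun (ps f) by apply: partial_sum_weighted_bfun; exists M.
  have UA : U [set B | (A `<=` B)%fset] by apply: tU; exists A.
  rewrite ler_distl; apply/andP; split.
    apply: ulim_near_ge => //; apply: filterS UA => B /= /(partial_sum_tail fM).
    by rewrite ler_distl => /andP[].
  apply: ulim_near_le => //; apply: filterS UA => B /= /(partial_sum_tail fM).
  by rewrite ler_distl => /andP[].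
have mn : mean n.
  split.
  - apply: n_cvg; have [_ mu1] := pmu; have := @cvg_partial_sum _ _ mu 1 mu0 mu1.
    rewrite (_ : partial_sum mu = ps (fun=> 1))//; apply/funext => A.
    by rewrite /ps !partial_sumE; apply: eq_bigr => g _; rewrite mulr1.
  - move=> f h bf bh; rewrite /n -ulimD; try exact: partial_sum_weighted_bfun.
    congr ulim; apply/funext => A; rewrite /ps !partial_sumE -big_split.
    by apply: eq_bigr => g _; rewrite mulrDr.
  - move=> c f bf; rewrite /n -ulimZ; last exact: partial_sum_weighted_bfun.
    congr ulim; apply/funext => A; rewrite /ps !partial_sumE mulr_sumr.
    by apply: eq_bigr => g _; rewrite mulrCA.
  - move=> f bf f0; have [_ _ _] := @ulim_mean R _ _ UU; apply.
      exact: partial_sum_weighted_bfun.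
    by move=> A; rewrite /ps partial_sumE; apply: sumr_ge0 => g _; rewrite mulr_ge0.
exists n; split => //.
  move=> f bf f0; have muf0 g : 0 <= mu g * f g by rewrite mulr_ge0.
  have [M fM] := bf; have M0 : 0 <= M by exact: le_trans (normr_ge0 _) (fM 1%g).
  have fin : (\esum_(g in [set: G]) (mu g * f g)%:E \is a fin_num)%E.
    rewrite ge0_fin_numE; last by apply: esum_ge0 => g _; rewrite lee_fin.
    apply: (@le_lt_trans _ _ (\esum_(g in [set: G]) (M * mu g)%:E)%E).
      apply: le_esum => g _; rewrite lee_fin mulrC ler_wpM2r//.
      exact: le_trans (ler_norm _) (fM g).
    by have [_ mu1] := pmu; rewrite esumZl// mu1 mule1 ltry.
  rewrite -(fineK fin); congr (_%:E); symmetry; apply: n_cvg.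
  by apply: cvg_partial_sum => //; rewrite fineK.
pose Y k := iter k (conv n) (fun phi => phi 1%g).
have mY k : mean (Y k).
  elim: k => [|k IH]; last exact: conv_mean.
  by split => // f bf; apply.
pose C (N : nat) phi := N.+1%:R^-1 * \sum_(k < N.+1) Y k phi.
have C_bound N phi M : (forall g, `|phi g| <= M) -> `|C N phi| <= M.
  move=> pM; rewrite /C normrM ger0_norm ?invr_ge0// mulrC ler_pdivrMr// .
  apply: le_trans (ler_norm_sum _ _ _) _.
  apply: (@le_trans _ _ (\sum_(k < N.+1) M)).
    by apply: ler_sum => k _; apply: (mean_norm (mY k)) => //; exists M.
  by rewrite sumr_const card_ord mulr_natr.
have bC phi : bfun phi -> bfun (C^~ phi).
  by move=> [M pM]; exists M => N; exact: C_bound.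
(* The difference telescopes to the terms of index 0 and [N.+1]. *)
have C_conv N phi M : (forall g, `|phi g| <= M) ->
    `|conv n (C N) phi - C N phi| <= 2 * M * harmonic N.
  move=> pM; have bp : bfun phi by exists M.
  have mean_sum (l : nat) (F : nat -> G -> R) : (forall i, bfun (F i)) ->
      n (fun g => \sum_(i < l) F i g) = \sum_(i < l) n (F i).
    have [_ nD _ _] := mn; move=> bF; elim: l => [|l IH].
      rewrite big_ord0 -[RHS](mean_cst mn); congr n; apply/funext => g.
      by rewrite big_ord0.
    rewrite big_ord_recr/= -IH -nD//; last exact: bfun_sum.
    by congr n; apply/funext => g; rewrite big_ord_recr.
  have -> : conv n (C N) phi = N.+1%:R^-1 * \sum_(k < N.+1) Y k.+1 phi.
    rewrite /conv /poisson /C; have [_ _ nZ _] := mn.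
    rewrite nZ; last first.
      by apply: bfun_sum => k; exact: (poisson_bounded (mY k) bp).
    congr (_ * _); rewrite (mean_sum _ (fun k => poisson (Y k) phi))//.
    by move=> k; exact: (poisson_bounded (mY k) bp).
  rewrite /C -mulrBr -sumrB -(big_mkord xpredT (fun k => Y k.+1 phi - Y k phi)).
  rewrite telescope_sumr//.
  rewrite normrM ger0_norm ?invr_ge0// mulrC /harmonic ler_wpM2r ?invr_ge0//.
  rewrite (le_trans (ler_normB _ _))// mulr_natl.
  have h k : `|Y k phi| <= M by exact: (mean_norm (mY k)).
  by rewrite mulr2n lerD.
have [V [VV eV]] := ultraFilterLemma (@eventually_filter).
have bps phi A : bfun phi -> bfun (fun N => ps (poisson (C N) phi) A).
  move=> [M pM]; exists (M * partial_sum mu A) => N.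
  rewrite /ps !partial_sumE mulr_sumr (le_trans (ler_norm_sum _ _ _))//.
  apply: ler_sum => g _; rewrite normrM ger0_norm// mulrC ler_wpM2r//.
  by apply: C_bound.
exists (fun phi => ulim V (C^~ phi)).
  split.
  - rewrite -[RHS](ulim_cst VV); congr ulim; apply/funext => N.
    rewrite /C (eq_bigr (fun=> 1)); last by move=> k _; exact: mean_cst.
    by rewrite sumr_const card_ord mulVf.
  - move=> f h bf bh; rewrite -ulimD; try exact: bC.
    congr ulim; apply/funext => N; rewrite /C -mulrDr -big_split/=; congr (_ * _).
    by apply: eq_bigr => k _; have [_ YD _ _] := mY k; exact: YD.
  - move=> c f bf; rewrite -ulimZ; last exact: bC.
    congr ulim; apply/funext => N; rewrite /C [RHS]mulrCA; congr (_ * _); rewrite mulr_sumr.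
    by apply: eq_bigr => k _; have [_ _ YZ _] := mY k; exact: YZ.
  - move=> f bf f0; have [_ _ _] := @ulim_mean R _ _ VV; apply; first exact: bC.
    move=> N; rewrite /C mulr_ge0 ?invr_ge0//; apply: sumr_ge0 => k _.
    by have [_ _ _] := mY k; apply.
move=> phi bp; have [M pM] := bp; set y := fun _ => _.
have M0 : 0 <= M by exact: le_trans (normr_ge0 _) (pM 1%g).
have yM (g : G) : `|poisson y phi g| <= M.
  rewrite /poisson /y -ulim_norm; last by apply: bC; exact: bfun_lshift.
  apply: ulim_near_le; last by apply: (@filterE _ V) => N; exact: C_bound.
  exists M => N; rewrite normr_id; exact: C_bound.
apply/eqP; rewrite -subr_eq0 -normr_le0; apply/ler_addgt0Pl => e e0; rewrite addr0.
have M4 : 0 < 4 * (M + 1) by rewrite mulr_gt0// ltr_wpDl.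
(* The errors below total [3 * (M * d)]; [M + 1] avoids dividing by 0. *)
have [d [d0 dE]] : exists d, 0 < d /\ d * (4 * (M + 1)) = e.
  by exists (e / (4 * (M + 1))); rewrite divr_gt0// divfK// gt_eqF.
have Md : 4 * (M * d) <= e.
  rewrite -dE (_ : d * _ = 4 * (M * d) + 4 * d); last by ring.
  by rewrite lerDl mulr_ge0// ltW.
(* Outside [A] the mass of [mu] is at most [d], and the finite sum over [A] commutes with the limit
   along [V]. *)
have [A Ad] := exists_partial_sum_ge d0.
have tail f : (forall g, `|f g| <= M) -> `|n f - ps f A| <= M * d.
  by move=> fM; apply: le_trans (n_tail _ _ _ fM) _; rewrite ler_wpM2l.
have psy : ps (poisson y phi) A = ulim V (fun N => ps (poisson (C N) phi) A).
  have bs g : bfun (C^~ (fun x => phi (g * x)%g)) by apply: bC; exact: bfun_lshift.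
  rewrite (_ : ps _ A = \sum_(g <- A) ulim V (fun N => mu g * poisson (C N) phi g)).
    rewrite -ulim_sum//; last by move=> g; exact/bfunZ/bs.
    by congr ulim; apply/funext => N; rewrite /ps partial_sumE.
  by rewrite /ps partial_sumE; apply: eq_bigr => g _; rewrite ulimZ//; exact: bs.
have near : `|ps (poisson y phi) A - y phi| <= M * d + M * d.
  rewrite psy /y -ulimB//; [|exact: bps|exact: bC].
  have bB := bfunB (bps _ A bp) (bC _ bp).
  rewrite -ulim_norm//; apply: ulim_near_le.
    by have [M' bM'] := bB; exists M' => N; rewrite normr_id.
  have : V [set N | 2 * M * harmonic N <= M * d].
    apply: eV; have := @cvg_harmonic R => /cvgrPdist_le h.
    have [k _ kP] := h (d / 2) (divr_gt0 d0 (ltr0n _ 2)).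
    exists k => // N /= /kP; rewrite sub0r normrN ger0_norm ?harmonic_ge0//.
    move=> /(ler_wpM2l (mulr_ge0 (ler0n R 2) M0)) /le_trans; apply.
    by rewrite -mulrA mulrCA [2 * _]mulrC divfK.
  apply: filterS => N /= hN.
  have t1 : `|conv n (C N) phi - ps (poisson (C N) phi) A| <= M * d.
    by apply: tail => g; exact: C_bound.
  rewrite -(subrK (conv n (C N) phi) (ps _ A)) -addrA (le_trans (ler_normD _ _))//.
  by rewrite lerD//; [rewrite distrC|exact: le_trans (C_conv N phi M pM) hN].
rewrite -(subrK (ps (poisson y phi) A) (conv n y phi)) -addrA (le_trans (ler_normD _ _))//.
have t2 : `|conv n y phi - ps (poisson y phi) A| <= M * d by exact: tail.
have := lerD t2 near; have : 0 <= M * d by rewrite mulr_ge0// ltW.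
by move=> Md0 h; apply: (le_trans h); move: Md Md0; move: (M * d) => x; lra.
Qed.

Lemma stationary_fap : exists m : set G -> R, fap m /\
  forall A : set G, (\esum_(g in [set: G]) (mu g * m (ltranslate g^-1 A))%:E = (m A)%:E)%E.
Proof.
have [n [mn nE [y my yE]]] := stationary_mean.
exists (fun A : set G => y (ind A)); split; first exact: mean_fap.
move=> A; rewrite -(yE _ (bfun_ind A)) /conv -nE; last 2 first.
- exact: poisson_bounded my (bfun_ind A).
- move=> g; have [_ _ _] := my; apply; first exact/bfun_lshift/bfun_ind.
  by move=> x; have /andP[] := @ind01 R _ A (g * x)%g.
apply: eq_esum => g _; congr (_ * y _)%:E; apply/funext => x.
rewrite /ind; congr (nat_of_bool _)%:R; apply/idP/idP => /set_mem.
  by move=> /ltranslateE; rewrite invgK => ?; exact/mem_set.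
by move=> ?; apply/mem_set/ltranslateE; rewrite invgK.
Qed.

End stationary_means.

(** * From clopen contents to Borel measures on the space of amenable subgroups *)

Section clopen_extension.
Context {R : realType} (T : ptopologicalType).

(** A copy of [T] whose measurable sets are the clopen ones, kept apart from a Borel structure that
    [T] may carry. *)
Definition clopen_space : Type := T.

HB.instance Definition _ := Pointed.copy clopen_space T.
HB.instance Definition _ := @isAlgebraOfSets.Build default_measure_display clopen_space
  (@clopen T) clopen0 clopenU (fun A => @clopenC T A A).

Variables (p : set T -> R) (fp : fap p).
Hypothesis cT : compact [set: T].

Definition clopen_content (A : set clopen_space) : \bar R := (p A)%:E.

Let p0 : clopen_content set0 = 0%E.
Proof. by rewrite /clopen_content -setCT fap_setC//; have [_ -> _] := fp; rewrite subrr. Qed.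

Let p_ge0 A : (0 <= clopen_content A)%E.
Proof. by have [h _ _] := fp; rewrite lee_fin. Qed.

(* By compactness, a countable disjoint union of clopen sets is clopen only if all but
   finitely many of them are empty. *)
Let p_sigma_additive : semi_sigma_additive clopen_content.
Proof.
move=> F mF tF mUF.
have cU : compact (\bigcup_n F n : set T) by apply: subclosed_compact cT _ => //; case: mUF.
move: cU; rewrite compact_cover => /(_ nat setT F).
case=> [i _|//|D _ FD]; first by case: (mF i).
pose N := (\max_(i <- D) i).+1.
have F0 n : (N <= n)%N -> F n = set0.
  move=> Nn; apply/seteqP; split => // x Fx.
  have [|i iD Fi] := FD x; first by exists n.
  have ni : n = i by apply: tF => //; exists x.
  by move: Nn; rewrite ni ltnNge (leq_bigmax_seq _ iD).
have pE n : (\sum_(0 <= i < n) clopen_content (F i) =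
    clopen_content (\big[setU/set0]_(0 <= i < n) F i))%E.
  elim: n => [|n IH]; first by rewrite !big_geq// p0.
  rewrite !big_nat_recr//= IH /clopen_content -EFinD.
  have [_ _ ->] := fp; first by [].
  apply/seteqP; split => // x [+ Fn]; rewrite big_mkord -bigcup_mkord => -[i /= iN Fi].
  have ni : n = i by apply: tF => //; exists x.
  by move: iN; rewrite ni ltnn.
apply: cvg_near_cst; exists N => // n /= Nn; rewrite pE; congr clopen_content.
rewrite big_mkord -bigcup_mkord; apply/seteqP; split => x [i Pi Fi]; exists i => //=.
by rewrite ltnNge; apply/negP => ni; move: Fi; rewrite F0// (leq_trans Nn).
Qed.

HB.instance Definition _ := isMeasure.Build _ clopen_space R clopen_content
  p0 p_ge0 p_sigma_additive.

Lemma clopen_extension :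
  exists nu : {measure set (g_sigma_algebraType (@measurable _ clopen_space)) -> \bar R},
    forall A, clopen A -> nu A = (p A)%:E.
Proof.
exists (measure_extension clopen_content) => A cA /=.
by rewrite /measure_extension measurable_mu_extE.
Qed.

End clopen_extension.

Section Suba_topology.
Context {R : realType} {G : groupType}.
Local Notation Suba := (Suba R G).

Lemma Suba_cvg (F : set_system Suba) (K : Suba) : Filter F ->
  (forall g, F [set K' | (val K' : G -> bool) g = (val K : G -> bool) g]) -> F --> K.
Proof.
move=> FF FK A /=; rewrite nbhsE => -[B [oB BK] BA]; apply: filterS BA _.
have [V oV VB] : exists2 V : set {ptws G -> bool}, open V &
    (@set_val _ (@amenable_subgroup R G)) @^-1` V = B by exact: oB.
have cV : {ptws, (@set_val _ (@amenable_subgroup R G)) @ F --> (val K : G -> bool)}.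
  apply/cvg_sup => g W; rewrite nbhsE => -[B' [[C _ <-] Cg] CW]; apply: filterS CW _.
  suff : F [set K' | C ((val K' : G -> bool) g)] by [].
  by apply: filterS (FK g) => K' /= ->.
by rewrite -VB; apply: cV; apply: open_nbhs_nbhs; split => //; rewrite -VB in BK.
Qed.

(** The limit of an ultrafilter consists of the [g] lying in almost every subgroup. A finite part of
    it lies in a single amenable subgroup, whose invariant measure feeds [invariant_compact]. *)
Lemma compact_Suba : compact [set: Suba].
Proof.
rewrite compact_ultra => F UF _; have FF := @ultra_proper _ _ UF.
pose K : {ptws G -> bool} := fun g => `[< F (@cyl R G g) >].
have sK : Defs.Sub K.
  split; first by apply/asboolP; apply: (@filterE _ F) => K'; have [[]] := set_mem (valP K').
  move=> x y; rewrite !unfold_in => /asboolP Fx /asboolP Fy; apply/asboolP.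
  apply: filterS2 Fx Fy => K' K'x K'y; have [[_ HF] _] := set_mem (valP K').
  exact: HF K'x K'y.
have aK : amenable_subgroup R K.
  apply: invariant_amenable => //; apply: (@invariant_compact R G [set g | K g]) => S SK.
  have : F (\bigcap_(h in [set` S]) @cyl R G h).
    by apply: filter_bigI => h /SK /asboolP.
  move=> /filter_ex[K' K'S]; have [m [fm _ mK]] := amenable_invariant (set_mem (valP K')).
  by exists m; split => // h /K'S; exact: mK.
exists (mk_Suba aK); split => //=; apply: Suba_cvg => g.
have [Fg|Fg] := @in_ultra_setVsetC _ F (@cyl R G g) UF.
  have Kg : K g by apply/asboolP.
  by apply: filterS Fg => K' K'g; rewrite /= Kg.
apply: filterS (Fg) => K' /negP/negbTE K'g; rewrite /= [LHS]K'g; apply/esym/asboolP => Fg'.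
by move: Fg' => /(filterI Fg)/filter_ex[x []].
Qed.

Lemma continuous_Suba_act g : continuous (@Suba_act R G g).
Proof.
move=> K; have FK : Filter (Suba_act g @ nbhs K).
  by apply: fmap_filter; exact: nbhs_filter.
apply: Suba_cvg => x /=.
apply: open_nbhs_nbhs; split => //.
exact: (@open_eval R G (x ^ g)%g [set b | b = _]).
Qed.

Lemma clopen_cyl g : clopen (@cyl R G g).
Proof.
split; first exact: (@open_eval R G g [set b | is_true b]).
rewrite -openC; exact: (@open_eval R G g [set b | ~ is_true b]).
Qed.

Lemma measurable_Suba_act g : measurable_fun setT (@Suba_act R G g).
Proof.
apply: (@measurability _ _ _ _ _ _ (@open Suba)) => // _ [A oA <-]; rewrite setTI.
apply: measurable_open; apply: open_comp => // K _; exact: continuous_Suba_act.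
Qed.

Lemma Suba_actM g h (K : Suba) : Suba_act g (Suba_act h K) = Suba_act (g * h)%g K.
Proof. by apply: val_inj; apply/funext => x; rewrite /= /conj_subgroup conjgM. Qed.

Hypothesis countG : countable [set: G].

(** An open set is the union over [n] of the sets of [K] whose neighbourhood [B n K] it contains;
    each depends on finitely many coordinates, hence is clopen. *)
Lemma open_sub_sigma_clopen : @open Suba `<=` <<s (@clopen Suba) >>.
Proof.
have /countable_injP[e /in2TT einj] := countG.
pose B n (K : Suba) : set Suba :=
  [set K' | forall g, (e g < n)%N -> (val K' : G -> bool) g = (val K : G -> bool) g].
have nB n K : nbhs K (B n K).
  have fin : finite_set [set g | (e g < n)%N].
    have := @finite_preimage _ _ `I_n e; apply; last exact: finite_II.
    by move=> x y _ _; exact: einj.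
  apply: (@filterS _ _ _ (\bigcap_(g in [set` fset_set [set g | (e g < n)%N]])
      [set K' : Suba | (val K' : G -> bool) g = (val K : G -> bool) g])).
    by move=> K' K'K g gn; apply: K'K; rewrite /= in_fset_set// inE.
  apply: filter_bigI => g _; apply: open_nbhs_nbhs; split => //.
  exact: (@open_eval R G g [set b | b = _]).
have open_local (n : nat) (A : set Suba) :
    (forall K K', B n K K' -> A K -> A K') -> open A.
  move=> AB; rewrite openE => K AK; rewrite /interior; apply: filterS (nB n K) => K' K'K.
  exact: AB K'K AK.
have clopen_local n A : (forall K K', B n K K' -> A K -> A K') -> clopen A.
  move=> AB; split; first exact: open_local AB.
  rewrite -openC; apply: (open_local n) => K K' K'K nAK AK'; apply: nAK.
  by apply: AB AK' => g gn; rewrite K'K.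
move=> A oA.
have -> : A = \bigcup_n [set K | B n K `<=` A].
  apply/seteqP; split => [K AK|K [n _]]; last by apply.
  have FF : Filter (filter_from setT (B^~ K)).
    apply: filter_from_filter; first by exists 0.
    move=> i j _ _; exists (maxn i j) => // K' K'K.
    by split => g gi; apply: K'K; rewrite leq_max gi ?orbT.
  have cK : filter_from setT (B^~ K) --> K.
    by apply: Suba_cvg => g; exists (e g).+1 => // K'; apply.
  have [n _ BA] : filter_from setT (B^~ K) A by apply: cK; apply: open_nbhs_nbhs.
  by exists n.
apply: sigma_algebra_bigcup => n; apply: sub_sigma_algebra; apply: (clopen_local n).
move=> K K' K'K BA K'' K''K'; apply: BA => g gn.
by rewrite K''K'// K'K.
Qed.

Lemma measurable_Suba_clopen : @measurable _ Suba = <<s (@clopen Suba) >>.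
Proof.
apply/seteqP; split => A.
  apply: smallest_sub; first exact: smallest_sigma_algebra.
  exact: open_sub_sigma_clopen.
apply: smallest_sub; first exact: sigma_algebra_measurable.
by move=> B [oB _]; exact: measurable_open.
Qed.

End Suba_topology.

Section borel_extension.
Context {R : realType} {G : groupType} (countG : countable [set: G]).
Local Notation Suba := (Suba R G).
Variables (p : set Suba -> R) (fp : fap p).
Variable nu0 : {measure set (g_sigma_algebraType (@measurable _ (clopen_space Suba))) -> \bar R}.
Hypothesis nu0p : forall A : set Suba, clopen A -> nu0 A = (p A)%:E.

(** The same set function, retyped to the Borel structure of [Suba]; the sigma-algebras agree by
    [measurable_Suba_clopen]. *)
Definition borel_measure (A : set Suba) : \bar R := nu0 A.

Let borel0 : borel_measure set0 = 0%E.
Proof. exact: measure0. Qed.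

Let borel_ge0 A : (0 <= borel_measure A)%E.
Proof. exact: measure_ge0. Qed.

Let borel_sigma : semi_sigma_additive borel_measure.
Proof.
rewrite /semi_sigma_additive (@measurable_Suba_clopen R G countG) => F mF tF mUF.
exact: (@measure_semi_sigma_additive _ _ _ nu0 F).
Qed.

HB.instance Definition _ := isMeasure.Build _ Suba R borel_measure
  borel0 borel_ge0 borel_sigma.

Let borelT : borel_measure setT = 1%E.
Proof. by rewrite /borel_measure nu0p; [have [_ -> _] := fp|exact: clopenT]. Qed.

HB.instance Definition _ := Measure_isProbability.Build _ Suba R borel_measure borelT.

Lemma borel_extension : exists nu : probability Suba R,
  forall A, clopen A -> nu A = (p A)%:E.
Proof. by exists borel_measure => A /nu0p. Qed.

End borel_extension.

Section stationary_measures.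
Context {R : realType} {G : groupType} (countG : countable [set: G]).
Local Notation Suba := (Suba R G).

Lemma clopen_probability (p : set Suba -> R) : fap p ->
  exists nu : probability Suba R, forall A, clopen A -> nu A = (p A)%:E.
Proof.
move=> fp; have [nu0 nu0p] := clopen_extension fp (@compact_Suba R G).
exact: (borel_extension countG fp nu0p).
Qed.

Lemma esum_exchange (I J : choiceType) (a : I -> J -> \bar R) :
  (forall i j, 0 <= a i j)%E ->
  (\esum_(i in [set: I]) \esum_(j in [set: J]) a i j =
   \esum_(j in [set: J]) \esum_(i in [set: I]) a i j)%E.
Proof.
move=> a0; rewrite !esum_esum//.
rewrite (reindex_esum ([set: J] `*`` fun=> [set: I]) _ (fun k => (k.2, k.1)))//.
split => [//|[i j] [i' j'] _ _ [-> ->]//|[i j] _].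
by exists (j, i).
Qed.

(** A pi-lambda argument: complements use that [mu] has mass 1, disjoint unions an exchange of
    nonnegative sums. *)
Lemma stationary_of_clopen (mu : G -> R) (nu : probability Suba R) : prob mu ->
  (forall A, clopen A ->
    (\esum_(g in [set: G]) ((mu g)%:E * nu (Suba_act g @^-1` A)) = nu A)%E) ->
  stationary_measure mu nu.
Proof.
move=> [mu0 mu1] nuC A mA; rewrite /pushforward.
have mact g B : measurable B -> measurable (@Suba_act R G g @^-1` B).
  by move=> mB; rewrite -[X in measurable X]setTI; exact: measurable_Suba_act.
have ge0 g B : (0 <= (mu g)%:E * nu (Suba_act g @^-1` B))%E by rewrite mule_ge0// lee_fin.
pose P (B : set Suba) :=
  (\esum_(g in [set: G]) ((mu g)%:E * nu (Suba_act g @^-1` B)) = nu B)%E.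
have PT : P setT.
  rewrite /P [RHS]probability_setT -[RHS]mu1; apply: eq_esum => g _.
  by rewrite preimage_setT probability_setT mule1.
apply: (@dynkin_induction _ Suba (@clopen Suba) P) => //.
- exact: measurable_Suba_clopen.
- exact: clopenI.
- move=> B mB PB; rewrite /P.
  have fB : nu B \is a fin_num by exact: fin_num_measure.
  have : (nu B + \esum_(g in [set: G]) ((mu g)%:E * nu (Suba_act g @^-1` (~` B))) = 1)%E.
    rewrite -{1}PB -esumD// -[RHS]mu1; apply: eq_esum => g _.
    have mX := mact g B mB; rewrite preimage_setC probability_setC//.
    rewrite -[nu (Suba_act g @^-1` B)]fineK ?fin_num_measure//.
    by rewrite -EFinB -!EFinM -EFinD mulrBr mulr1 addrC subrK.
  rewrite probability_setC// => <-.
  by rewrite [(nu B + _)%E]addeC addeK.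
- have bigE (F : nat -> set Suba) : (forall k, measurable (F k)) -> trivIset setT F ->
      (nu (\bigcup_k F k) = \sum_(0 <= k <oo) nu (F k))%E.
    by move=> mF tF; rewrite measure_bigcup//; apply: eq_eseriesl => k; rewrite in_setT.
  move=> F mF tF PF; rewrite /P bigE//.
  rewrite (eq_eseriesr (fun k _ => esym (PF k))) nneseries_esumT; last first.
    by move=> k; apply: esum_ge0 => g _.
  rewrite esum_exchange//; apply: eq_esum => g _.
  rewrite -nneseries_esumT// nneseriesZl//; congr (_ * _)%E.
  rewrite preimage_bigcup bigE//; first by move=> k; exact: mact.
  apply/trivIsetP => i j _ _ ij; move/trivIsetP: tF => /(_ i j I I ij) Fij.
  by rewrite -preimage_setI Fij preimage_set0.
- by rewrite -measurable_Suba_clopen.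
Qed.

Lemma not_simple_stationary (mu : G -> R) : prob mu -> ~ Cstar_simple R G ->
  ~ unique_stationary_dirac mu.
Proof.
move=> pmu /not_simple_recurrent[H [F [aH F1 HF]]] [_ uniq].
have [M [fM statM]] := stationary_fap pmu; have [M0 M1 MD] := fM.
(* Pulls sets back along the orbit map of [H], carrying [M] from [G] to the space of subgroups. *)
pose orb (A : set Suba) : set G := [set h | A (Suba_act h (mk_Suba aH))].
have fp : fap (M \o orb).
  split => [A|//|A B AB] /=; first exact: M0.
  rewrite -MD//; apply/seteqP; split => // h [Ah Bh].
  by have : (A `&` B) (Suba_act h (mk_Suba aH)) by []; rewrite AB.
have [nu nuM] := clopen_probability fp.
have nu_stat : stationary_measure mu nu.
  apply: stationary_of_clopen => // A cA; rewrite nuM//= -statM.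
  apply: eq_esum => g _; rewrite nuM/=; last first.
    by apply: preimage_clopen => //; exact: continuous_Suba_act.
  rewrite -EFinM; congr (_ * M _)%:E; apply/seteqP; split => h.
    by rewrite /orb /= Suba_actM => Ah; apply/ltranslateE; rewrite invgK.
  by move=> /ltranslateE; rewrite invgK /orb/= Suba_actM.
pose W : set Suba := \big[setU/set0]_(g <- F) cyl g.
have WE K : W K <-> exists2 g, g \in F & (val K : G -> bool) g.
  by rewrite /W -bigcup_seq; split => -[g gF Kg]; exists g.
have cW : clopen W.
  apply: big_ind => [|A B|g _]; [exact: clopen0|exact: clopenU|exact: clopen_cyl].
have : nu W = 1%E.
  rewrite nuM//= -M1; congr (M _)%:E; apply/seteqP; split => // h _; apply/WE.
  (* The inverse appears because [g] lies in the conjugate of [H] by [h] when [h^-1 * g * h] lies in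
     [H]. *)
  have [g gF Hg] := HF h^-1%g; exists g => //.
  by rewrite invgK -mulgA -conjgE in Hg.
rewrite uniq//; last by apply: measurable_open; case: cW.
rewrite /dirac_trivial/= /dirac indicE memNset; first by move=> /eqP; rewrite eqe eq_sym oner_eq0.
by move=> /WE[g /F1 /negbTE g1]; rewrite /= g1.
Qed.

End stationary_measures.

Theorem corollary5p7 (R : realType) (G : groupType)
    (countG : countable [set: G]) :
  (forall mu : G -> R, prob mu ->
     Cstar_simple_measure mu -> unique_stationary_dirac mu) /\
  (~ Cstar_simple R G ->
     forall mu : G -> R, prob mu -> ~ unique_stationary_dirac mu).
Proof.
split=> [mu|ns mu pmu]; first exact: Cstar_simple_measure_unique.
exact: not_simple_stationary.
Qed.
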